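(* Let $\alpha>0$ and let $m\ge 1$ be an integer. Let $u^{0}\in \mathcal{X}^{0}(\mathbb{R}^{3})$ be a divergence-free vector field and let $$u\in \mathcal{C}([0,T^* ),\mathcal{X}^{0}(\mathbb{R}^{3}))\cap L^{1}_{\mathrm{loc}}([0,T^* ),\mathcal{X}^{2}(\mathbb{R}^{3}))$$ be the maximal solution of the problem $(NSE_M)$ with initial datum $u^0$. Then, for all $t\in[0,T^* )$, $$\|u(t)\|_{\mathcal{X}^0}\leq \|u^0\|_{\mathcal{X}^0}\exp\Big(\int_0^t \Big(\tfrac{1}{2}\|u(z)\|_{\mathcal{X}^0}^2+\alpha \|u(z)\|_{\mathcal{X}^0}^{2m}\Big)dz\Big).$$
   Context: The Fourier transform is $\widehat f(\xi)=\mathcal F(f)(\xi)=\int_{\mathbb{R}^3}e^{-ix\cdot\xi}f(x)\,dx$ (extended to tempered distributions). For $\rho\in\mathbb{R}$, $$\mathcal{X}^{\rho}(\mathbb{R}^3)=\Big\{f\in\mathcal{S}'(\mathbb{R}^{3}):\ \widehat f\in L^1_{\mathrm{loc}}(\mathbb{R}^3),\ \|f\|_{\mathcal{X}^\rho}:=\int_{\mathbb{R}^{3}}|\xi|^{\rho}|\widehat f(\xi)|\,d\xi<\infty\Big\}.$$ For vector fields the same definition is used with $|\cdot|$ the Euclidean norm on $\mathbb{C}^3$. $L^1_{\mathrm{loc}}([0,T^* ),X)$ denotes functions that belong to $L^1([0,T];X)$ for every $T\in(0,T^* )$. The problem $(NSE_M)$ is $$\partial_t u-\Delta u+u\cdot\nabla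 u+\alpha\sum_{k=1}^3u_k^{2m+1}e_k=-\nabla p,\qquad \operatorname{div}u=0,\qquad u(0,\cdot)=u^0,$$ on $\mathbb{R}^+\times\mathbb{R}^3$, where $u=(u_1,u_2,u_3)$ is the velocity, $p$ the pressure and $(e_1,e_2,e_3)$ the canonical basis of $\mathbb{R}^3$. A solution is understood in the integral (Duhamel) sense: $$u(t)=e^{t\Delta}u^0-\int_0^te^{(t-\tau)\Delta}\mathbb P(u\cdot\nabla u)(\tau)\,d\tau-\alpha\sum_{k=1}^3\int_0^te^{(t-\tau)\Delta}\mathbb P\bigl(u_k^{2m+1}e_k\bigr)(\tau)\,d\tau,$$ where $\mathcal F(e^{t\Delta}f)(\xi)=e^{-t|\xi|^2}\widehat f(\xi)$ and $\mathbb P$ is the Leray projector, $\mathcal F(\mathbb P f)(\xi)=\widehat f(\xi)-\frac{\xi\cdot\widehat f(\xi)}{|\xi|^2}\xi$. For every divergence-free $u^0\in\mathcal X^0(\mathbb R^3)$ there is a time $T>0$ such that $(NSE_M)$ has a unique solution in $C([0,T];\mathcal X^0(\mathbb{R}^3))\cap L^1([0,T];\mathcal X^2(\mathbb{R}^3))$. The maximal solution is the unique solution in the corresponding class on $[0,T^* )$, where $T^*\in(0,\infty]$ is the supremum of all $T>0$ for which a solution in $C([0,T];\mathcal X^0(\mathbb{R}^3))\cap L^1([0,T];\mathcal X^2(\mathbb{R}^3))$ exists. *)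

(* Defs.v *)
From HB Require Import structures.
From mathcomp Require Import all_boot all_order all_algebra.
From mathcomp Require Import complex.
From mathcomp Require Import all_classical all_reals all_analysis.

Set Implicit Arguments.
Unset Strict Implicit.
Unset Printing Implicit Defensive.
Import Order.TTheory GRing.Theory Num.Theory.
Import numFieldNormedType.Exports.

Local Open Scope classical_set_scope.
Local Open Scope ring_scope.
Local Open Scope complex_scope.

(* [R * R * R] carries the product topology and its library norm is the sup
   norm; the Euclidean norm is [enorm3] below. *)
Notation space R := (R * R * R)%type.

Notation leb R := (@lebesgue_measure R).
Notation leb3 R := ((leb R \x leb R) \x leb R)%E.

Section Space.
Context {R : realType}.

Definition coord (x : space R) (j : 'I_3) : R := nth 0 [:: x.1.1; x.1.2; x.2] j.

Definition ebasis (j : 'I_3) : space R :=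
  ((j == 0%N :> nat)%:R, (j == 1%N :> nat)%:R, (j == 2%N :> nat)%:R).

Definition dot (x y : space R) : R := \sum_(j < 3) coord x j * coord y j.

Definition enorm3 (x : space R) : R := Num.sqrt (dot x x).

Definition cabs (z : R[i]) : R := ComplexField.Normc.normc z.

Definition cnorm3 (z : 'I_3 -> R[i]) : R := Num.sqrt (\sum_(j < 3) cabs (z j) ^+ 2).

Definition cis (a : R) : R[i] := cos a +i* sin a.

Definition cintegral d (T : measurableType d) (mu : {measure set T -> \bar R}) (D : set T)
    (f : T -> R[i]) : R[i] :=
  Rintegral mu D (fun x => complex.Re (f x)) +i*
  Rintegral mu D (fun x => complex.Im (f x)).

End Space.

Section Schwartz.
Context {R : realType}.
Implicit Types (f : space R -> R) (phi : space R -> R[i]).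

Definition pderivs (s : seq 'I_3) f : space R -> R :=
  foldr (fun j g => 'D_(ebasis j) g) f s.

Definition seminorm_le (k : nat) (s : seq 'I_3) f (M : R) : Prop :=
  forall x, enorm3 x ^+ k * `|pderivs s f x| <= M.

Definition schwartzR f : Prop :=
  (forall s x, differentiable (pderivs s f) x) /\
  (forall k s, exists M, seminorm_le k s f M).

Definition schwartz phi : Prop :=
  schwartzR (fun x => complex.Re (phi x)) /\
  schwartzR (fun x => complex.Im (phi x)).

Definition cpderiv (j : 'I_3) phi : space R -> R[i] := fun x =>
  'D_(ebasis j) (fun y => complex.Re (phi y)) x +i*
  'D_(ebasis j) (fun y => complex.Im (phi y)) x.

Definition fourier phi : space R -> R[i] := fun xi =>
  cintegral (leb3 R) setT (fun x => cis (- dot x xi) * phi x).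

Definition inv_fourier phi : space R -> R[i] := fun x =>
  (((2 * pi) ^+ 3)^-1)%:C *
  cintegral (leb3 R) setT (fun xi => cis (dot x xi) * phi xi).

End Schwartz.

(* Functionals on test functions.  Only the values on Schwartz functions are
   meaningful: every definition below evaluates a functional on those only. *)
Definition dist (R : realType) : Type := (space R -> R[i]) -> R[i].
Definition vdist (R : realType) : Type := 'I_3 -> dist R.

Section Distributions.
Context {R : realType}.
Implicit Types (T : dist R) (g h v : space R -> R[i]) (u : vdist R).

(* The second clause is continuity for the Schwartz topology, with
   "[M] bounds all the seminorms of order at most [N]" in place of their
   maximum. *)
Definition tempered T : Prop :=
  (forall (a : R[i]) phi psi, schwartz phi -> schwartz psi ->
     T (fun x => a * phi x + psi x) = a * T phi + T psi) /\
  (exists (C : R) (N : nat), forall phi (M : R), schwartz phi ->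
     (forall k s, (k <= N)%N -> (size s <= N)%N ->
        seminorm_le k s (fun x => complex.Re (phi x)) M /\
        seminorm_le k s (fun x => complex.Im (phi x)) M) ->
     cabs (T phi) <= C * M).

Definition locally_integrable3 g : Prop := forall K : set (space R), compact K ->
  (leb3 R).-integrable K (fun x => (complex.Re (g x))%:E) /\
  (leb3 R).-integrable K (fun x => (complex.Im (g x))%:E).

Definition regular g : dist R := fun phi =>
  cintegral (leb3 R) setT (fun x => g x * phi x).

(* The Fourier transform of [T], defined by <F T, phi> = <T, F phi>, is the
   locally integrable function [g]. *)
Definition has_fourier T g : Prop :=
  locally_integrable3 g /\
  forall phi, schwartz phi -> T (fourier phi) = regular g phi.

(* A representative (unique almost everywhere) of the Fourier transform. *)
Definition Fhat T : space R -> R[i] := xget (fun=> 0) [set g | has_fourier T g].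

(* The distribution whose Fourier transform is [h]. *)
Definition Finv h : dist R := fun phi => regular h (inv_fourier phi).

Definition dderiv (j : 'I_3) T : dist R := fun phi => - T (cpderiv j phi).

Definition div_free u : Prop :=
  forall phi, schwartz phi -> \sum_(j < 3) dderiv j (u j) phi = 0.

Definition Xenorm (rho : R) u : \bar R :=
  (\int[leb3 R]_xi (enorm3 xi `^ rho * cnorm3 (fun k => Fhat (u k) xi))%:E)%E.

Definition Xnorm (rho : R) u : R := fine (Xenorm rho u).

Definition inX (rho : R) u : Prop :=
  (forall k, tempered (u k) /\ exists g, has_fourier (u k) g) /\
  (Xenorm rho u < +oo)%E.

Definition vsub (u v : vdist R) : vdist R := fun k phi => u k phi - v k phi.

Definition heat (t : R) T : dist R :=
  Finv (fun xi => (expR (- t * enorm3 xi ^+ 2))%:C * Fhat T xi).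

Definition leray u : vdist R := fun k =>
  Finv (fun xi => Fhat (u k) xi -
    (\sum_(j < 3) (coord xi j)%:C * Fhat (u j) xi) / (enorm3 xi ^+ 2)%:C
      * (coord xi k)%:C).

(* Elements of X^0, and the first derivatives of elements of X^0 and X^2, are
   given by bounded continuous functions; products of distributions are taken
   through these functions. *)
Definition represents v T : Prop :=
  [/\ continuous (fun x => complex.Re (v x)),
      continuous (fun x => complex.Im (v x)),
      (exists M, forall x, cabs (v x) <= M) &
      forall phi, schwartz phi -> T phi = regular v phi].

Definition fun_of T : space R -> R[i] := xget (fun=> 0) [set v | represents v T].

Definition convection u : vdist R := fun k =>
  regular (fun x => \sum_(j < 3) fun_of (u j) x * fun_of (dderiv j (u k)) x).

(* The vector field u_k^n e_k. *)
Definition power_term (n : nat) (k : 'I_3) u : vdist R := fun i =>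
  if i == k then regular (fun x => fun_of (u k) x ^+ n) else fun=> 0.

End Distributions.

Section Solutions.
Context {R : realType}.
Implicit Types (u v : R -> vdist R) (I : set R).

Definition C_X (rho : R) I u : Prop :=
  (forall t, I t -> inX rho (u t)) /\
  (forall t, I t ->
     (fun s => Xnorm rho (vsub (u s) (u t))) @ within I (nbhs t) --> (0 : R)).

Definition simple_X (rho : R) (s : R -> vdist R) : Prop :=
  [/\ finite_set (range s), forall w, measurable (s @^-1` [set w] : set (measurableTypeR R)) &
      forall t, inX rho (s t)].

(* Bochner integrability: strong measurability and a finite integral of the norm. *)
Definition L1_X (rho : R) (T : R) u : Prop :=
  (exists s : nat -> R -> vdist R,
     (forall n, simple_X rho (s n)) /\
     {ae leb R, forall t, `[0, T]%classic t -> inX rho (u t) /\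
        (Xnorm rho (vsub (u t) (s n t)) @[n --> \oo] --> (0 : R))}) /\
  (\int[leb R]_(t in `[0%R, T]) Xenorm rho (u t) < +oo)%E.

(* The integrals in time are integrals of distribution-valued functions:
   < int_0^t F(tau) dtau, phi > = int_0^t < F(tau), phi > dtau. *)
Definition duhamel (alpha : R) (m : nat) (u0 : vdist R) I u : Prop :=
  forall t, I t -> forall k phi, schwartz phi ->
    u t k phi =
      heat t (u0 k) phi
      - cintegral (leb R) `[0, t]
          (fun tau => heat (t - tau) (leray (convection (u tau)) k) phi)
      - alpha%:C * \sum_(j < 3) cintegral (leb R) `[0, t]
          (fun tau =>
             heat (t - tau) (leray (power_term (2 * m).+1 j (u tau)) k) phi).

Definition solution_closed (alpha : R) (m : nat) (u0 : vdist R) (T : R) u : Prop :=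
  [/\ C_X 0 `[0, T] u, L1_X 2 T u & duhamel alpha m u0 `[0, T] u].

Definition solution_open (alpha : R) (m : nat) (u0 : vdist R) (Tstar : \bar R) u : Prop :=
  let I := [set t : R | 0 <= t /\ (t%:E < Tstar)%E] in
  [/\ C_X 0 I u,
      forall T : R, 0 < T -> (T%:E < Tstar)%E -> L1_X 2 T u &
      duhamel alpha m u0 I u].

Definition maximal_solution (alpha : R) (m : nat) (u0 : vdist R) (Tstar : \bar R) u : Prop :=
  [/\ (0 < Tstar)%E,
      solution_open alpha m u0 Tstar u &
      Tstar = ereal_sup [set T%:E | T in
        [set T : R | 0 < T /\ exists v, solution_closed alpha m u0 T v]]].

End Solutions.

(* Main.v *)
(* Write N for the X^0 norm of u.  On the Fourier side products become convolutions;
   as the convolution constant (2 pi)^-3 is at most 1/64, crude bounds on the Leray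
   projector give, for almost every xi,
     |û(t)| <= e^(-t |xi|^2) |û0| + int_0^t e^(-(t-s) |xi|^2) (|û| * |xi||û| + alpha |û|^{*(2m+1)}) ds.
   Integrating in xi, and integrating |xi|^2 times this bound in (s, xi), Tonelli yields
     N(t) + int_0^t |u|_{X^2} <= N(0) + int_0^t (N |u|_{X^1} + alpha N^(2m+1)).
   As N |xi| <= (N^2 + |xi|^2)/2, half of the dissipation absorbs the convection term, and
   Gronwall's lemma concludes.

   The bounds are obtained by testing against transforms of tensor products of
   one-dimensional compactly supported functions, for which Fourier inversion is elementary;
   such tensors determine locally integrable functions almost everywhere. *)
Require Import Defs.
From HB Require Import structures.
From mathcomp Require Import all_boot all_order all_algebra.
From mathcomp Require Import complex.
From mathcomp Require Import all_classical all_reals all_analysis.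
From mathcomp Require Import measurable_realfun ring lra.
Import Order.TTheory GRing.Theory Num.Theory.
Import numFieldNormedType.Exports.
Set Implicit Arguments.
Unset Strict Implicit.
Unset Printing Implicit Defensive.
Local Open Scope classical_set_scope.
Local Open Scope ring_scope.
(* [vector] declares another notation [space], which this import overrides. *)
Import Defs.

(** [Fhat] and [fun_of] pick values by choice, separately at each time, so nothing is known about
    how $\hat u(t)$ varies with $t$. The integrands of the Duhamel formula are not known to be
    measurable in time; their integrals are controlled through lower integrals of jointly measurable
    majorants. These are built from a function $U(t,\xi)$, measurable in both variables and equal to
    $|\hat u(t,\xi)|$ for almost every $\xi$ at every $t$, which the continuity of $u$ into
    $\mathcal X^0$ provides.

    The losses paid by the crude bounds on convection multiply to exactly 64: 2 for recovering a
    modulus from real and imaginary parts when the transform of a product is tested, 4 for the Leray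
    projector, 2 for the time integral, 2 for testing the Duhamel formula, 2 for the Euclidean norm
    of three components. The power terms carry $(2\pi)^{-6m}$ and absorb a further factor 3. Half of
    the dissipation may be subtracted at the end because $u\in L^1([0,T];\mathcal X^2)$ makes it
    finite. *)

(** * Smooth functions on the line and compactly supported bumps *)

Section SmoothOneDim.
Context {R : realType}.
Implicit Types (f g : R -> R) (C : set (R -> R)).

Definition deriv_closed C := forall f, C f ->
  exists2 g, C g & forall x : R, is_derive x 1 f (g x).

(* Coinductive form of smoothness: no iterated derivative is ever named. *)
Definition smooth f := exists2 C, deriv_closed C & C f.

Inductive generated C : (R -> R) -> Prop :=
| gen_in f : C f -> generated C f
| gen_cst (k : R) : generated C (fun=> k)
| gen_add f g : generated C f -> generated C g -> generated C (fun x => f x + g x)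
| gen_mul f g : generated C f -> generated C g -> generated C (fun x => f x * g x).

(** Leibniz's rule stays inside the generated ring, so a derivative has to be exhibited for the
    generators only, and it may itself use constants, sums and products. *)
Lemma deriv_closed_generated C :
  (forall f, C f -> exists2 g, generated C g & forall x : R, is_derive x 1 f (g x)) ->
  deriv_closed (generated C).
Proof.
move=> HC f; elim=> {f} [f Cf|k|f g Cf [f' Cf' df] Cg [g' Cg' dg]
  |f g Cf [f' Cf' df] Cg [g' Cg' dg]].
- exact: HC.
- exists (fun=> 0); first exact: gen_cst.
  by move=> x; exact: is_derive_cst.
- exists (fun x => f' x + g' x); first exact: gen_add.
  by move=> x; have := df x; have := dg x => ? ?; exact: is_deriveD.
- exists (fun x => f x * g' x + g x * f' x).
    by apply: gen_add; exact: gen_mul.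
  by move=> x; have := df x; have := dg x => ? ?; exact: is_deriveM.
Qed.

Lemma smooth_derive f : smooth f ->
  exists2 g, smooth g & forall x : R, is_derive x 1 f (g x).
Proof.
by move=> [C HC Cf]; have [g Cg dg] := HC _ Cf; exists g => //; exists C.
Qed.

Lemma smooth_continuous f : smooth f -> continuous f.
Proof.
move=> /smooth_derive[g _ dg] x.
by apply: differentiable_continuous; apply/derivable1_diffP; have [] := dg x.
Qed.

Lemma smooth_generated f : generated smooth f -> smooth f.
Proof.
exists (generated smooth) => //; apply: deriv_closed_generated => g sg.
by have [h sh dh] := smooth_derive sg; exists h => //; exact: gen_in.
Qed.

Lemma smooth_cst k : smooth (fun=> k).
Proof. exact/smooth_generated/gen_cst. Qed.

Lemma smooth_mul f g : smooth f -> smooth g -> smooth (fun x => f x * g x).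
Proof. by move=> sf sg; apply/smooth_generated/gen_mul; exact: gen_in. Qed.

Lemma smooth_id : smooth id.
Proof.
pose C := [set f : R -> R | f = id \/ f = cst 1 \/ f = cst 0].
exists C; last by left.
move=> f [->|[->|->]].
- by exists (cst 1) => [|x]; [right; left|exact: is_derive_id].
- by exists (cst 0) => [|x]; [right; right|exact: is_derive_cst].
- by exists (cst 0) => [|x]; [right; right|exact: is_derive_cst].
Qed.

Lemma smooth_affine f (p q : R) : smooth f -> smooth (fun x => f (p * x + q)).
Proof.
move=> sf; pose C := [set g | exists2 h, smooth h & g = fun x => h (p * x + q)].
(* The chain rule brings out the factor [p], so the class has to be enlarged by constants and
   products. *)
exists (generated C); last by apply: gen_in; exists f.
apply: deriv_closed_generated => _ [h sh ->].
have [h' sh' dh] := smooth_derive sh.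
exists (fun x => h' (p * x + q) * p).
  by apply: gen_mul; [apply: gen_in; exists h'|exact: gen_cst].
move=> x; have ? := dh (p * x + q).
have dl : is_derive x 1 (fun x : R => p * x + q) p.
  have d1 : is_derive x 1 (p \*: id : R -> R) (p *: 1) by exact: is_deriveZ.
  have := @is_deriveD _ _ _ _ (cst q) x 1 _ _ d1 (is_derive_cst _ _ _).
  by rewrite addr0 /GRing.scale/= mulr1.
exact: (@is_derive1_comp _ h).
Qed.

(** For [n = 0] this is the classical function $e^{-1/x}$, flat at 0. The powers of $1/x$ make the
    family stable under differentiation, up to linear combinations. *)
Definition flat (n : nat) (x : R) : R :=
  if 0 < x then x^-1 ^+ n * expR (- x^-1) else 0.

Lemma flat_ge0 n x : 0 <= flat n x.
Proof.
by rewrite /flat; case: ifP => // x0; rewrite mulr_ge0 ?expR_ge0// exprn_ge0// invr_ge0 ltW.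
Qed.

(** With $y=1/x$ this follows from $e^y\ge y^{n+1}/(n+1)!$. The linear bound controls the difference
    quotients at 0. *)
Lemma flat_le n x : 0 < x -> flat n x <= (n.+1)`!%:R * x.
Proof.
move=> x0; rewrite /flat x0 expRN ler_pdivrMr ?expR_gt0//.
have y0 : 0 < x^-1 by rewrite invr_gt0.
have := expR_ge1Dxn n (ltW y0).
set F := (n.+1)`!%:R; have F0 : 0 < F by rewrite ltr0n fact_gt0.
move=> h; apply: (@le_trans _ _ (F * x * (x^-1 ^+ n.+1 / F))); last first.
  by rewrite ler_pM2l ?mulr_gt0//; apply: le_trans h; rewrite lerDr.
rewrite le_eqVlt; apply/orP; left; apply/eqP.
by rewrite exprS; field; rewrite !gt_eqF.
Qed.

Lemma is_derive_flat (n : nat) (x : R) :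
  is_derive x 1 (flat n) (- n%:R * flat n.+1 x + flat n.+2 x).
Proof.
have [x0|x0|->] := ltgtP x 0.
- apply: (@near_eq_is_derive R R R (cst 0)).
  + near=> y; rewrite /flat ltNge ltW//=; near: y; exact: lt_nbhsl.
  + rewrite /flat !(ltNge 0 x) (ltW x0)/= mulr0 addr0; exact: is_derive_cst.
- apply: (@near_eq_is_derive R R R (fun y : R => y^-1 ^+ n * expR (- y^-1))).
  + near=> y; rewrite /flat ifT//; near: y; exact: lt_nbhsr.
  + have xn0 : x != 0 by rewrite gt_eqF.
    have dV : is_derive x 1 (fun y : R => y^-1) (- x ^- 2).
      by apply: is_derive_eq; [exact: is_deriveV|rewrite /GRing.scale/= mulr1].
    have dX : is_derive x 1 (fun y : R => y^-1 ^+ n) (- n%:R * x^-1 ^+ n.+1).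
      rewrite -(exprfctE (fun y : R => y^-1)).
      apply: (is_derive_eq (is_deriveX n dV)).
      case: n => [|n]; first by rewrite /GRing.scale/= !mul0r oppr0 mul0r.
      by rewrite /GRing.scale/= !exprS expr0; field.
    have dN : is_derive x 1 (fun y : R => - y^-1) (x ^- 2).
      by apply: (is_derive_eq (is_deriveN dV)); rewrite opprK.
    have dE : is_derive x 1 (fun y : R => expR (- y^-1)) (expR (- x^-1) * x ^- 2).
      exact: (@is_derive1_comp _ expR).
    apply: (is_derive_eq (is_deriveM dX dE)).
    by rewrite /GRing.scale/= /flat x0 !exprS; field.
- rewrite /flat ltxx mulr0 addr0.
  rewrite -[X in is_derive _ _ X _]/(flat n).
  have h : h^-1 *: (flat n (h + 0) - flat n 0) @[h --> 0^'] --> (0 : R).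
    apply/cvgrPdist_le => e e0.
    near=> h; rewrite addr0 {2}/flat ltxx subr0 sub0r normrN.
    have h0 : h != 0 by near: h; exact: nbhs_dnbhs_neq.
    have [hp|hn] := ltP 0 h; last by rewrite /flat ltNge hn/= scaler0 normr0 ltW.
    (* Dividing by [h] only raises the index, so the linear bound applies to the quotient as
       well. *)
    have -> : h^-1 *: flat n h = flat n.+1 h.
      by rewrite /flat hp/= /GRing.scale/= exprS mulrA.
    rewrite ger0_norm ?flat_ge0//; apply: (le_trans (flat_le _ hp)).
    rewrite -ler_pdivlMl ?ltr0n ?fact_gt0//.
    have : `|h| <= ((n.+2)`!%:R)^-1 * e.
      near: h; apply: dnbhs0_le; by rewrite mulr_gt0// invr_gt0 ltr0n fact_gt0.
    by rewrite gtr0_norm.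
  have hh : (fun h : R => h^-1 *: ((flat n \o shift 0) (h *: 1) - flat n 0)) =
    fun h => h^-1 *: (flat n (h + 0) - flat n 0).
    by apply/funext => y; rewrite /= /GRing.scale/= mulr1.
  apply: DeriveDef.
    by rewrite /derivable hh; apply/cvg_ex; exists 0.
  by rewrite /derive hh; exact/cvg_lim.
Unshelve. all: by end_near. Qed.

Lemma smooth_flat n : smooth (flat n).
Proof.
pose C := [set f | exists n, f = flat n].
exists (generated C); last by apply: gen_in; exists n.
apply: deriv_closed_generated => _ [k ->].
exists (fun x => - k%:R * flat k.+1 x + flat k.+2 x); last exact: is_derive_flat.
apply: gen_add; last by apply: gen_in; exists k.+2.
by apply: (@gen_mul C (fun=> - k%:R)); [exact: gen_cst|apply: gen_in; exists k.+1].
Qed.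

(* The functions [bump a b n] increase to the indicator of ]a, b[. *)
Definition bump (a b : R) (n : nat) (x : R) : R :=
  flat 0 (n.+1%:R * x - n.+1%:R * a) * flat 0 (n.+1%:R * b - n.+1%:R * x).

Definition compactly_supported f := exists A, forall x, A < `|x| -> f x = 0.

Definition testfun f := smooth f /\ compactly_supported f.

Lemma flat_le1 x : flat 0 x <= 1.
Proof.
rewrite /flat; case: ifP => // x0; rewrite expr0 mul1r.
by rewrite -[leRHS]expR0 ler_expR oppr_le0 invr_ge0 ltW.
Qed.

Lemma bump_ge0 a b n x : 0 <= bump a b n x.
Proof. by rewrite mulr_ge0 ?flat_ge0. Qed.

Lemma bump_le1 a b n x : bump a b n x <= 1.
Proof. by rewrite mulr_ile1 ?flat_ge0 ?flat_le1. Qed.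

Lemma bump_out a b n x : ~~ (a < x < b) -> bump a b n x = 0.
Proof.
rewrite negb_and -!leNgt => /orP[xa|bx]; rewrite /bump /flat.
  by rewrite subr_gt0 ltr_pM2l// ltNge xa/= mul0r.
by rewrite [X in _ * X]ifF ?mulr0// subr_gt0 ltr_pM2l// ltNge bx.
Qed.

Lemma testfun_bump a b n : testfun (bump a b n).
Proof.
split.
  rewrite /bump; apply: smooth_mul.
    exact: (@smooth_affine (flat 0) n.+1%:R (- (n.+1%:R * a))) (smooth_flat 0).
  rewrite [X in smooth X](_ : _ = fun x => flat 0 (- n.+1%:R * x + n.+1%:R * b)).
    exact: smooth_affine (smooth_flat 0).
  by apply/funext => x; rewrite mulNr addrC.
exists (`|a| + `|b|) => x xab; apply: bump_out; apply/negP => /andP[ax xb].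
move: xab; rewrite ltNge => /negP; apply.
have [x0|x0] := leP 0 x.
  by rewrite (ger0_norm x0) (le_trans (ltW xb))// (le_trans (ler_norm b))// lerDr.
rewrite (ltr0_norm x0) (@le_trans _ _ (- a))//; first by rewrite lerN2 ltW.
by rewrite (le_trans (ler_norm _))// normrN lerDl.
Qed.

Lemma flat_cvg1 (c : R) : 0 < c -> flat 0 (n.+1%:R * c) @[n --> \oo] --> (1 : R).
Proof.
move=> c0; have -> : (fun n => flat 0 (n.+1%:R * c)) =
    (fun n => expR (- (c^-1 * n.+1%:R^-1))).
  apply/funext => n; rewrite /flat pmulr_rgt0// c0 expr0 mul1r.
  by rewrite invfM mulrC.
have h : (fun n : nat => - (c^-1 * n.+1%:R^-1)) n @[n --> \oo] --> (0 : R).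
  rewrite -oppr0; apply: cvgN; rewrite -(mulr0 c^-1).
  by apply: cvgM; [exact: cvg_cst|exact: cvg_harmonic].
rewrite -[X in _ --> X]expR0.
by apply: (cvg_comp _ _ h); exact: continuous_expR.
Qed.

Lemma bump_cvg a b x :
  bump a b n x @[n --> \oo] --> (\1_(`]a, b[%classic : set R) x : R).
Proof.
rewrite indicE; have [/[!inE]/=|] := boolP (x \in _).
  rewrite in_itv/= => /andP[ax xb]; rewrite -(mulr1 1).
  rewrite /bump.
  under eq_fun do rewrite -!mulrBr.
  by apply: cvgM; apply: flat_cvg1; rewrite subr_gt0.
rewrite notin_setE/= in_itv/= => /negP h.
by under eq_fun do rewrite bump_out//; exact: cvg_cst.
Qed.

End SmoothOneDim.

(** * Test functions and their cosine and sine transforms *)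

Section TestFunctions.
Context {R : realType}.
Implicit Types (f g : R -> R).
Local Notation mu := (@lebesgue_measure R).

Lemma is_derive1E f (x d : R) : is_derive x 1 f d -> f^`()%classic x = d.
Proof. by move=> h; rewrite derive1E; exact: derive_val. Qed.

Lemma is_derive_continuous f g : (forall x : R, is_derive x 1 f (g x)) -> continuous f.
Proof.
move=> df x; apply: differentiable_continuous; apply/derivable1_diffP.
by have [] := df x.
Qed.

Lemma supp_patch f A B : (forall x, A < `|x| -> f x = 0) -> A <= B ->
  f \_ `[- B, B] = f.
Proof.
move=> fA AB; apply/funext => x; rewrite patchE; case: ifPn => //.
rewrite notin_setE/= in_itv/= -ler_norml => /negP; rewrite -ltNge => Bx.
by rewrite fA// (le_lt_trans AB).
Qed.

Lemma supp_Rintegral f A B : (forall x, A < `|x| -> f x = 0) -> A <= B ->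
  \int[mu]_x f x = \int[mu]_(x in `[- B, B]) f x.
Proof. by move=> fA AB; rewrite [RHS]Rintegral_mkcond (supp_patch fA AB). Qed.

Lemma integrable_compactly_supported f : continuous f -> compactly_supported f ->
  mu.-integrable setT (EFin \o f).
Proof.
move=> cf [A fA]; rewrite -(supp_patch fA (lexx A)) -restrict_EFin.
apply/(integrable_mkcond _ _).1 => //.
apply: continuous_compact_integrable; first exact: segment_compact.
exact: continuous_subspaceT.
Qed.

Lemma compactly_supportedMl f g : compactly_supported f ->
  compactly_supported (fun x => f x * g x).
Proof. by move=> [A fA]; exists A => x /fA ->; rewrite mul0r. Qed.

Lemma compactly_supported_bounded f : continuous f -> compactly_supported f ->
  exists M, forall x, `|f x| <= M.
Proof.
move=> cf [A fA]; have AB : - `|A| <= `|A| by have := normr_ge0 A; lra.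
have cn : {within `[- `|A|, `|A|], continuous (fun x => `|f x|)}.
  by apply: continuous_subspaceT => x; apply: cvg_norm; exact: cf.
have [c _ hc] := EVT_max AB cn.
exists `|f c| => x; have [|Ax] := leP `|x| `|A|.
  by rewrite ler_norml => xA; apply: hc; rewrite in_itv.
by rewrite fA ?normr0// (le_lt_trans (ler_norm _)).
Qed.

(* Integrals of derivatives vanish: boundary terms are outside the support. *)
Lemma Rintegral_derive f g : (forall x : R, is_derive x 1 f (g x)) -> continuous g ->
  compactly_supported f -> compactly_supported g -> \int[mu]_x g x = 0.
Proof.
move=> df cg [A fA] [A' gA'].
pose B := `|A| + `|A'| + 1.
have AB : A < B by rewrite /B; have := ler_norm A; have := normr_ge0 A'; lra.
have A'B : A' <= B by rewrite /B; have := ler_norm A'; have := normr_ge0 A; lra.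
have B0 : 0 < B by rewrite /B; have := normr_ge0 A; have := normr_ge0 A'; lra.
rewrite (supp_Rintegral gA' A'B) /Rintegral.
rewrite (@continuous_FTC2 _ _ f).
- by rewrite !fA ?subee// ?normrN gtr0_norm.
- by rewrite gtrN.
- exact: continuous_subspaceT.
- have cf := is_derive_continuous df; split.
  + by move=> x _; have [] := df x.
  + by apply: cvg_at_right_filter; exact: cf.
  + by apply: cvg_at_left_filter; exact: cf.
- by move=> x _; apply: is_derive1E; exact: df.
Qed.

Lemma testfun_continuous f : testfun f -> continuous f.
Proof. by move=> [/smooth_continuous]. Qed.

Lemma testfun_bounded f : testfun f -> exists M, forall x, `|f x| <= M.
Proof. by move=> tf; apply: compactly_supported_bounded; [exact: testfun_continuous|case: tf]. Qed.

Lemma testfun_derive f : testfun f ->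
  exists2 g, testfun g & forall x : R, is_derive x 1 f (g x).
Proof.
move=> [/smooth_derive[g sg dg] [A fA]]; exists g => //; split => //.
exists A => x Ax; have := is_derive1E (dg x) => <-.
apply: is_derive1E; apply: (@near_eq_is_derive R R R (cst 0)).
near=> y; rewrite fA//; near: y.
have := @norm_continuous R R x; move/cvgrPdist_lt => /(_ (`|x| - A)).
rewrite subr_gt0 => /(_ Ax); apply: filterS => y /=.
by have := ler_norm (`|x| - `|y|); lra.
Unshelve. all: by end_near. Qed.

Lemma testfun_mulr f g : smooth g -> testfun f -> testfun (fun x => f x * g x).
Proof.
move=> sg [sf cf]; split; first exact: smooth_mul.
exact: compactly_supportedMl.
Qed.

Lemma testfun_scale (k : R) f : testfun f -> testfun (fun x => k * f x).
Proof.
move=> tf; rewrite (_ : (fun _ => _) = fun x => f x * k).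
  exact: (testfun_mulr (smooth_cst k)).
by apply/funext => x; rewrite mulrC.
Qed.

Lemma testfun_mulid f : testfun f -> testfun (fun x => x * f x).
Proof.
move=> tf; rewrite (_ : (fun _ => _) = fun x => f x * x).
  exact: (testfun_mulr smooth_id).
by apply/funext => x; rewrite mulrC.
Qed.

Lemma testfun_integrable f g : testfun f -> continuous g ->
  mu.-integrable setT (EFin \o (fun y => f y * g y)).
Proof.
move=> tf cg; apply: integrable_compactly_supported.
  by move=> x; apply: cvgM; [exact: testfun_continuous|exact: cg].
by apply: compactly_supportedMl; case: tf.
Qed.

(* The functions whose derivatives all decay faster than any power, again coinductively. *)
Definition rapid_closed (C : set (R -> R)) := forall f, C f ->
  [/\ exists2 g, C g & forall x : R, is_derive x 1 f (g x),
      C (fun x => x * f x) & exists M, forall x, `|f x| <= M].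

Definition rapid f := exists2 C, rapid_closed C & C f.

Lemma rapid_rapid_closed : rapid_closed rapid.
Proof.
move=> f [C HC Cf]; have [[g Cg dg] Cx M] := HC _ Cf; split => //.
  by exists g => //; exists C.
by exists C.
Qed.

Lemma testfun_rapid f : testfun f -> rapid f.
Proof.
exists testfun => // g tg; split.
- exact: testfun_derive.
- exact: testfun_mulid.
- exact: testfun_bounded.
Qed.

Definition cosT f (x : R) : R := \int[mu]_y (f y * cos (x * y)).
Definition sinT f (x : R) : R := \int[mu]_y (f y * sin (x * y)).

Lemma continuous_mull (x : R) : continuous (fun y : R => x * y).
Proof. by move=> y; apply: cvgM; [exact: cvg_cst|exact: cvg_id]. Qed.

Lemma continuous_cosM (x : R) : continuous (fun y => cos (x * y)).
Proof. by move=> y; apply: continuous_comp; [exact: continuous_mull|exact: continuous_cos]. Qed.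

Lemma continuous_sinM (x : R) : continuous (fun y => sin (x * y)).
Proof. by move=> y; apply: continuous_comp; [exact: continuous_mull|exact: continuous_sin]. Qed.

Lemma is_derive_mull (x y : R) : is_derive y 1 (fun y : R => x * y) x.
Proof.
apply: (is_derive_eq (@is_deriveZ _ _ _ id x y 1 1 _)).
by rewrite /GRing.scale/= mulr1.
Qed.

Lemma is_derive_mulr (x y : R) : is_derive y 1 (fun y : R => y * x) x.
Proof.
rewrite [X in is_derive _ _ X](_ : _ = (fun y : R => x * y)); first exact: is_derive_mull.
by apply/funext => z; rewrite mulrC.
Qed.

Lemma is_derive_cosM (x y : R) : is_derive y 1 (fun y : R => cos (x * y)) (- sin (x * y) * x).
Proof. by have ? := is_derive_mull x y; exact: (@is_derive1_comp _ cos). Qed.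

Lemma is_derive_sinM (x y : R) : is_derive y 1 (fun y : R => sin (x * y)) (cos (x * y) * x).
Proof. by have ? := is_derive_mull x y; exact: (@is_derive1_comp _ sin). Qed.

Lemma norm_cos_le1 (x : R) : `|cos x| <= 1.
Proof. by rewrite ler_norml cos_geN1 cos_le1. Qed.

Lemma norm_sin_le1 (x : R) : `|sin x| <= 1.
Proof. by rewrite ler_norml sin_geN1 sin_le1. Qed.

(* Common part of the differentiation of [cosT] and [sinT]: [t], [t'] are [cos], [- sin]
   or [sin], [cos]. *)
Lemma is_derive_trigT (t t' : R -> R) f (x : R) : testfun f ->
  continuous t -> continuous t' -> (forall z : R, is_derive z 1 t (t' z)) ->
  (forall z, `|t' z| <= 1) ->
  is_derive x 1 (fun x => \int[mu]_y (f y * t (x * y)))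
    (\int[mu]_y ((y * f y) * t' (x * y))).
Proof.
move=> tf ct ct' dt t'1.
have dft (z y : R) : is_derive z 1 (fun z => f y * t (z * y)) (y * f y * t' (z * y)).
  have dm := is_derive_mulr y z.
  have ? := dt (z * y).
  have dc : is_derive z 1 (fun z => t (z * y)) (t' (z * y) * y).
    exact: (@is_derive1_comp _ t).
  apply: (is_derive_eq (@is_deriveZ _ _ _ _ (f y) z 1 _ dc)).
  by rewrite /GRing.scale/=; ring.
have p1 (z y : R) : partial1of2 (fun z y => f y * t (z * y)) z y = y * f y * t' (z * y).
  by rewrite /partial1of2; exact: is_derive1E.
pose G (y : R) := `|y * f y|.
have tG := testfun_mulid tf.
have iG : mu.-integrable setT (EFin \o G).
  apply: integrable_compactly_supported.
    by move=> y; apply: cvg_norm; exact: (testfun_continuous tG).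
  by case: tG => _ [A hA]; exists A => y /hA h; rewrite /G h normr0.
have H1 : `]x - 1, x + 1[%classic x by rewrite /= in_itv/=; lra.
have H2 z : `]x - 1, x + 1[%classic z ->
    mu.-integrable setT (EFin \o (fun y => f y * t (z * y))).
  move=> _; apply: testfun_integrable => // y.
  by apply: continuous_comp; [exact: continuous_mull|exact: ct].
have H3 (z y : R) : `]x - 1, x + 1[%classic z -> [set: R] y ->
    derivable ((fun z y => f y * t (z * y)) ^~ y) z 1.
  by move=> _ _; have [] := dft z y.
have H4 (z y : R) : `]x - 1, x + 1[%classic z -> [set: R] y ->
    `|partial1of2 (fun z y => f y * t (z * y)) z y| <= G y.
  by move=> _ _; rewrite p1 normrM ler_piMr.
have dI := derivable_under_integral (@measurableT _ (measurableTypeR R)) H1 H2 H3 (fun y => normr_ge0 _) iG H4.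
have eI := differentiation_under_integral (@measurableT _ (measurableTypeR R)) H1 H2 H3 (fun y => normr_ge0 _) iG H4.
apply: DeriveDef; first exact: dI.
by rewrite -derive1E eI; apply: eq_Rintegral => y _; exact: p1.
Qed.

Lemma is_derive_cosT f (x : R) : testfun f ->
  is_derive x 1 (cosT f) (sinT (fun y => - 1 * (y * f y)) x).
Proof.
move=> tf; have := @is_derive_trigT cos (fun z => - sin z) f x tf.
rewrite (_ : sinT _ x = \int[mu]_y ((y * f y) * - sin (x * y))); last first.
  by apply: eq_Rintegral => y _; ring.
apply.
- exact: continuous_cos.
- by move=> z; apply: cvgN; exact: continuous_sin.
- by move=> z; rewrite normrN norm_sin_le1.
Qed.

Lemma is_derive_sinT f (x : R) : testfun f ->
  is_derive x 1 (sinT f) (cosT (fun y => y * f y) x).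
Proof.
move=> tf; apply: (@is_derive_trigT sin cos f x tf).
- exact: continuous_sin.
- exact: continuous_cos.
- exact: norm_cos_le1.
Qed.

(** Integration by parts: the difference of the two sides is the integral of the derivative of
    $f(y)\sin(xy)$. *)
Lemma mul_cosT f g (x : R) : testfun f -> testfun g ->
  (forall x : R, is_derive x 1 f (g x)) -> x * cosT f x = - sinT g x.
Proof.
move=> tf tg df; apply/eqP; rewrite -subr_eq0 opprK; apply/eqP.
have i1 := testfun_integrable tf (@continuous_cosM x).
have i2 := testfun_integrable tg (@continuous_sinM x).
have i1' : mu.-integrable setT (EFin \o (fun y => x * (f y * cos (x * y)))).
  exact: (integrableZl measurableT x i1).
rewrite /cosT -RintegralZl// -RintegralD//.
have dM (y : R) : is_derive y 1 (fun y => f y * sin (x * y))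
    (x * (f y * cos (x * y)) + g y * sin (x * y)).
  apply: (is_derive_eq (is_deriveM (df y) (is_derive_sinM x y))).
  by rewrite /GRing.scale/=; ring.
apply: (Rintegral_derive dM).
- move=> y; apply: cvgD; apply: cvgM.
  + exact: cvg_cst.
  + by apply: cvgM; [exact: testfun_continuous|exact: continuous_cosM].
  + exact: testfun_continuous.
  + exact: continuous_sinM.
- by apply: compactly_supportedMl; case: tf.
- case: tf tg => _ [A fA] [_ [B gB]]; exists (`|A| + `|B|) => y ABy.
  rewrite fA ?gB ?mul0r ?mulr0 ?addr0//.
    by have := ler_norm B; have := normr_ge0 A; lra.
  by have := ler_norm A; have := normr_ge0 B; lra.
Qed.

Lemma mul_sinT f g (x : R) : testfun f -> testfun g ->
  (forall x : R, is_derive x 1 f (g x)) -> x * sinT f x = cosT g x.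
Proof.
move=> tf tg df; apply/eqP; rewrite -subr_eq0; apply/eqP.
have i1 := testfun_integrable tf (@continuous_sinM x).
have i2 := testfun_integrable tg (@continuous_cosM x).
have i1' : mu.-integrable setT (EFin \o (fun y => x * (f y * sin (x * y)))).
  exact: (integrableZl measurableT x i1).
rewrite -opprB; apply/eqP; rewrite oppr_eq0; apply/eqP.
rewrite /sinT -RintegralZl// -RintegralB//.
have dM (y : R) : is_derive y 1 (fun y => f y * cos (x * y))
    (g y * cos (x * y) - x * (f y * sin (x * y))).
  apply: (is_derive_eq (is_deriveM (df y) (is_derive_cosM x y))).
  by rewrite /GRing.scale/=; ring.
apply: (Rintegral_derive dM).
- move=> y; apply: cvgB; apply: cvgM.
  + exact: testfun_continuous.
  + exact: continuous_cosM.
  + exact: cvg_cst.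
  + by apply: cvgM; [exact: testfun_continuous|exact: continuous_sinM].
- by apply: compactly_supportedMl; case: tf.
- case: tf tg => _ [A fA] [_ [B gB]]; exists (`|A| + `|B|) => y ABy.
  rewrite fA ?gB ?mul0r ?mulr0 ?subr0//.
    by have := ler_norm B; have := normr_ge0 A; lra.
  by have := ler_norm A; have := normr_ge0 B; lra.
Qed.

Lemma trigT_bounded (t : R -> R) f : testfun f -> continuous t -> (forall z, `|t z| <= 1) ->
  exists M, forall x, `|\int[mu]_y (f y * t (x * y))| <= M.
Proof.
move=> tf ct t1; exists (\int[mu]_y `|f y|) => x.
have iT : mu.-integrable setT (EFin \o (fun y => f y * t (x * y))).
  apply: testfun_integrable => // y.
  by apply: continuous_comp; [exact: continuous_mull|exact: ct].
apply: le_trans (le_normr_Rintegral _ iT) _ => //.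
apply: le_Rintegral => //.
- exact: (integrable_norm iT).
- have i0 : mu.-integrable setT (EFin \o f).
    by apply: integrable_compactly_supported; [exact: testfun_continuous|case: tf].
  exact: (integrable_norm i0).
- by move=> y _; rewrite normrM ler_piMr.
Qed.

Definition trig_transform (h : R -> R) :=
  exists2 f, testfun f & h = cosT f \/ h = sinT f.

(** Differentiation in $x$ replaces $f$ by $\pm yf$ and multiplication by $x$ replaces it by $\pm
    f'$, exchanging cosines and sines; every transform is bounded by $\int|f|$. The transforms of
    test functions thus form a class of the kind that [rapid] asks for. *)
Lemma rapid_trig_transform h : trig_transform h -> rapid h.
Proof.
exists trig_transform => // _ [f tf [->|->]]; have [g tg df] := testfun_derive tf.
- split.
  + exists (sinT (fun y => - 1 * (y * f y))); last by move=> x; exact: is_derive_cosT.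
    exists (fun y => - 1 * (y * f y)); last by right.
    exact/testfun_scale/testfun_mulid.
  + exists (fun y => - 1 * g y); first exact: testfun_scale.
    right; apply/funext => x; rewrite (mul_cosT _ tf tg df) -[LHS]mulN1r.
    rewrite -[LHS]RintegralZl//; last exact: testfun_integrable (@continuous_sinM x).
    by apply: eq_Rintegral => y _; rewrite mulrA.
  + apply: trigT_bounded => //; [exact: continuous_cos|exact: norm_cos_le1].
- split.
  + exists (cosT (fun y => (y * f y))); last by move=> x; exact: is_derive_sinT.
    exists (fun y => (y * f y)); last by left.
    exact/testfun_mulid.
  + exists g => //.
    by left; apply/funext => x; rewrite (mul_sinT _ tf tg df).
  + apply: trigT_bounded => //; [exact: continuous_sin|exact: norm_sin_le1].
Qed.

Lemma rapid_cosT f : testfun f -> rapid (cosT f).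
Proof. by move=> tf; apply: rapid_trig_transform; exists f => //; left. Qed.

Lemma rapid_sinT f : testfun f -> rapid (sinT f).
Proof. by move=> tf; apply: rapid_trig_transform; exists f => //; right. Qed.

End TestFunctions.

(** * Integration of real functions, with bounds by lower integrals *)

Section RealIntegration.
Context {R : realType} d (T : measurableType d) (mu : {measure set T -> \bar R}).

(* The library integral of a nonnegative function is a lower integral, so
   monotonicity does not need measurability. *)
Lemma ge0_le_lower_integral (D : set T) (f g : T -> \bar R) :
  (forall x, D x -> (0 <= f x)%E) -> (forall x, D x -> (f x <= g x)%E) ->
  (\int[mu]_(x in D) f x <= \int[mu]_(x in D) g x)%E.
Proof.
move=> f0 fg; have g0 x : D x -> (0 <= g x)%E by move=> Dx; exact: le_trans (f0 _ Dx) (fg _ Dx).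
rewrite !ge0_integralE//; apply: le_ereal_sup => _ [h hf <-]; exists h => //.
move=> x; apply: le_trans (hf x) _; rewrite !patchE; case: ifPn => //.
by move=> /[!inE]; exact: fg.
Qed.

(** The positive and the negative part of [f] are each compared with [g] as lower integrals, and a
    difference of two numbers of $[0,G]$ is at most $G$ in absolute value. In this form the bound
    applies to integrands of unknown measurability, such as those of the Duhamel formula. *)
Lemma norm_Rintegral_le (D : set T) (f : T -> R) (g : T -> \bar R) :
  (forall x, D x -> (`|f x|%:E <= g x)%E) -> (\int[mu]_(x in D) g x < +oo)%E ->
  (`|\int[mu]_(x in D) f x|%:E <= \int[mu]_(x in D) g x)%E.
Proof.
move=> fg goo.
have hp : (\int[mu]_(x in D) (EFin \o f)^\+ x <= \int[mu]_(x in D) g x)%E.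
  apply: ge0_le_lower_integral => x Dx; first exact: funepos_ge0.
  apply: le_trans (fg _ Dx); rewrite funeposE/= -EFin_max lee_fin.
  by rewrite ge_max ler_norm normr_ge0.
have hn : (\int[mu]_(x in D) (EFin \o f)^\- x <= \int[mu]_(x in D) g x)%E.
  apply: ge0_le_lower_integral => x Dx; first exact: funeneg_ge0.
  apply: le_trans (fg _ Dx); rewrite funenegE/= -EFin_max lee_fin.
  by rewrite ge_max -normrN ler_norm normr_ge0.
have hp0 : (0 <= \int[mu]_(x in D) (EFin \o f)^\+ x)%E.
  by apply: integral_ge0 => x _; exact: funepos_ge0.
have hn0 : (0 <= \int[mu]_(x in D) (EFin \o f)^\- x)%E.
  by apply: integral_ge0 => x _; exact: funeneg_ge0.
rewrite /Rintegral integralE.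
set p := (\int[mu]_(x in D) _)%E in hp hp0 *; set n := (\int[mu]_(x in D) _)%E in hn hn0 *.
move: hp hn goo; set G := (\int[mu]_(x in D) _)%E => hp hn goo.
have pf : p \is a fin_num by rewrite ge0_fin_numE// (le_lt_trans hp).
have nf : n \is a fin_num by rewrite ge0_fin_numE// (le_lt_trans hn).
have Gf : G \is a fin_num by rewrite ge0_fin_numE// (le_trans hp0).
rewrite fineB//.
move: pf nf Gf hp hn hp0 hn0.
move=> /fineK <- /fineK <- /fineK <-; rewrite !lee_fin /= => *.
by rewrite ler_norml; lra.
Qed.

Lemma Rintegral_dominated (D : set T) (f_ : nat -> T -> R) (f g : T -> R) :
  measurable D -> (forall n, measurable_fun D (f_ n)) -> measurable_fun D f ->
  (forall x, D x -> f_ n x @[n --> \oo] --> f x) ->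
  mu.-integrable D (EFin \o g) -> (forall n x, D x -> `|f_ n x| <= g x) ->
  \int[mu]_(x in D) f_ n x @[n --> \oo] --> \int[mu]_(x in D) f x.
Proof.
move=> mD mf_ mf f_f ig f_g.
have [|||||fi _ cvg] := @dominated_convergence _ _ _ mu D mD
    (fun n => EFin \o f_ n) (EFin \o f) (EFin \o g).
- by move=> n; exact/measurable_EFinP.
- exact/measurable_EFinP.
- by apply: aeW => x Dx /=; apply/fine_cvgP; split; [exact: nearW|exact: f_f].
- exact: ig.
- by apply: aeW => x n Dx; rewrite lee_fin; exact: f_g.
rewrite /Rintegral; apply: fine_cvg; rewrite fineK; first exact: cvg.
exact: integrable_fin_num.
Qed.

Lemma integrable_le_fin (D : set T) (f g : T -> R) : measurable D ->
  measurable_fun D f -> (forall x, D x -> `|f x| <= g x) ->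
  mu.-integrable D (EFin \o g) -> mu.-integrable D (EFin \o f).
Proof.
move=> mD mf fg; apply: le_integrable => //; first exact/measurable_EFinP.
by move=> x Dx /=; rewrite lee_fin (le_trans (fg _ Dx))// ler_norm.
Qed.

Lemma Rintegral_EFin (D : set T) (f : T -> R) : measurable D ->
  mu.-integrable D (EFin \o f) ->
  (\int[mu]_(x in D) f x)%:E = (\int[mu]_(x in D) (f x)%:E)%E.
Proof. by move=> mD fi; rewrite /Rintegral fineK//; exact: integrable_fin_num. Qed.

Lemma Rintegral_ae_eq (D : set T) (f g : T -> R) : measurable D ->
  measurable_fun D f -> measurable_fun D g ->
  {ae mu, forall x, D x -> f x = g x} ->
  \int[mu]_(x in D) f x = \int[mu]_(x in D) g x.
Proof.
move=> mD mf mg fg; rewrite /Rintegral; congr fine; apply: ae_eq_integral => //.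
- exact/measurable_EFinP.
- exact/measurable_EFinP.
- by apply: filterS fg => x h Dx; rewrite /= h.
Qed.

End RealIntegration.

(** * Fubini's theorem for real integrals and sigma-finite products *)

Section RealFubini.
Context {R : realType} d1 d2 (T1 : measurableType d1) (T2 : measurableType d2).
Context (m1 : {sigma_finite_measure set T1 -> \bar R}).
Context (m2 : {sigma_finite_measure set T2 -> \bar R}).
Implicit Types f : T1 * T2 -> R.

Lemma Rintegral_prod1 f : (m1 \x m2)%E.-integrable setT (EFin \o f) ->
  m1.-integrable setT (EFin \o (fun x => \int[m2]_y f (x, y))) /\
  \int[(m1 \x m2)%E]_z f z = \int[m1]_x \int[m2]_y f (x, y).
Proof.
move=> fi; have Fi := integrable_fubini_F fi.
(* [Rintegral] replaces an infinite section integral by 0, which happens on a null set only. *)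
have Fae : ae_eq m1 setT (fubini_F m2 (EFin \o f)) (EFin \o (fun x => \int[m2]_y f (x, y))).
  have := integrable_ae (@measurableT _ _) Fi; apply: filterS => x h _ /=.
  by rewrite /Rintegral fineK//; apply: h.
have mF := measurable_int m1 Fi.
have mG : measurable_fun setT (EFin \o (fun x => \int[m2]_y f (x, y))).
  apply/measurable_EFinP; apply: (measurableT_comp (f := fine)) => //; exact: mF.
split.
  apply: le_integrable Fi => // x _; rewrite /= /Rintegral /fubini_F.
  by case: (integral _ _ _) => //=; rewrite normr0 leey.
rewrite /Rintegral -(integral12_prod_meas1 fi); congr fine.
exact: ae_eq_integral.
Qed.

Lemma Rintegral_prod2 f : (m1 \x m2)%E.-integrable setT (EFin \o f) ->
  m2.-integrable setT (EFin \o (fun y => \int[m1]_x f (x, y))) /\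
  \int[(m1 \x m2)%E]_z f z = \int[m2]_y \int[m1]_x f (x, y).
Proof.
move=> fi.
have mf : measurable_fun setT (EFin \o f) by exact: measurable_int fi.
have Fi : m2.-integrable setT (fubini_G m1 (EFin \o f)).
  apply/integrableP; split; first exact: (measurable_fubini_G fi).
  apply: le_lt_trans ((integrable21ltyP m1 m2 mf).1 fi).
  apply: ge0_le_lower_integral => y _; first exact: abse_ge0.
  apply: le_abse_integral => //.
  exact: (measurableT_comp mf (pair2_measurable y)).
have Fae : ae_eq m2 setT (fubini_G m1 (EFin \o f)) (EFin \o (fun y => \int[m1]_x f (x, y))).
  have := integrable_ae (@measurableT _ _) Fi; apply: filterS => x h _ /=.
  by rewrite /Rintegral fineK//; apply: h.
have mF := measurable_int m2 Fi.
have mG : measurable_fun setT (EFin \o (fun y => \int[m1]_x f (x, y))).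
  apply/measurable_EFinP; apply: (measurableT_comp (f := fine)) => //; exact: mF.
split.
  apply: le_integrable Fi => // x _; rewrite /= /Rintegral /fubini_G.
  by case: (integral _ _ _) => //=; rewrite normr0 leey.
rewrite /Rintegral -(integral21_prod_meas1 fi); congr fine.
exact: ae_eq_integral.
Qed.

Lemma Rintegral_swap f : (m1 \x m2)%E.-integrable setT (EFin \o f) ->
  \int[m1]_x \int[m2]_y f (x, y) = \int[m2]_y \int[m1]_x f (x, y).
Proof. by move=> fi; rewrite -(Rintegral_prod1 fi).2 (Rintegral_prod2 fi).2. Qed.

Lemma integrable_tensor (g : T1 -> R) (h : T2 -> R) :
  m1.-integrable setT (EFin \o g) -> m2.-integrable setT (EFin \o h) ->
  (m1 \x m2)%E.-integrable setT (EFin \o (fun z => g z.1 * h z.2)).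
Proof.
move=> gi hi.
have mg : measurable_fun setT g by apply/measurable_EFinP; exact: measurable_int gi.
have mh : measurable_fun setT h by apply/measurable_EFinP; exact: measurable_int hi.
apply/integrable12ltyP.
  apply/measurable_EFinP; apply: measurable_funM.
    by apply: (measurableT_comp mg).
  by apply: (measurableT_comp mh).
have mg' : measurable_fun setT (fun x => (`|g x|)%:E).
  by apply/measurable_EFinP; exact: measurableT_comp.
have mh' : measurable_fun setT (fun x => (`|h x|)%:E).
  by apply/measurable_EFinP; exact: measurableT_comp.
have [_ gfin] := integrableP _ _ _ gi; have [_ hfin] := integrableP _ _ _ hi.
have e x : (\int[m2]_y `|(g x * h y)%:E|%E =
    (`|g x|)%:E * \int[m2]_y (`|h y|)%:E)%E.
  rewrite -ge0_integralZl//.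
  by apply: eq_integral => y _; rewrite /= normrM EFinM.
rewrite (eq_integral _ _ (fun x _ => e x : _)) ge0_integralZr//; last exact: integral_ge0.
- rewrite lte_mul_pinfty//.
  + exact: integral_ge0.
  + by rewrite ge0_fin_numE//; exact: integral_ge0.
Qed.

End RealFubini.

Section ProductSigmaFinite.
Context {R : realType} d1 d2 (T1 : measurableType d1) (T2 : measurableType d2).
Context (m1 : {sigma_finite_measure set T1 -> \bar R}).
Context (m2 : {sigma_finite_measure set T2 -> \bar R}).

Lemma sigma_finite_product : sigma_finite setT (m1 \x m2)%E.
Proof.
have /sigma_finiteP[F [UF iF Ffin]] := sigma_finiteT m1.
have /sigma_finiteP[G [UG iG Gfin]] := sigma_finiteT m2.
exists (fun n => F n `*` G n) => [|n]; last first.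
  have [mF F_fin] := Ffin n; have [mG G_fin] := Gfin n.
  split; first exact: measurableX.
  by rewrite product_measure1E// lte_mul_pinfty// ge0_fin_numE.
apply/seteqP; split=> // -[x y] _.
have [i _ Fx] : (\bigcup_n F n) x by rewrite -UF.
have [j _ Gy] : (\bigcup_n G n) y by rewrite -UG.
exists (maxn i j) => //; split=> /=.
  by move: x Fx; apply/subsetPset/iF/leq_maxl.
by move: y Gy; apply/subsetPset/iG/leq_maxr.
Qed.

(** A triple product is integrated by using the two-factor theorems twice, which requires the
    product of the first two factors as a sigma-finite measure. *)
Definition product_sf : {sigma_finite_measure set (T1 * T2)%type -> \bar R} :=
  HB.pack (m1 \x m2)%E (Measure_isSigmaFinite.Build _ _ _ (m1 \x m2)%E sigma_finite_product).

End ProductSigmaFinite.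

Definition lebesgue2 {R : realType} := product_sf (leb R) (leb R).
Definition lebesgue3 {R : realType} := product_sf (@lebesgue2 R) (leb R).

(** * Reflection and translation of Lebesgue measure *)

Section ChangeOfVariable.
Context {R : realType}.
Local Notation mu := (@lebesgue_measure R).

Lemma measurable_oppr : measurable_fun setT (-%R : R -> measurableTypeR R).
Proof. exact: measurable_funN. Qed.

Lemma Rintegral_opp (f : R -> R) : mu.-integrable setT (EFin \o f) ->
  \int[mu]_x f (- x) = \int[mu]_x f x.
Proof.
move=> fi; rewrite /Rintegral; congr fine.
have mf : measurable_fun setT (EFin \o f) by exact: measurable_int fi.
have e (g : R -> \bar R) : measurable_fun setT g -> (forall x, 0 <= g x)%E ->
    (\int[mu]_x g (- x)%R = \int[mu]_x g x)%E.
  move=> mg g0.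
  transitivity (\int[pushforward mu (-%R : R -> measurableTypeR R)]_x g x)%E.
    by rewrite ge0_integral_pushforward//; exact: measurable_oppr.
  by apply: eq_measure_integral => //= A mA _; exact: lebesgue_measureN.
rewrite integralE [RHS]integralE; congr (_ - _)%E.
  rewrite -[RHS](e _ (measurable_funepos mf) (funepos_ge0 _)).
  by apply: eq_integral => x _; rewrite !funeposE.
rewrite -[RHS](e _ (measurable_funeneg mf) (funeneg_ge0 _)).
by apply: eq_integral => x _; rewrite !funenegE.
Qed.

(** The pushforward under translation agrees with Lebesgue measure on half-open intervals, which
    determine it. *)
Lemma ge0_integral_shift (a : R) (f : R -> \bar R) : measurable_fun setT f ->
  (forall x, 0 <= f x)%E -> (\int[mu]_x f (x + a)%R = \int[mu]_x f x)%E.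
Proof.
move=> mf f0.
have ms : measurable_fun setT ((fun x => x + a) : measurableTypeR R -> measurableTypeR R).
  exact: measurable_funD.
pose mixin := isMeasurableFun.Build _ _ _ _ _ ms.
pose shift : {mfun measurableTypeR R >-> measurableTypeR R} :=
  HB.pack ((fun x => x + a) : measurableTypeR R -> measurableTypeR R) mixin.
transitivity (\int[pushforward mu shift]_x f x)%E.
  by rewrite ge0_integral_pushforward.
apply: eq_measure_integral => //= A mA _.
apply/esym/lebesgue_measure_unique => //= _ [[b c]] _ <-.
rewrite /pushforward.
rewrite (_ : _ @^-1` _ = `]b - a, c - a]%classic); last first.
  by apply/seteqP; split => x /=; rewrite !in_itv/=; lra.
rewrite !lebesgue_measure_itv/= !lte_fin ltrD2r; case: ifP => // _.
by rewrite -!EFinD; congr EFin; lra.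
Qed.

Lemma Rintegral_odd (f : R -> R) : mu.-integrable setT (EFin \o f) ->
  (forall x, f (- x) = - f x) -> \int[mu]_x f x = 0.
Proof.
move=> fi fN; have := Rintegral_opp fi.
under eq_Rintegral do rewrite fN.
have -> : \int[mu]_x (- f x) = - \int[mu]_x f x.
  by under eq_Rintegral do rewrite -mulN1r; rewrite RintegralZl// mulN1r.
lra.
Qed.

Lemma Rintegral_even (f : R -> R) : mu.-integrable setT (EFin \o f) ->
  (forall x, f (- x) = f x) -> \int[mu]_x f x = 2 * \int[mu]_(x in `[0, +oo[) f x.
Proof.
move=> fi fN.
have i1 : mu.-integrable setT (EFin \o (f \_ `]0, +oo[)).
  rewrite -restrict_EFin; apply/(integrable_mkcond _ _).1 => //.
  by apply: (integrableS _ _ _ fi).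
rewrite [LHS](_ : _ = \int[mu]_(x in (`]-oo, 0[%classic `|` `[0, +oo[%classic)) f x); last first.
  congr (Rintegral _ _ _).
  by apply/seteqP; split => // x _; rewrite /= !in_itv/= andbT; case: (ltP x 0); [left|right].
rewrite Rintegral_setU//; last 2 first.
- by apply: (integrableS _ _ _ fi) => //; exact: measurableU.
- by apply/disj_setPS => x [] /=; rewrite !in_itv/= andbT; lra.
rewrite mulr2n mulrDl mul1r; congr +%R.
rewrite -Rintegral_itv_obnd_cbnd; last by apply: (integrableS _ _ _ fi).
rewrite [LHS]Rintegral_mkcond [RHS]Rintegral_mkcond -[RHS]Rintegral_opp//.
apply: eq_Rintegral => x _; rewrite !patchE fN.
by congr (if _ then _ else _); apply/idP/idP => /[!inE]/=; rewrite !in_itv/= andbT; lra.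
Qed.

End ChangeOfVariable.

Local Open Scope complex_scope.

(** * Complex numbers and complex-valued integrals *)

Section ComplexNumbers.
Context {R : realType}.
Implicit Types (z w : R[i]).
Local Notation Re := complex.Re.
Local Notation Im := complex.Im.

Lemma complex_ext z w : Re z = Re w -> Im z = Im w -> z = w.
Proof. by case: z => a b; case: w => c d /= -> ->. Qed.

Lemma ReM z w : Re (z * w) = Re z * Re w - Im z * Im w.
Proof. by case: z => a b; case: w => c d. Qed.

Lemma ImM z w : Im (z * w) = Re z * Im w + Im z * Re w.
Proof. by case: z => a b; case: w => c d. Qed.

Lemma ReD z w : Re (z + w) = Re z + Re w.
Proof. by case: z => a b; case: w => c d. Qed.

Lemma ImD z w : Im (z + w) = Im z + Im w.
Proof. by case: z => a b; case: w => c d. Qed.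

Lemma ReN z : Re (- z) = - Re z.
Proof. by case: z. Qed.

Lemma ImN z : Im (- z) = - Im z.
Proof. by case: z. Qed.

Lemma cabsE z : cabs z = Num.sqrt (Re z ^+ 2 + Im z ^+ 2).
Proof. by case: z. Qed.

Lemma cabs_ge0 z : 0 <= cabs z.
Proof. by rewrite cabsE sqrtr_ge0. Qed.

Lemma cabs0 : cabs (0 : R[i]) = 0.
Proof. exact: ComplexField.Normc.normc0. Qed.

Lemma cabsM z w : cabs (z * w) = cabs z * cabs w.
Proof. exact: ComplexField.Normc.normcM. Qed.

Lemma cabsD z w : cabs (z + w) <= cabs z + cabs w.
Proof. exact: le_normcD. Qed.

Lemma cabsN z : cabs (- z) = cabs z.
Proof. exact: normcN. Qed.

Lemma cabsC (x : R) : cabs x%:C = `|x|.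
Proof. by rewrite cabsE/= expr0n/= addr0 sqrtr_sqr. Qed.

Lemma cabs_cis (a : R) : cabs (cis a) = 1.
Proof. by rewrite cabsE/= cos2Dsin2 sqrtr1. Qed.

Lemma cisD (a b : R) : cis (a + b) = cis a * cis b.
Proof. by apply: complex_ext; rewrite ?ReM ?ImM/= ?cosD ?sinD//; ring. Qed.

Lemma cis0 : cis (0 : R) = 1.
Proof. by apply: complex_ext; rewrite /= ?cos0 ?sin0. Qed.

Lemma normRe_le z : `|Re z| <= cabs z.
Proof. by rewrite cabsE -sqrtr_sqr ler_wsqrtr// lerDl sqr_ge0. Qed.

Lemma normIm_le z : `|Im z| <= cabs z.
Proof. by rewrite cabsE -sqrtr_sqr ler_wsqrtr// lerDr sqr_ge0. Qed.

Lemma cabs_le z : cabs z <= `|Re z| + `|Im z|.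
Proof.
case: z => a b; have -> : a +i* b = a%:C + (0 +i* 1) * b%:C.
  by apply: complex_ext; rewrite ?ReD ?ImD ?ReM ?ImM/=; ring.
apply: le_trans (cabsD _ _) _.
rewrite cabsM !cabsC ReD ImD ReM ImM/=.
rewrite expr0n expr1n add0r sqrtr1.
by rewrite !(mul0r, mul1r, mulr0, subr0, addr0, add0r).
Qed.

Lemma cabs_sum (I : Type) (s : seq I) (F : I -> R[i]) :
  cabs (\sum_(i <- s) F i) <= \sum_(i <- s) cabs (F i).
Proof.
elim/big_rec2: _ => [|i x y _ h]; first by rewrite cabs0.
by apply: le_trans (cabsD _ _) _; rewrite lerD2l.
Qed.

Lemma cabs_sqr z : cabs z ^+ 2 = Re z ^+ 2 + Im z ^+ 2.
Proof. by rewrite cabsE sqr_sqrtr// addr_ge0// sqr_ge0. Qed.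

Lemma cabs_eq0 z : cabs z = 0 -> z = 0.
Proof. exact: ComplexField.Normc.eq0_normc. Qed.

End ComplexNumbers.

Section ComplexIntegration.
Context {R : realType} d (T : measurableType d) (mu : {measure set T -> \bar R}).
Implicit Types (f g : T -> R[i]).
Local Notation Re := complex.Re.
Local Notation Im := complex.Im.

Definition cmeasurable f :=
  measurable_fun setT (fun x => Re (f x)) /\ measurable_fun setT (fun x => Im (f x)).

Definition cintegrable f :=
  mu.-integrable setT (EFin \o (fun x => Re (f x))) /\
  mu.-integrable setT (EFin \o (fun x => Im (f x))).

Local Notation cint f := (cintegral mu setT f).

Lemma cmeasurable_cst (z : R[i]) : cmeasurable (fun=> z).
Proof. by split; exact: measurable_cst. Qed.

Lemma cmeasurable_real (f : T -> R) : measurable_fun setT f -> cmeasurable (fun x => (f x)%:C).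
Proof. by move=> mf; split => //=; exact: measurable_cst. Qed.

Lemma cmeasurableD f g : cmeasurable f -> cmeasurable g -> cmeasurable (fun x => f x + g x).
Proof.
move=> [? ?] [? ?]; split.
  by under eq_fun do rewrite ReD; exact: measurable_funD.
by under eq_fun do rewrite ImD; exact: measurable_funD.
Qed.

Lemma cmeasurableN f : cmeasurable f -> cmeasurable (fun x => - f x).
Proof.
move=> [? ?]; split.
  by under eq_fun do rewrite ReN; exact: measurable_funN.
by under eq_fun do rewrite ImN; exact: measurable_funN.
Qed.

Lemma cmeasurableM f g : cmeasurable f -> cmeasurable g -> cmeasurable (fun x => f x * g x).
Proof.
move=> [? ?] [? ?]; split.
  by under eq_fun do rewrite ReM; apply: measurable_funB; exact: measurable_funM.
by under eq_fun do rewrite ImM; apply: measurable_funD; exact: measurable_funM.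
Qed.

Lemma cmeasurable_cis (f : T -> R) : measurable_fun setT f -> cmeasurable (fun x => cis (f x)).
Proof.
move=> mf; split => /=.
  by apply: (measurableT_comp _ mf); apply: continuous_measurable_fun; exact: continuous_cos.
by apply: (measurableT_comp _ mf); apply: continuous_measurable_fun; exact: continuous_sin.
Qed.

Lemma measurable_cabs f : cmeasurable f -> measurable_fun setT (fun x => cabs (f x)).
Proof.
move=> [mr mi]; under eq_fun do rewrite cabsE.
have ms : measurable_fun setT (Num.sqrt : R -> R).
  by apply: continuous_measurable_fun; exact: sqrt_continuous.
apply: (measurableT_comp ms).
by apply: measurable_funD; exact: measurable_funX.
Qed.

Lemma cmeasurable_sum (I : Type) (s : seq I) (F : I -> T -> R[i]) :
  (forall i, cmeasurable (F i)) -> cmeasurable (fun x => \sum_(i <- s) F i x).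
Proof.
move=> mF; elim: s => [|i s IH].
  by under eq_fun do rewrite big_nil; exact: cmeasurable_cst.
by under eq_fun do rewrite big_cons; exact: cmeasurableD.
Qed.

Lemma cintegrable_measurable f : cintegrable f -> cmeasurable f.
Proof. by move=> [fr fi]; split; apply/measurable_EFinP; [exact: measurable_int fr|exact: measurable_int fi]. Qed.

Lemma cintegrable_le f (g : T -> R) : cmeasurable f -> (forall x, cabs (f x) <= g x) ->
  mu.-integrable setT (EFin \o g) -> cintegrable f.
Proof.
move=> [mr mi] fg gi; split; apply: (integrable_le_fin (g := g)) => // x _.
  exact: le_trans (normRe_le _) (fg x).
exact: le_trans (normIm_le _) (fg x).
Qed.

Lemma integrable_cabs f : cintegrable f -> mu.-integrable setT (EFin \o (fun x => cabs (f x))).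
Proof.
move=> fi; have mf := cintegrable_measurable fi; case: fi => fr fi.
apply: (integrable_le_fin (g := fun x => `|Re (f x)| + `|Im (f x)|)) => //.
- exact: measurable_cabs.
- by move=> x _; rewrite ger0_norm ?cabs_ge0// cabs_le.
- have := integrableD (@measurableT _ T) (integrable_norm fr) (integrable_norm fi).
  by apply: eq_integrable.
Qed.

Lemma cintegrable_fin f : cmeasurable f ->
  (\int[mu]_x (cabs (f x))%:E < +oo)%E -> cintegrable f.
Proof.
move=> mf foo; apply: (@cintegrable_le _ (fun x => cabs (f x))) => //.
apply/integrableP; split; first by apply/measurable_EFinP; exact: measurable_cabs.
apply: le_lt_trans foo; rewrite le_eqVlt; apply/orP; left; apply/eqP.
by apply: eq_integral => x _; rewrite /= ger0_norm// cabs_ge0.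
Qed.

Lemma cintegrable_bounded f g (M : R) : cmeasurable f -> (forall x, cabs (f x) <= M) ->
  cintegrable g -> cintegrable (fun x => f x * g x).
Proof.
move=> mf fM gi; apply: (@cintegrable_le _ (fun x => M * cabs (g x))).
- exact: (cmeasurableM mf (cintegrable_measurable gi)).
- by move=> x; rewrite cabsM ler_wpM2r// cabs_ge0.
- exact: (integrableZl (@measurableT _ T) M (integrable_cabs gi)).
Qed.

Lemma cintegrable_cabs_eq f g : cmeasurable g -> (forall x, cabs (g x) <= cabs (f x)) ->
  cintegrable f -> cintegrable g.
Proof. by move=> mg gf /integrable_cabs; exact: cintegrable_le. Qed.

Lemma cintegrableD f g : cintegrable f -> cintegrable g -> cintegrable (fun x => f x + g x).
Proof.
move=> [fr fi] [gr gi]; split.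
  by under eq_fun do rewrite ReD; exact: (integrableD (@measurableT _ T) fr gr).
by under eq_fun do rewrite ImD; exact: (integrableD (@measurableT _ T) fi gi).
Qed.

Lemma cintegrableN f : cintegrable f -> cintegrable (fun x => - f x).
Proof.
move=> fi; apply: (cintegrable_cabs_eq _ _ fi); last by move=> x; rewrite cabsN.
exact: (cmeasurableN (cintegrable_measurable fi)).
Qed.

Lemma cintegrableZ (z : R[i]) f : cintegrable f -> cintegrable (fun x => z * f x).
Proof. by move=> fi; apply: (cintegrable_bounded (cmeasurable_cst z) _ fi) => x; exact: lexx. Qed.

Lemma cintegrable0 : cintegrable (fun=> 0).
Proof. by split; exact: integrable0. Qed.

Lemma cintegralD f g : cintegrable f -> cintegrable g ->
  cint (fun x => f x + g x) = cint f + cint g.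
Proof.
move=> [? ?] [? ?]; rewrite /cintegral; apply: complex_ext; rewrite ?ReD ?ImD/=.
  by under eq_Rintegral do rewrite ReD; rewrite RintegralD.
by under eq_Rintegral do rewrite ImD; rewrite RintegralD.
Qed.

Lemma eq_cintegral f g : f =1 g -> cint f = cint g.
Proof. by move=> /funext ->. Qed.

Lemma cintegralZ (z : R[i]) f : cintegrable f -> cint (fun x => z * f x) = z * cint f.
Proof.
move=> [fr fi]; rewrite /cintegral; apply: complex_ext; rewrite ?ReM ?ImM/=.
  under eq_Rintegral do rewrite ReM.
  rewrite RintegralB//; [|exact: (integrableZl (@measurableT _ T) _ fr)|
    exact: (integrableZl (@measurableT _ T) _ fi)].
  by rewrite !RintegralZl.
under eq_Rintegral do rewrite ImM.
rewrite RintegralD//; [|exact: (integrableZl (@measurableT _ T) _ fi)|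
  exact: (integrableZl (@measurableT _ T) _ fr)].
by rewrite !RintegralZl.
Qed.

Lemma cintegralN f : cintegrable f -> cint (fun x => - f x) = - cint f.
Proof.
move=> fi; rewrite -mulN1r -cintegralZ//.
by apply: eq_cintegral => x; rewrite mulN1r.
Qed.

Lemma cintegral_ae_eq f g : cmeasurable f -> cmeasurable g ->
  {ae mu, forall x, f x = g x} -> cint f = cint g.
Proof.
move=> [fr fi] [gr gi] fg; rewrite /cintegral; congr Complex.
  by apply: Rintegral_ae_eq => //; apply: filterS fg => x ->.
by apply: Rintegral_ae_eq => //; apply: filterS fg => x ->.
Qed.

(* Multiplying by the conjugate of the integral reduces to a real integral. *)
Lemma cabs_cintegral f : cintegrable f -> cabs (cint f) <= \int[mu]_x cabs (f x).
Proof.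
move=> fi; have [->|I0] := eqVneq (cint f) 0.
  by rewrite cabs0; apply: Rintegral_ge0 => x _; exact: cabs_ge0.
have cI0 : 0 < cabs (cint f).
  rewrite lt_neqAle cabs_ge0 andbT eq_sym; apply/eqP => /cabs_eq0/eqP.
  by rewrite (negbTE I0).
set z := Complex (Re (cint f)) (- Im (cint f)).
have zI : Re (z * cint f) = cabs (cint f) ^+ 2.
  by rewrite cabs_sqr ReM /z/=; ring.
have cz : cabs z = cabs (cint f) by rewrite !cabsE/= sqrrN.
have zfi := cintegrableZ z fi.
rewrite -(ler_pM2l cI0) -expr2 -zI -cintegralZ// /cintegral/=.
rewrite -RintegralZl//; last exact: integrable_cabs.
apply: le_Rintegral => //.
- by case: zfi.
- exact: (integrableZl (@measurableT _ T) _ (integrable_cabs fi)).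
- move=> x _; apply: le_trans (ler_norm _) _.
  by apply: le_trans (normRe_le _) _; rewrite cabsM cz.
Qed.

Lemma cabs_cintegral_EFin f : cintegrable f ->
  ((cabs (cint f))%:E <= \int[mu]_x (cabs (f x))%:E)%E.
Proof.
move=> fi; rewrite -Rintegral_EFin//; last exact: integrable_cabs.
by rewrite lee_fin cabs_cintegral.
Qed.

(** Rotating the integral onto the real axis, as in [cabs_cintegral], relies on linearity and hence
    on the integrability of [f]. Estimating real and imaginary parts separately costs the factor 2
    but covers integrands of unknown measurability. *)
Lemma cabs_cintegral_lower (D : set T) f (g : T -> \bar R) :
  (forall x, D x -> ((cabs (f x))%:E <= g x)%E) ->
  (\int[mu]_(x in D) g x < +oo)%E ->
  ((cabs (cintegral mu D f))%:E <= 2%:E * \int[mu]_(x in D) g x)%E.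
Proof.
move=> fg goo.
have h1 := @norm_Rintegral_le _ _ _ mu D (fun x => Re (f x)) g _ goo.
have h2 := @norm_Rintegral_le _ _ _ mu D (fun x => Im (f x)) g _ goo.
apply: (@le_trans _ _ (`|Re (cintegral mu D f)|%:E + `|Im (cintegral mu D f)|%:E)%E).
  by rewrite -EFinD lee_fin cabs_le.
have g0 : (0 <= \int[mu]_(x in D) g x)%E.
  by apply: integral_ge0 => x Dx; apply: le_trans (fg _ Dx); rewrite lee_fin cabs_ge0.
rewrite (_ : 2%:E = 1 + 1)%E// ge0_muleDl// mul1e; apply: leeD.
  by apply: h1 => x Dx; apply: le_trans (fg _ Dx); rewrite lee_fin normRe_le.
by apply: h2 => x Dx; apply: le_trans (fg _ Dx); rewrite lee_fin normIm_le.
Qed.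

End ComplexIntegration.

Section ComplexFubini.
Context {R : realType} d1 d2 (T1 : measurableType d1) (T2 : measurableType d2).
Context (m1 : {sigma_finite_measure set T1 -> \bar R}).
Context (m2 : {sigma_finite_measure set T2 -> \bar R}).
Implicit Types f : T1 * T2 -> R[i].
Local Notation Re := complex.Re.
Local Notation Im := complex.Im.

Lemma cintegral_prod1 f : cintegrable (m1 \x m2)%E f ->
  cintegrable m1 (fun x => cintegral m2 setT (fun y => f (x, y))) /\
  cintegral (m1 \x m2)%E setT f =
    cintegral m1 setT (fun x => cintegral m2 setT (fun y => f (x, y))).
Proof.
move=> [fr fi]; have [r1 r2] := Rintegral_prod1 fr; have [i1 i2] := Rintegral_prod1 fi.
by split; [split|rewrite /cintegral/= r2 i2].
Qed.

Lemma cintegral_prod2 f : cintegrable (m1 \x m2)%E f ->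
  cintegrable m2 (fun y => cintegral m1 setT (fun x => f (x, y))) /\
  cintegral (m1 \x m2)%E setT f =
    cintegral m2 setT (fun y => cintegral m1 setT (fun x => f (x, y))).
Proof.
move=> [fr fi]; have [r1 r2] := Rintegral_prod2 fr; have [i1 i2] := Rintegral_prod2 fi.
by split; [split|rewrite /cintegral/= r2 i2].
Qed.

Lemma cintegral_swap f : cintegrable (m1 \x m2)%E f ->
  cintegral m1 setT (fun x => cintegral m2 setT (fun y => f (x, y))) =
  cintegral m2 setT (fun y => cintegral m1 setT (fun x => f (x, y))).
Proof. by move=> fi; rewrite -(cintegral_prod1 fi).2 (cintegral_prod2 fi).2. Qed.

Lemma cmeasurable_fst (g : T1 -> R[i]) : cmeasurable g ->
  cmeasurable (fun z : T1 * T2 => g z.1).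
Proof.
move=> [mr mi]; split; [exact: (measurableT_comp mr measurable_fst)|
  exact: (measurableT_comp mi measurable_fst)].
Qed.

Lemma cmeasurable_snd (g : T2 -> R[i]) : cmeasurable g ->
  cmeasurable (fun z : T1 * T2 => g z.2).
Proof.
move=> [mr mi]; split; [exact: (measurableT_comp mr measurable_snd)|
  exact: (measurableT_comp mi measurable_snd)].
Qed.

Lemma cintegrable_tensor (g : T1 -> R[i]) (h : T2 -> R[i]) :
  cintegrable m1 g -> cintegrable m2 h ->
  cintegrable (m1 \x m2)%E (fun z => g z.1 * h z.2).
Proof.
move=> gi hi; apply: (@cintegrable_le _ _ _ _ _ (fun z => cabs (g z.1) * cabs (h z.2))).
- exact: (cmeasurableM (cmeasurable_fst (cintegrable_measurable gi))
    (cmeasurable_snd (cintegrable_measurable hi))).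
- by move=> z; rewrite cabsM.
- exact: (integrable_tensor (integrable_cabs gi) (integrable_cabs hi)).
Qed.

Lemma cintegral_tensor (g : T1 -> R[i]) (h : T2 -> R[i]) :
  cintegrable m1 g -> cintegrable m2 h ->
  cintegral (m1 \x m2)%E setT (fun z => g z.1 * h z.2) =
  cintegral m1 setT g * cintegral m2 setT h.
Proof.
move=> gi hi; rewrite (cintegral_prod1 (cintegrable_tensor gi hi)).2/=.
under eq_cintegral => x do rewrite cintegralZ//.
rewrite [RHS]mulrC -cintegralZ//; apply: eq_cintegral => x.
by rewrite mulrC.
Qed.

End ComplexFubini.

(** * Fourier inversion on the line *)

Section Inversion.
Context {R : realType}.
Implicit Types (f g h : R -> R).
Local Notation mu := (@lebesgue_measure R).

Lemma integrable_oneDsqrV : mu.-integrable setT (EFin \o (fun x : R => (1 + x ^+ 2)^-1)).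
Proof.
have c : continuous (fun x : R => (1 + x ^+ 2)^-1) by exact: continuous_oneDsqrV.
apply/integrableP; split.
  by apply/measurable_EFinP; exact: continuous_measurable_fun.
rewrite (_ : (\int[mu]_x _)%E = (\int[mu]_x (1 + x ^+ 2)^-1%:E)%E); last first.
  apply: eq_integral => x _; rewrite /= ger0_norm// invr_ge0 addr_ge0//.
  exact: sqr_ge0.
have p0 x : 0 <= (1 + x ^+ 2)^-1 :> R by rewrite invr_ge0; have := sqr_ge0 x; lra.
have sym : (fun x : R => (1 + x ^+ 2)^-1) =1 (fun x => (1 + x ^+ 2)^-1) \o -%R.
  by move=> x; rewrite /= sqrrN.
rewrite (ge0_symfun_integralT p0 c sym).
rewrite (_ : [set x | 0 <= x] = `[0, +oo[%classic); last first.
  by apply/seteqP; split => x /=; rewrite in_itv/= andbT.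
by rewrite integral0y_oneDsqr -EFinM ltry.
Qed.

(** Both $h$ and $x^2h$ are bounded; the resulting majorant is integrable. *)
Lemma rapid_decay h : rapid h -> exists M, forall x, `|h x| <= M * (1 + x ^+ 2)^-1.
Proof.
move=> rh; have [_ rh1 [M hM]] := rapid_rapid_closed rh.
have [_ rh2 _] := rapid_rapid_closed rh1; have [_ _ [M' hM']] := rapid_rapid_closed rh2.
exists (M + M') => x; rewrite ler_pdivlMr; last by have := sqr_ge0 x; lra.
rewrite mulrDr mulr1 lerD// (le_trans _ (hM' x))// !normrM mulrA -normrM -expr2 mulrC.
by rewrite (ger0_norm (sqr_ge0 x)).
Qed.

Lemma rapid_continuous h : rapid h -> continuous h.
Proof. by move=> /rapid_rapid_closed[[g _ dg] _ _]; exact: is_derive_continuous dg. Qed.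

Lemma rapid_integrableM h (t : R -> R) : rapid h -> continuous t -> (forall x, `|t x| <= 1) ->
  mu.-integrable setT (EFin \o (fun x => h x * t x)).
Proof.
move=> rh ct t1; have [M hM] := rapid_decay rh.
apply: (@integrable_le_fin R _ (measurableTypeR R) mu setT _ (fun x => M * (1 + x ^+ 2)^-1)).
- exact: measurableT.
- apply: continuous_measurable_fun => x; apply: cvgM; [exact: rapid_continuous|exact: ct].
- by move=> x _; rewrite normrM (le_trans _ (hM x))// ler_piMr.
- exact: (integrableZl (@measurableT _ _) M integrable_oneDsqrV).
Qed.

Section HalfLine.
Variables (f : R -> R) (eta : R).
Hypothesis tf : testfun f.

Let Ph x := cosT f x * cos (x * eta) + sinT f x * sin (x * eta).

Lemma trig_pairE x :
  cosT f x * cos (x * eta) + sinT f x * sin (x * eta) =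
  \int[mu]_y (f y * cos (x * (y - eta))).
Proof.
have i1 := testfun_integrable tf (@continuous_cosM _ x).
have i2 := testfun_integrable tf (@continuous_sinM _ x).
rewrite /cosT /sinT (mulrC _ (cos (x * eta))) (mulrC _ (sin (x * eta))).
rewrite -!RintegralZl// -RintegralD//; last 2 first.
- exact: (integrableZl (@measurableT _ _) _ i1).
- exact: (integrableZl (@measurableT _ _) _ i2).
by apply: eq_Rintegral => y _; rewrite mulrBr cosB; ring.
Qed.

Let N (n : nat) : R := n.+1%:R ^+ 2.
Let eps (n : nat) : R := n.+1%:R^-1.

(** A cosine integral with damping $e^{-\epsilon x}$, $\epsilon=1/(n+1)$, cut off at
    $x=\epsilon^{-2}$. At the cut-off the damping is $e^{-(n+1)}$, small enough to beat the size
    $\epsilon^{-2}$ of $1/(\epsilon^2+y^2)$ at $y=0$. *)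
Definition kernel n (y : R) : R :=
  \int[mu]_(x in `[0, n.+1%:R ^+ 2]) (expR (- (n.+1%:R^-1 * x)) * cos (x * y)).

Let eps_gt0 n : 0 < eps n. Proof. by rewrite invr_gt0. Qed.
Let N_gt0 n : 0 < N n. Proof. by rewrite exprn_gt0. Qed.

Let antiderivative n (y x : R) : R :=
  (eps n ^+ 2 + y ^+ 2)^-1 * (expR (- (eps n * x)) * (y * sin (x * y) - eps n * cos (x * y))).

Let is_derive_antiderivative n (y x : R) : is_derive x 1 (antiderivative n y)
  (expR (- (eps n * x)) * cos (x * y)).
Proof.
have dm := is_derive_mulr y x.
have dc : is_derive x 1 (fun x => cos (x * y)) (- sin (x * y) * y).
  exact: (@is_derive1_comp _ cos).
have ds : is_derive x 1 (fun x => sin (x * y)) (cos (x * y) * y).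
  exact: (@is_derive1_comp _ sin).
have de : is_derive x 1 (fun x => expR (- (eps n * x))) (expR (- (eps n * x)) * - eps n).
  have dl : is_derive x 1 (fun x : R => - (eps n * x)) (- eps n).
    exact: (is_deriveN (is_derive_mull (eps n) x)).
  exact: (@is_derive1_comp _ expR).
apply: (is_derive_eq (is_deriveZ (eps n ^+ 2 + y ^+ 2)^-1
  (is_deriveM de (is_deriveB (is_deriveZ y ds) (is_deriveZ (eps n) dc))))).
rewrite !fctE /GRing.scale/=.
have d0 : eps n ^+ 2 + y ^+ 2 != 0.
  by rewrite gt_eqF// ltr_pwDl ?exprn_gt0 ?sqr_ge0.
move: (cos (x * y)) (sin (x * y)) (expR _) d0 => c s E; move: (eps n) => e d0.
by rewrite /GRing.scale/=; field.
Qed.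

(** The main term is the Poisson kernel $\epsilon/(\epsilon^2+y^2)$; the term with $e^{-(n+1)}$
    comes from the cut-off. *)
Lemma kernelE n y : kernel n y =
  (eps n ^+ 2 + y ^+ 2)^-1 *
  (eps n + expR (- n.+1%:R) * (y * sin (N n * y) - eps n * cos (N n * y))).
Proof.
rewrite /kernel /Rintegral (@continuous_FTC2 _ _ (antiderivative n y)).
- rewrite /antiderivative mulr0 !mul0r oppr0 expR0 sin0 cos0 mulr0 mul1r mulr1 sub0r.
  rewrite (_ : eps n * n.+1%:R ^+ 2 = n.+1%:R); last first.
    by rewrite /eps expr2 mulrA mulVf ?mul1r.
  by rewrite -EFinB/= -/(N n); ring.
- exact: N_gt0.
- apply: continuous_subspaceT => x; apply: cvgM.
    apply: continuous_comp; last exact: continuous_expR.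
    by apply: cvgN; exact: continuous_mull.
  apply: continuous_comp; last exact: continuous_cos.
  by apply: cvgM; [exact: cvg_id|exact: cvg_cst].
- have c := is_derive_continuous (is_derive_antiderivative n y); split.
  + by move=> x _; have [] := is_derive_antiderivative n y x.
  + by apply: cvg_at_right_filter; exact: c.
  + by apply: cvg_at_left_filter; exact: c.
- by move=> x _; apply: is_derive1E; exact: is_derive_antiderivative.
Qed.

Lemma kernel_swap n :
  \int[mu]_(x in `[0, N n]) (expR (- (eps n * x)) * Ph x) =
  \int[mu]_y (f y * kernel n (y - eta)).
Proof.
(* Cutting off the weight rather than the domain makes the exchange an instance of Fubini on the
   whole product. *)
pose w x := (fun x => expR (- (eps n * x))) \_ (`[0, N n]) x.
have wi : mu.-integrable setT (EFin \o w).
  rewrite -restrict_EFin; apply/(integrable_mkcond _ _).1 => //.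
  apply: continuous_compact_integrable; first exact: segment_compact.
  apply: continuous_subspaceT => x; apply: continuous_comp; last exact: continuous_expR.
  by apply: cvgN; exact: continuous_mull.
have fi : mu.-integrable setT (EFin \o f).
  by apply: integrable_compactly_supported; [exact: testfun_continuous|case: tf].
have mw : measurable_fun setT w by apply/measurable_EFinP; exact: measurable_int wi.
have mf : measurable_fun setT f by apply/measurable_EFinP; exact: measurable_int fi.
pose F (z : measurableTypeR R * measurableTypeR R) := w z.1 * (f z.2 * cos (z.1 * (z.2 - eta))).
have Fi : (mu \x mu)%E.-integrable setT (EFin \o F).
  apply: (@integrable_le_fin R _ _ (mu \x mu)%E setT F (fun z => `|w z.1| * `|f z.2|)).
  - exact: measurableT.
  - apply: measurable_funM; first exact: (measurableT_comp mw measurable_fst).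
    apply: measurable_funM; first exact: (measurableT_comp mf measurable_snd).
    apply: measurableT_comp; first exact: (continuous_measurable_fun (@continuous_cos R)).
    apply: measurable_funM; first exact: measurable_fst.
    by apply: measurable_funB; [exact: measurable_snd|exact: measurable_cst].
  - by move=> z _; rewrite /F !normrM ler_wpM2l// ler_piMr// norm_cos_le1.
  - exact: (integrable_tensor (integrable_norm wi) (integrable_norm fi)).
rewrite Rintegral_mkcond.
transitivity (\int[mu]_x \int[mu]_y F (x, y)).
  apply: eq_Rintegral => x _; rewrite {1}/F/= /w !patchE; case: ifPn => [_|_]; last first.
    by under eq_Rintegral do rewrite mul0r; rewrite Rintegral_cst ?mul0r.
  rewrite /Ph trig_pairE -RintegralZl//; apply: testfun_integrable => // y.
  apply: continuous_comp; last exact: continuous_cos.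
  apply: cvgM; first exact: cvg_cst.
  by apply: cvgB; [exact: cvg_id|exact: cvg_cst].
rewrite (Rintegral_swap Fi); apply: eq_Rintegral => y _; rewrite /F/= /kernel.
rewrite [in RHS]Rintegral_mkcond -RintegralZl//; last first.
  rewrite -restrict_EFin; apply/(integrable_mkcond _ _).1 => //.
  apply: continuous_compact_integrable; first exact: segment_compact.
  apply: continuous_subspaceT => x; apply: cvgM.
    apply: continuous_comp; last exact: continuous_expR.
    by apply: cvgN; exact: continuous_mull.
  apply: continuous_comp; last exact: continuous_cos.
  by apply: cvgM; [exact: cvg_id|exact: cvg_cst].
apply: eq_Rintegral => x _; rewrite /w !patchE; case: ifP => _; last by rewrite mul0r mulr0.
by rewrite -/(eps n); ring.
Qed.

End HalfLine.
End Inversion.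

Section Inversion2.
Context {R : realType}.
Implicit Types (f g h : R -> R).
Local Notation mu := (@lebesgue_measure R).

Lemma lipschitz_derive f g (L : R) : (forall x : R, is_derive x 1 f (g x)) ->
  (forall x, `|g x| <= L) -> forall x y, `|f x - f y| <= L * `|x - y|.
Proof.
move=> df gL.
have H x y : x < y -> `|f y - f x| <= L * `|y - x|.
  move=> xy; have [c _ ->] := MVT xy (fun z _ => df z) (continuous_subspaceT (is_derive_continuous df)).
  by rewrite normrM ler_wpM2r.
move=> x y; have [xy|yx|->] := ltgtP x y.
- by rewrite distrC (distrC x); exact: H.
- exact: H.
- by rewrite !subrr normr0 mulr0.
Qed.

Lemma harmonic_cvg0 (c : R) : c * n.+1%:R^-1 @[n --> \oo] --> (0 : R).
Proof. by rewrite -(mulr0 c); apply: cvgM; [exact: cvg_cst|exact: cvg_harmonic]. Qed.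

Lemma expRN_inv_cvg (x : R) : expR (- (n.+1%:R^-1 * x)) @[n --> \oo] --> (1 : R).
Proof.
have h : (fun n : nat => - (n.+1%:R^-1 * x)) n @[n --> \oo] --> (0 : R).
  rewrite -oppr0; apply: cvgN; under eq_fun do rewrite mulrC.
  exact: harmonic_cvg0.
rewrite -[X in _ --> X]expR0.
by apply: (cvg_comp _ _ h); exact: continuous_expR.
Qed.

(** From $e^x\ge 1+x^3/6$ at $x=n+1$. It makes the cut-off error in [kernel] tend to 0. *)
Lemma expR_cube_bound (n : nat) : expR (- n.+1%:R) * n.+1%:R ^+ 2 <= 6 * n.+1%:R^-1 :> R.
Proof.
have n0 : 0 < n.+1%:R :> R by [].
rewrite expRN -ler_pdivlMl ?invr_gt0 ?expR_gt0// invrK.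
have := expR_ge1Dxn 2 (ltW n0); rewrite (_ : 3`!%:R = 6 :> R)// => h.
apply: (@le_trans _ _ ((1 + n.+1%:R ^+ 3 / 6) * (6 / n.+1%:R))); last first.
  by rewrite ler_wpM2r// divr_ge0.
rewrite mulrDl mul1r.
have -> : n.+1%:R ^+ 3 / 6 * (6 / n.+1%:R) = n.+1%:R ^+ 2 :> R.
  by field; rewrite gt_eqF.
by rewrite lerDr divr_ge0.
Qed.

Section HalfLine.
Variables (f : R -> R) (eta : R).
Hypothesis tf : testfun f.

Let Ph x := cosT f x * cos (x * eta) + sinT f x * sin (x * eta).

Let P n (y : R) : R := (n.+1%:R^-1 ^+ 2 + y ^+ 2)^-1 * n.+1%:R^-1.

Let P_ge0 n y : 0 <= P n y.
Proof. by rewrite mulr_ge0// invr_ge0 addr_ge0 ?sqr_ge0. Qed.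

Let den_gt0 n (y : R) : 0 < n.+1%:R^-1 ^+ 2 + y ^+ 2.
Proof. by rewrite ltr_pwDl ?exprn_gt0 ?invr_gt0 ?sqr_ge0. Qed.

Lemma poisson_atan n B : 0 < B ->
  \int[mu]_(y in `[- B, B]) P n (y - eta) =
  atan (n.+1%:R * (B - eta)) - atan (n.+1%:R * (- B - eta)).
Proof.
move=> B0; have d (y : R) : is_derive y 1 (fun y => atan (n.+1%:R * (y - eta))) (P n (y - eta)).
  have dl : is_derive y 1 (fun y : R => n.+1%:R * (y - eta)) n.+1%:R.
    have d0 : is_derive y 1 (fun y : R => y - eta) 1.
      by have := is_deriveB (is_derive_id y 1) (is_derive_cst eta y 1); rewrite subr0.
    by apply: (is_derive_eq (is_deriveZ n.+1%:R d0)); rewrite /GRing.scale/= mulr1.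
  have da := is_derive1_atan (n.+1%:R * (y - eta)).
  have dc : is_derive y 1 (fun y => atan (n.+1%:R * (y - eta)))
    ((1 + (n.+1%:R * (y - eta)) ^+ 2)^-1 * n.+1%:R) by exact: (@is_derive1_comp _ atan).
  apply: (is_derive_eq dc); rewrite /P.
  move: (y - eta) => z; have := den_gt0 n z.
  have : 0 < 1 + (n.+1%:R * z) ^+ 2 by rewrite ltr_pwDl ?sqr_ge0.
  have : 0 < n.+1%:R :> R by [].
  move: (n.+1%:R : R) => k k0 h1 h2.
  have -> : k^-1 ^+ 2 + z ^+ 2 = (1 + (k * z) ^+ 2) * k^-1 ^+ 2.
    by field; rewrite gt_eqF.
  move: (1 + (k * z) ^+ 2) h1 => w w0.
  by field; rewrite !gt_eqF.
rewrite /Rintegral (@continuous_FTC2 _ _ (fun y => atan (n.+1%:R * (y - eta)))) //.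
- by rewrite gtrN.
- apply: continuous_subspaceT => y; apply: cvgM; last exact: cvg_cst.
  apply: cvgV; first by rewrite gt_eqF// den_gt0.
  apply: cvgD; first exact: cvg_cst.
  have c : continuous (fun y : R => y - eta) by move=> z; apply: cvgB; [exact: cvg_id|exact: cvg_cst].
  by rewrite expr2; under eq_fun do rewrite expr2; apply: cvgM; exact: c.
- have c := is_derive_continuous d; split.
  + by move=> x _; have [] := d x.
  + by apply: cvg_at_right_filter; exact: c.
  + by apply: cvg_at_left_filter; exact: c.
- by move=> x _; apply: is_derive1E; exact: d.
Qed.

Lemma atan_cvg (c : R) : 0 < c -> atan (n.+1%:R * c) @[n --> \oo] --> (pi / 2 : R).
Proof.
move=> c0.
have h : (fun n : nat => n.+1%:R * c) n @[n --> \oo] --> +oo.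
  apply/cvgryPge => A; near=> n.
  rewrite -ler_pdivrMr//.
  near: n; exists (Num.bound `|A / c|) => // n /= bn.
  apply: (le_trans (ler_norm _)); apply: ltW; apply: (lt_le_trans (archi_boundP (normr_ge0 _))).
  by rewrite ler_nat (leq_trans bn).
by apply: (cvg_comp _ _ h); exact: cvgy_atan.
Unshelve. all: by end_near. Qed.

Lemma Ph_integrable : mu.-integrable setT (EFin \o Ph).
Proof.
have i1 : mu.-integrable setT (EFin \o (fun x => cosT f x * cos (x * eta))).
  apply: rapid_integrableM; first exact: rapid_cosT.
    by under eq_fun do rewrite mulrC; exact: continuous_cosM.
  by move=> x; exact: norm_cos_le1.
have i2 : mu.-integrable setT (EFin \o (fun x => sinT f x * sin (x * eta))).
  apply: rapid_integrableM; first exact: rapid_sinT.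
    by under eq_fun do rewrite mulrC; exact: continuous_sinM.
  by move=> x; exact: norm_sin_le1.
exact: (integrableD (@measurableT _ _) i1 i2).
Qed.

(** The transforms of [f] decay rapidly, so [Ph] is integrable and dominates; damping and cut-off
    both disappear in the limit. *)
Lemma window_cvg :
  \int[mu]_(x in `[0, n.+1%:R ^+ 2]) (expR (- (n.+1%:R^-1 * x)) * Ph x) @[n --> \oo] -->
  \int[mu]_(x in `[0, +oo[) Ph x.
Proof.
have iP := Ph_integrable.
have mP : measurable_fun setT Ph by apply/measurable_EFinP; exact: measurable_int iP.
under eq_fun do rewrite Rintegral_mkcond; rewrite (Rintegral_mkcond mu `[0, +oo[).
apply: (@Rintegral_dominated R _ (measurableTypeR R) mu setT
  (fun n => (fun x => expR (- (n.+1%:R^-1 * x)) * Ph x) \_ `[0, n.+1%:R ^+ 2])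
  (Ph \_ `[0, +oo[) (fun x => `|Ph x|)).
- exact: measurableT.
- move=> n; apply/(measurable_restrictT _ _).1 => //; apply: measurable_funTS.
  apply: measurable_funM => //; apply: continuous_measurable_fun => x.
  apply: continuous_comp; last exact: continuous_expR.
  by apply: cvgN; exact: continuous_mull.
- by apply/(measurable_restrictT _ _).1 => //; exact: measurable_funTS.
- move=> x _; rewrite [X in _ --> X]patchE; case: ifPn => [|/negP h].
    rewrite inE/= in_itv/= andbT => x0.
    have : expR (- (n.+1%:R^-1 * x)) * Ph x @[n --> \oo] --> Ph x.
      rewrite -[X in _ --> X]mul1r; apply: cvgM; last exact: cvg_cst.
      exact: expRN_inv_cvg.
    apply: cvg_trans; apply: near_eq_cvg; near=> n.
    rewrite patchE ifT// inE/= in_itv/= x0/=.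
    near: n; exists (Num.bound x) => // n /= bn.
    apply: ltW; apply: (lt_le_trans (archi_boundP x0)).
    rewrite (@le_trans _ _ n.+1%:R)// ?ler_nat ?(leq_trans bn)//.
    by rewrite expr2 ler_peMr// ler1n.
  rewrite (_ : (fun n => _) = fun=> 0); first exact: cvg_cst.
  apply/funext => n; rewrite patchE ifF//; apply/negbTE/negP => hx; apply: h.
  by move: hx; rewrite !inE/= !in_itv/= andbT => /andP[].
- exact: (integrable_norm iP).
- move=> n x _; rewrite patchE; case: ifPn; last by rewrite normr0.
  rewrite inE/= in_itv/= => /andP[x0 _]; rewrite normrM ler_piMl//.
  by rewrite ger0_norm ?expR_ge0// -[leRHS]expR0 ler_expR oppr_le0 mulr_ge0.
Unshelve. all: by end_near. Qed.

(** The value [f eta] times the Poisson kernel is subtracted. As [f] is Lipschitz, the remainder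
    [h n] is bounded on [[- B, B]] and of order $1/(n+1)$ at each point, so its integral tends to 0.
    The subtracted part integrates exactly to a difference of arctangents, whose limit is $\pi$. *)
Lemma kernel_cvg : \int[mu]_y (f y * kernel n (y - eta)) @[n --> \oo] --> pi * f eta.
Proof.
have [g tg dg] := testfun_derive tf.
have [L hL] := testfun_bounded tg; have [M hM] := testfun_bounded tf.
have L0 : 0 <= L by rewrite (le_trans _ (hL 0)).
have M0 : 0 <= M by rewrite (le_trans _ (hM 0)).
case: (tf) => _ [A fA].
(* The support of [f] and the point [eta] both lie inside [[- B, B]], so the arctangents at the two
   ends have limits of opposite signs. *)
pose B := `|A| + `|eta| + 1.
have AB : A <= B by rewrite /B; have := ler_norm A; have := normr_ge0 eta; lra.
have B0 : 0 < B by rewrite /B; have := normr_ge0 A; have := normr_ge0 eta; lra.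
have etaB1 : 0 < B - eta by rewrite /B; have := normr_ge0 A; have := ler_norm eta; lra.
have etaB2 : 0 < B + eta by rewrite /B; have := normr_ge0 A; have := ler_norm (- eta); rewrite normrN; lra.
pose c y := L / `|y - eta| + 6 * M * (B + `|eta| + 1).
pose h n y := f y * kernel n (y - eta) - f eta * P n (y - eta).
have cP n : continuous (fun y => P n (y - eta)).
  move=> y; apply: cvgM; last exact: cvg_cst.
  apply: cvgV; first by rewrite gt_eqF// den_gt0.
  apply: cvgD; first exact: cvg_cst.
  have cc : continuous (fun y : R => y - eta) by move=> z; apply: cvgB; [exact: cvg_id|exact: cvg_cst].
  by rewrite expr2; under eq_fun do rewrite expr2; apply: cvgM; exact: cc.
have ck n : continuous (fun y => kernel n (y - eta)).
  have cc : continuous (fun y : R => y - eta) by move=> z; apply: cvgB; [exact: cvg_id|exact: cvg_cst].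
  have cm (k : R) : continuous (fun y : R => k * (y - eta)).
    by move=> z; apply: cvgM; [exact: cvg_cst|exact: cc].
  under eq_fun do rewrite kernelE; move=> y.
  apply: cvgM.
    apply: cvgV; first by rewrite gt_eqF// den_gt0.
    apply: cvgD; first exact: cvg_cst.
    by rewrite expr2; under eq_fun do rewrite expr2; apply: cvgM; exact: cc.
  apply: cvgD; first exact: cvg_cst.
  apply: cvgM; first exact: cvg_cst.
  apply: cvgB; apply: cvgM.
  - exact: cc.
  - by apply: (continuous_comp (cm _ y)); exact: continuous_sin.
  - exact: cvg_cst.
  - by apply: (continuous_comp (cm _ y)); exact: continuous_cos.
have cf := testfun_continuous tf.
have ch n : continuous (h n).
  move=> y; apply: cvgB; apply: cvgM; [exact: cf|exact: ck|exact: cvg_cst|exact: cP].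
have hE n y : h n y = (f y - f eta) * P n (y - eta) +
    f y * ((n.+1%:R^-1 ^+ 2 + (y - eta) ^+ 2)^-1 * (expR (- n.+1%:R) *
      ((y - eta) * sin (n.+1%:R ^+ 2 * (y - eta)) - n.+1%:R^-1 * cos (n.+1%:R ^+ 2 * (y - eta))))).
  by rewrite /h kernelE /P; ring.
have h2 n y : - B <= y <= B -> `|f y * ((n.+1%:R^-1 ^+ 2 + (y - eta) ^+ 2)^-1 * (expR (- n.+1%:R) *
      ((y - eta) * sin (n.+1%:R ^+ 2 * (y - eta)) - n.+1%:R^-1 * cos (n.+1%:R ^+ 2 * (y - eta)))))|
    <= 6 * M * (B + `|eta| + 1) * n.+1%:R^-1.
  move=> yB.
  have e1 : n.+1%:R^-1 <= 1 :> R by rewrite invf_le1// ler1n.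
  have d1 : `|(n.+1%:R^-1 ^+ 2 + (y - eta) ^+ 2)^-1| <= n.+1%:R ^+ 2.
    rewrite ger0_norm; last by rewrite invr_ge0 ltW// den_gt0.
    rewrite -[leRHS]invrK lef_pV2 ?posrE ?invr_gt0 ?exprn_gt0// -exprVn.
    by rewrite lerDl sqr_ge0.
  have t1 : `|(y - eta) * sin (n.+1%:R ^+ 2 * (y - eta)) - n.+1%:R^-1 * cos (n.+1%:R ^+ 2 * (y - eta))|
      <= B + `|eta| + 1.
    apply: (le_trans (ler_normB _ _)); rewrite !normrM lerD//.
      apply: (@le_trans _ _ `|y - eta|); first by rewrite ler_piMr// norm_sin_le1.
      by apply: (le_trans (ler_normB _ _)); rewrite lerD2r ler_norml.
    by rewrite mulr_ile1// ?norm_cos_le1// ger0_norm.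
  rewrite !normrM.
  apply: (@le_trans _ _ (M * (n.+1%:R ^+ 2 * (expR (- n.+1%:R) * (B + `|eta| + 1))))).
    rewrite ler_pM ?mulr_ge0//; rewrite ler_pM ?mulr_ge0//; rewrite ler_pM ?mulr_ge0//.
    by rewrite ger0_norm ?expR_ge0.
  have := expR_cube_bound n; set E := expR _; set K := (n.+1%:R : R); set b := B + _ + _.
  have b0 : 0 <= b by rewrite /b; have := normr_ge0 eta; lra.
  move=> hh; rewrite (_ : M * (K ^+ 2 * (E * b)) = M * b * (E * K ^+ 2)); last by ring.
  by rewrite (_ : 6 * M * b / K = M * b * (6 / K)) ?ler_wpM2l ?mulr_ge0//; ring.
have Pz n y : `|y - eta| * P n (y - eta) <= 1.
  rewrite /P; set z := y - eta; have e0 : 0 < n.+1%:R^-1 :> R by rewrite invr_gt0.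
  move: (n.+1%:R^-1 : R) e0 (den_gt0 n z) => e e0; rewrite mulrCA mulrC => d0.
  rewrite ler_pdivrMr// mul1r -(real_normK (num_real z)).
  have := sqr_ge0 (e - `|z|); have := sqr_ge0 (e); have := sqr_ge0 (`|z|); nra.
have h1 n y : `|(f y - f eta) * P n (y - eta)| <= L.
  rewrite normrM (ger0_norm (P_ge0 _ _)).
  apply: (@le_trans _ _ (L * `|y - eta| * P n (y - eta))).
    by rewrite ler_wpM2r//; exact: (lipschitz_derive dg).
  by rewrite -mulrA ler_piMr.
(* At [y = eta] both sides are 0, the inverse of 0 being 0. *)
have h1' n y : `|(f y - f eta) * P n (y - eta)| <= L / `|y - eta| * n.+1%:R^-1.
  have [->|yn] := eqVneq y eta; first by rewrite !subrr mul0r normr0 invr0 mulr0 mul0r.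
  have z0 : 0 < `|y - eta| by rewrite normr_gt0 subr_eq0.
  rewrite normrM (ger0_norm (P_ge0 _ _)).
  apply: (@le_trans _ _ (L * `|y - eta| * P n (y - eta))).
    by rewrite ler_wpM2r//; exact: (lipschitz_derive dg).
  rewrite -!mulrA ler_wpM2l// /P mulrA ler_wpM2r//.
  rewrite ler_pdivrMr// mulrC ler_pdivlMr// -expr2 real_normK ?num_real//.
  by rewrite lerDr sqr_ge0.
have hcvg : \int[mu]_(y in `[- B, B]) h n y @[n --> \oo] --> (0 : R).
  rewrite [X in _ --> X](_ : _ = \int[mu]_(y in `[- B, B]) (cst 0 y : R)); last first.
    by rewrite Rintegral_cst// mul0r.
  apply: (@Rintegral_dominated R _ (measurableTypeR R) mu _ h (cst 0)
      (fun=> L + 6 * M * (B + `|eta| + 1))).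
  - exact: measurable_itv.
  - by move=> n; apply: measurable_funTS; exact: continuous_measurable_fun.
  - exact: measurable_cst.
  - move=> y /=; rewrite in_itv/= => yB; apply/norm_cvg0P.
    apply: (@squeeze_cvgr _ _ _ _ (cst 0) (fun n => c y * n.+1%:R^-1)).
    + apply: nearW => n; rewrite normr_ge0/= hE.
      apply: (le_trans (ler_normD _ _)); rewrite /c [leRHS]mulrDl lerD//.
      exact: h2.
    + exact: cvg_cst.
    + exact: harmonic_cvg0.
  - apply: continuous_compact_integrable; first exact: segment_compact.
    by apply: continuous_subspaceT => x; exact: cvg_cst.
  - move=> n y /=; rewrite in_itv/= => yB; rewrite hE.
    apply: (le_trans (ler_normD _ _)); rewrite lerD//.
    apply: le_trans (h2 n y yB) _; rewrite ler_piMr//.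
      by rewrite !mulr_ge0//; have := normr_ge0 eta; lra.
    by rewrite invf_le1// ler1n.
have e n : \int[mu]_y (f y * kernel n (y - eta)) =
    \int[mu]_(y in `[- B, B]) h n y + f eta * (atan (n.+1%:R * (B - eta)) - atan (n.+1%:R * (- B - eta))).
  have ci (k : R -> R) : continuous k -> mu.-integrable `[- B, B] (EFin \o k).
    move=> kc; apply: continuous_compact_integrable; first exact: segment_compact.
    exact: continuous_subspaceT.
  rewrite -poisson_atan// -RintegralZl//; last exact: ci.
  rewrite -RintegralD//; last 2 first.
  - exact: ci.
  - by apply: ci => y; apply: cvgM; [exact: cvg_cst|exact: cP].
  rewrite (@supp_Rintegral _ _ A B)//; last by move=> y /fA ->; rewrite mul0r.
  by apply: eq_Rintegral => y _; rewrite /h; ring.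
rewrite (funext e) (_ : pi * f eta = 0 + f eta * (pi / 2 - (- (pi / 2)))); last by field.
apply: cvgD; first exact: hcvg.
apply: cvgM; first exact: cvg_cst.
apply: cvgB; first exact: atan_cvg.
under eq_fun do rewrite -opprD mulrN atanN.
by apply: cvgN; exact: atan_cvg.
Qed.

(** [window_cvg] and [kernel_cvg] compute the limit of one and the same sequence, written in two
    ways by [kernel_swap]. *)
Lemma half_line_inversion : \int[mu]_(x in `[0, +oo[) Ph x = pi * f eta.
Proof.
have := window_cvg; under eq_fun do rewrite (kernel_swap eta tf).
by move=> h; have := cvg_unique _ h kernel_cvg; apply.
Qed.

Lemma full_line_inversion : \int[mu]_x Ph x = 2 * pi * f eta.
Proof.
rewrite Rintegral_even ?half_line_inversion ?mulrA//; first exact: Ph_integrable.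
move=> x; rewrite /Ph mulNr cosN sinN.
have -> : cosT f (- x) = cosT f x.
  by apply: eq_Rintegral => y _; rewrite mulNr cosN.
suff -> : sinT f (- x) = - sinT f x by rewrite mulrNN.
rewrite -[RHS]mulN1r /sinT -[RHS]RintegralZl//; last exact: testfun_integrable (@continuous_sinM _ x).
by apply: eq_Rintegral => y _; rewrite mulNr sinN; ring.
Qed.

Lemma odd_part_inversion :
  \int[mu]_x (sinT f x * cos (x * eta) - cosT f x * sin (x * eta)) = 0.
Proof.
have i1 : mu.-integrable setT (EFin \o (fun x => sinT f x * cos (x * eta))).
  apply: rapid_integrableM; first exact: rapid_sinT.
    by under eq_fun do rewrite mulrC; exact: continuous_cosM.
  by move=> x; exact: norm_cos_le1.
have i2 : mu.-integrable setT (EFin \o (fun x => cosT f x * sin (x * eta))).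
  apply: rapid_integrableM; first exact: rapid_cosT.
    by under eq_fun do rewrite mulrC; exact: continuous_sinM.
  by move=> x; exact: norm_sin_le1.
apply: Rintegral_odd; first exact: (integrableB (@measurableT _ _) i1 i2).
move=> x; rewrite mulNr cosN sinN.
have -> : cosT f (- x) = cosT f x.
  by apply: eq_Rintegral => y _; rewrite mulNr cosN.
suff -> : sinT f (- x) = - sinT f x by ring.
rewrite -[RHS]mulN1r /sinT -[RHS]RintegralZl//; last exact: testfun_integrable (@continuous_sinM _ x).
by apply: eq_Rintegral => y _; rewrite mulNr sinN; ring.
Qed.

End HalfLine.
End Inversion2.

(** * Tensor products of rapidly decreasing functions *)

Section TensorSchwartz.
Context {R : realType}.
Implicit Types (f g h : R -> R).

Definition tensor {K : pzRingType} (f1 f2 f3 : R -> K) (x : space R) : K :=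
  f1 x.1.1 * f2 x.1.2 * f3 x.2.

Lemma rapid_scale (k : R) f : rapid f -> rapid (fun x => k * f x).
Proof.
move=> rf; pose C := [set h : R -> R | exists2 g, rapid g & h = fun x => k * g x].
exists C; last by exists f.
move=> _ [g rg ->]; have [[g' rg' dg] rx [M hM]] := rapid_rapid_closed rg; split.
- exists (fun x => k * g' x); first by exists g'.
  move=> x; have ? := dg x; exact: (@is_deriveZ R R R g k x 1).
- exists (fun x => x * g x) => //; apply/funext => x; ring.
- by exists (`|k| * M) => x; rewrite normrM ler_wpM2l.
Qed.

Lemma differentiable_tensor f1 f2 f3 (x : space R) :
  (forall z : R, derivable f1 z 1) -> (forall z : R, derivable f2 z 1) ->
  (forall z : R, derivable f3 z 1) -> differentiable (tensor f1 f2 f3) x.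
Proof.
move=> d1 d2 d3.
have p1 (V W : normedModType R) (z : V * W) : differentiable (fst : V * W -> V) z.
  have c : continuous (fst : V * W -> V) by move=> y; exact: cvg_fst.
  exact: (@linear_differentiable R _ _ (fst : {linear (V * W)%type -> V}) z c).
have p2 (V W : normedModType R) (z : V * W) : differentiable (snd : V * W -> W) z.
  have c : continuous (snd : V * W -> W) by move=> y; exact: cvg_snd.
  exact: (@linear_differentiable R _ _ (snd : {linear (V * W)%type -> W}) z c).
apply: differentiableM.
  apply: differentiableM.
    apply: (@differentiable_comp _ _ _ _ (fun x : space R => x.1.1) f1); last exact/derivable1_diffP.
    exact: (@differentiable_comp _ _ _ _ (fst : space R -> R * R) fst).
  apply: (@differentiable_comp _ _ _ _ (fun x : space R => x.1.2) f2); last exact/derivable1_diffP.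
  exact: (@differentiable_comp _ _ _ _ (fst : space R -> R * R) snd).
by apply: (@differentiable_comp _ _ _ _ (snd : space R -> R) f3); last exact/derivable1_diffP.
Qed.

Lemma derive_along (V : normedModType R) (F : V -> R) (v x : V) f (z d : R) :
  (forall h : R, F (h *: v + x) = f (h + z)) -> is_derive z 1 f d -> 'D_v F x = d.
Proof.
move=> e [_ <-]; rewrite /derive.
have E : (fun h : R => h^-1 *: ((F \o shift x) (h *: v) - F x)) =
    (fun h : R => h^-1 *: ((f \o shift z) (h *: 1) - f z)).
  apply/funext => h; rewrite /= e; congr (_ *: (_ - _)).
    by rewrite /GRing.scale/= mulr1.
  by have := e 0; rewrite scale0r !add0r.
by rewrite E.
Qed.

Lemma derive_tensor f1 f2 f3 g1 g2 g3 (j : 'I_3) :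
  (forall z : R, is_derive z 1 f1 (g1 z)) -> (forall z : R, is_derive z 1 f2 (g2 z)) ->
  (forall z : R, is_derive z 1 f3 (g3 z)) ->
  (fun x => 'D_(ebasis j) (tensor f1 f2 f3) x) =
  tensor (if j == 0%N :> nat then g1 else f1) (if j == 1%N :> nat then g2 else f2)
    (if j == 2%N :> nat then g3 else f3).
Proof.
move=> d1 d2 d3; apply/funext => x.
case: j => [[|[|[|//]]] ?]; rewrite /ebasis /tensor/=.
- have ? := d1 x.1.1.
  apply: (@derive_along _ _ _ _ (fun y => (f2 x.1.2 * f3 x.2) * f1 y) x.1.1).
    by move=> h; rewrite /= !scaler0 !add0r /GRing.scale/= mulr1; ring.
  apply: (is_derive_eq (@is_deriveZ R R R f1 (f2 x.1.2 * f3 x.2) x.1.1 1 (g1 x.1.1) _)).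
  by rewrite /GRing.scale/=; ring.
- have ? := d2 x.1.2.
  apply: (@derive_along _ _ _ _ (fun y => (f1 x.1.1 * f3 x.2) * f2 y) x.1.2).
    by move=> h; rewrite /= !scaler0 !add0r /GRing.scale/= mulr1; ring.
  apply: (is_derive_eq (@is_deriveZ R R R f2 (f1 x.1.1 * f3 x.2) x.1.2 1 (g2 x.1.2) _)).
  by rewrite /GRing.scale/=; ring.
- have ? := d3 x.2.
  apply: (@derive_along _ _ _ _ (fun y => (f1 x.1.1 * f2 x.1.2) * f3 y) x.2).
    by move=> h; rewrite /= !scaler0 !add0r /GRing.scale/= mulr1; ring.
Qed.

(** Each partial derivative acts on one factor and leaves the other two alone. The new factors are
    only asserted to exist, in keeping with the coinductive form of [rapid]. *)
Lemma pderivs_tensor s f1 f2 f3 : rapid f1 -> rapid f2 -> rapid f3 ->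
  exists g1 g2 g3, [/\ rapid g1, rapid g2, rapid g3 &
    pderivs s (tensor f1 f2 f3) = tensor g1 g2 g3].
Proof.
move=> r1 r2 r3; elim: s => [|j s [g1 [g2 [g3 [s1 s2 s3 e]]]]].
  by exists f1, f2, f3.
have [[h1 t1 d1] _ _] := rapid_rapid_closed s1.
have [[h2 t2 d2] _ _] := rapid_rapid_closed s2.
have [[h3 t3 d3] _ _] := rapid_rapid_closed s3.
exists (if j == 0%N :> nat then h1 else g1), (if j == 1%N :> nat then h2 else g2),
  (if j == 2%N :> nat then h3 else g3); split; [by case: ifP|by case: ifP|by case: ifP|].
by rewrite /= e -/(pderivs s _) -(derive_tensor _ d1 d2 d3).
Qed.

Lemma enorm3_le (x : space R) : enorm3 x <= `|x.1.1| + `|x.1.2| + `|x.2|.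
Proof.
rewrite /enorm3 -[leRHS]ger0_norm ?addr_ge0// -sqrtr_sqr ler_wsqrtr//.
rewrite /dot !big_ord_recl big_ord0 /coord/= addr0 -!expr2.
rewrite -(real_normK (num_real x.1.1)) -(real_normK (num_real x.1.2)) -(real_normK (num_real x.2)).
have := normr_ge0 x.1.1; have := normr_ge0 x.1.2; have := normr_ge0 x.2.
by move: `|x.1.1| `|x.1.2| `|x.2| => a b c *; nra.
Qed.

Lemma rapid_weight k f : rapid f -> exists M, forall x, (1 + `|x|) ^+ k * `|f x| <= M.
Proof.
elim: k f => [|k IH] f rf; have [_ rx [M hM]] := rapid_rapid_closed rf.
  by exists M => x; rewrite expr0 mul1r.
have [M1 h1] := IH _ rf; have [M2 h2] := IH _ rx; exists (M1 + M2) => x.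
rewrite exprS (_ : _ * _ = (1 + `|x|) ^+ k * `|f x| + (1 + `|x|) ^+ k * `|x * f x|).
  by rewrite lerD.
by rewrite normrM; ring.
Qed.

(** Since $|x|\le(1+|x_1|)(1+|x_2|)(1+|x_3|)$, the weight splits over the three factors. *)
Lemma tensor_seminorm k f1 f2 f3 : rapid f1 -> rapid f2 -> rapid f3 ->
  exists M, forall x, enorm3 x ^+ k * `|tensor f1 f2 f3 x| <= M.
Proof.
move=> r1 r2 r3; have [M1 h1] := rapid_weight k r1; have [M2 h2] := rapid_weight k r2.
have [M3 h3] := rapid_weight k r3; exists (M1 * M2 * M3) => x.
apply: (@le_trans _ _ (((1 + `|x.1.1|) ^+ k * `|f1 x.1.1|) * ((1 + `|x.1.2|) ^+ k * `|f2 x.1.2|)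
  * ((1 + `|x.2|) ^+ k * `|f3 x.2|))).
  have -> : forall a b c d e g : R, a * b * (c * d) * (e * g) = a * c * e * (b * d * g).
    by move=> *; ring.
  rewrite /tensor !normrM ler_wpM2r ?mulr_ge0// -!exprMn lerXn2r ?nnegrE ?sqrtr_ge0 ?mulr_ge0 ?addr_ge0//.
  apply: (le_trans (enorm3_le x)).
  have := normr_ge0 x.1.1; have := normr_ge0 x.1.2; have := normr_ge0 x.2.
  move: `|x.1.1| `|x.1.2| `|x.2| => a b c c0 b0 a0.
  by have := mulr_ge0 a0 b0; have := mulr_ge0 a0 c0; have := mulr_ge0 b0 c0;
    have := mulr_ge0 (mulr_ge0 a0 b0) c0; nra.
have p (y : R) : 0 <= (1 + `|y|) ^+ k by rewrite exprn_ge0// addr_ge0.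
by rewrite ler_pM ?mulr_ge0// ler_pM ?mulr_ge0.
Qed.

Lemma schwartzR_tensor f1 f2 f3 : rapid f1 -> rapid f2 -> rapid f3 ->
  schwartzR (tensor f1 f2 f3).
Proof.
move=> r1 r2 r3; split=> [s x|k s]; have [g1 [g2 [g3 [s1 s2 s3 e]]]] := pderivs_tensor s r1 r2 r3.
  rewrite e; apply: differentiable_tensor.
  - by have [[h _ d] _ _] := rapid_rapid_closed s1 => z; have [] := d z.
  - by have [[h _ d] _ _] := rapid_rapid_closed s2 => z; have [] := d z.
  - by have [[h _ d] _ _] := rapid_rapid_closed s3 => z; have [] := d z.
rewrite /seminorm_le e; exact: tensor_seminorm.
Qed.

Lemma schwartzRD (f g : space R -> R) : schwartzR f -> schwartzR g ->
  schwartzR (fun x => f x + g x).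
Proof.
move=> [df bf] [dg bg].
have e s : pderivs s (fun x => f x + g x) = (fun x => pderivs s f x + pderivs s g x).
  elim: s => [//|j s IH]; rewrite /= -/(pderivs s _) IH; apply/funext => x.
  have h1 := diff_derivable (v := ebasis j) (df s x).
  have h2 := diff_derivable (v := ebasis j) (dg s x).
  exact: (deriveD h1 h2).
split=> [s x|k s]; first by rewrite e; exact: differentiableD.
have [M1 h1] := bf k s; have [M2 h2] := bg k s; exists (M1 + M2) => x.
rewrite e; apply: le_trans (lerD (h1 x) (h2 x)); rewrite -mulrDr ler_wpM2l//.
  by rewrite exprn_ge0// sqrtr_ge0.
exact: ler_normD.
Qed.

Lemma schwartzR0 : schwartzR (fun _ : space R => 0).
Proof.
have e s : pderivs s (fun _ : space R => 0) = (fun=> (0 : R)).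
  elim: s => [//|j s IH]; rewrite /= -/(pderivs s _) IH; apply/funext => x.
  exact: (derive_cst (0 : R)).
split=> [s x|k s]; first by rewrite e; exact: differentiable_cst.
by exists 0 => x; rewrite e normr0 mulr0.
Qed.

End TensorSchwartz.

(** * Fourier transforms of tensors *)

Section TensorFourier.
Context {R : realType}.
Implicit Types (f g h : R -> R) (sg : R).
Local Notation mu := (@lebesgue_measure R).
Local Notation mu3 := (@lebesgue3 R).

(* For [sg = 1] and [sg = -1], the integral of [e^{i sg x y} f y] over [y]. *)
Definition FT1 sg f (x : R) : R[i] := cosT f x +i* (sg * sinT f x).

Definition is_sign sg := sg = 1 \/ sg = -1.

Lemma is_signN sg : is_sign sg -> is_sign (- sg).
Proof. by move=> [->|->]; [right|left; rewrite opprK]. Qed.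

Lemma cos_sign sg x : is_sign sg -> cos (sg * x) = cos x.
Proof. by move=> [->|->]; rewrite ?mul1r// mulN1r cosN. Qed.

Lemma sin_sign sg x : is_sign sg -> sin (sg * x) = sg * sin x.
Proof. by move=> [->|->]; rewrite ?mul1r// !mulN1r sinN. Qed.

Lemma sign_sqr sg : is_sign sg -> sg * sg = 1.
Proof. by move=> [->|->]; rewrite ?mulr1// mulrNN mulr1. Qed.

Lemma cintegrable_testfun sg f (x : R) : testfun f ->
  cintegrable mu (fun y => cis (sg * (x * y)) * (f y)%:C).
Proof.
move=> tf; apply: (@cintegrable_le R _ (measurableTypeR R) mu _ (fun y => `|f y|)).
- apply: cmeasurableM.
    apply: cmeasurable_cis; apply: measurable_funM; first exact: measurable_cst.
    by apply: measurable_funM; [exact: measurable_cst|exact: measurable_id].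
  apply: cmeasurable_real; apply: continuous_measurable_fun.
  exact: testfun_continuous.
- by move=> y; rewrite cabsM cabs_cis mul1r cabsC.
- apply: integrable_norm; apply: integrable_compactly_supported; last by case: tf.
  exact: testfun_continuous.
Qed.

Lemma FT1_cintegral sg f (x : R) : is_sign sg -> testfun f ->
  cintegral mu setT (fun y => cis (sg * (x * y)) * (f y)%:C) = FT1 sg f x.
Proof.
move=> ssg tf; rewrite /cintegral /FT1; congr Complex.
  by apply: eq_Rintegral => y _; rewrite ReM/= (cos_sign _ ssg) mulr0 subr0 mulrC.
rewrite /sinT -RintegralZl//; last exact: testfun_integrable (@continuous_sinM _ x).
by apply: eq_Rintegral => y _; rewrite ImM/= (sin_sign _ ssg) mulr0 add0r; ring.
Qed.

Lemma rapid_ReFT1 sg f : testfun f -> rapid (fun x => complex.Re (FT1 sg f x)).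
Proof. exact: rapid_cosT. Qed.

Lemma rapid_ImFT1 sg f : testfun f -> rapid (fun x => complex.Im (FT1 sg f x)).
Proof. by move=> tf; apply: rapid_scale; exact: rapid_sinT. Qed.

Lemma cmeasurable_FT1 sg f : testfun f -> cmeasurable (FT1 sg f).
Proof.
move=> tf; split; apply: continuous_measurable_fun; apply: rapid_continuous.
  exact: rapid_ReFT1.
exact: rapid_ImFT1.
Qed.

Lemma cintegrable_FT1 sg tau f (x : R) : testfun f ->
  cintegrable mu (fun y => cis (tau * (y * x)) * FT1 sg f y).
Proof.
move=> tf.
have [M1 h1] := rapid_decay (@rapid_ReFT1 sg f tf).
have [M2 h2] := rapid_decay (@rapid_ImFT1 sg f tf).
apply: (@cintegrable_le R _ (measurableTypeR R) mu _ (fun y => (M1 + M2) * (1 + y ^+ 2)^-1)).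
- apply: cmeasurableM; last exact: cmeasurable_FT1.
  apply: cmeasurable_cis; apply: measurable_funM; first exact: measurable_cst.
  by apply: measurable_funM; [exact: measurable_id|exact: measurable_cst].
- move=> y; rewrite cabsM cabs_cis mul1r; apply: (le_trans (cabs_le _)).
  by rewrite mulrDl lerD.
- exact: (integrableZl (@measurableT _ _) _ integrable_oneDsqrV).
Qed.

(** The real part is the inversion formula for an even integrand; the imaginary part is, up to sign,
    the integral of an odd function. *)
Lemma FT1_inversion sg f (x : R) : is_sign sg -> testfun f ->
  cintegral mu setT (fun y => cis (- sg * (y * x)) * FT1 sg f y) = (2 * pi * f x)%:C.
Proof.
move=> ssg tf; rewrite /cintegral; congr Complex.
  rewrite -full_line_inversion//; apply: eq_Rintegral => y _.
  rewrite ReM/= (cos_sign _ (is_signN ssg)) (sin_sign _ (is_signN ssg)).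
  have := sign_sqr ssg; set s := sin _; set c := cos _ => e.
  rewrite (_ : - sg * s * (sg * sinT f y) = - ((sg * sg) * (s * sinT f y))); last by ring.
  by rewrite e; ring.
transitivity (sg * \int[mu]_y (sinT f y * cos (y * x) - cosT f y * sin (y * x))); last first.
  by rewrite odd_part_inversion// mulr0.
rewrite -RintegralZl//; last first.
  have i1 : mu.-integrable setT (EFin \o (fun y => sinT f y * cos (y * x))).
    apply: rapid_integrableM; first exact: rapid_sinT.
      by under eq_fun do rewrite mulrC; exact: continuous_cosM.
    by move=> y; exact: norm_cos_le1.
  have i2 : mu.-integrable setT (EFin \o (fun y => cosT f y * sin (y * x))).
    apply: rapid_integrableM; first exact: rapid_cosT.
      by under eq_fun do rewrite mulrC; exact: continuous_sinM.
    by move=> y; exact: norm_sin_le1.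
  exact: (integrableB (@measurableT _ _) i1 i2).
apply: eq_Rintegral => y _.
by rewrite ImM/= (cos_sign _ (is_signN ssg)) (sin_sign _ (is_signN ssg)); ring.
Qed.

Lemma FT1_derive sg f g (x : R) : is_sign sg -> testfun f -> testfun g ->
  (forall z : R, is_derive z 1 f (g z)) ->
  FT1 sg g x = (0 +i* (- sg * x)) * FT1 sg f x.
Proof.
move=> ssg tf tg df; have h1 := mul_cosT x tf tg df; have h2 := mul_sinT x tf tg df.
apply: complex_ext; rewrite ?ReM ?ImM/= mul0r.
  rewrite -h2 sub0r (_ : - (- sg * x * (sg * sinT f x)) = (sg * sg) * (x * sinT f x)); last by ring.
  by rewrite sign_sqr// mul1r.
rewrite (_ : 0 + - sg * x * cosT f x = - sg * (x * cosT f x)); last by ring.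
by rewrite h1; ring.
Qed.

Lemma cintegral_tensor3 (g1 g2 g3 : R -> R[i]) :
  cintegrable mu g1 -> cintegrable mu g2 -> cintegrable mu g3 ->
  cintegrable mu3 (tensor g1 g2 g3) /\
  cintegral mu3 setT (tensor g1 g2 g3) =
    cintegral mu setT g1 * cintegral mu setT g2 * cintegral mu setT g3.
Proof.
move=> i1 i2 i3; have i12 := cintegrable_tensor i1 i2.
split; first exact: (@cintegrable_tensor R _ _ _ _ lebesgue2 mu _ _ i12 i3).
by rewrite -(cintegral_tensor i1 i2) -(@cintegral_tensor R _ _ _ _ lebesgue2 mu _ _ i12 i3).
Qed.

Lemma dotE (x y : space R) : dot x y = x.1.1 * y.1.1 + x.1.2 * y.1.2 + x.2 * y.2.
Proof. by rewrite /dot !big_ord_recl big_ord0 /coord/= addr0 addrA. Qed.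

Lemma dotC (x y : space R) : dot x y = dot y x.
Proof. by rewrite !dotE; ring. Qed.

Definition FT3 sg (f1 f2 f3 : R -> R) : space R -> R[i] :=
  tensor (FT1 sg f1) (FT1 sg f2) (FT1 sg f3).

Definition ctens (f1 f2 f3 : R -> R) : space R -> R[i] := fun x => (tensor f1 f2 f3 x)%:C.

Lemma cis_dot_tensor sg (x : space R) (g1 g2 g3 : R -> R[i]) y :
  cis (sg * dot y x) * tensor g1 g2 g3 y =
  tensor (fun a => cis (sg * (x.1.1 * a)) * g1 a) (fun a => cis (sg * (x.1.2 * a)) * g2 a)
    (fun a => cis (sg * (x.2 * a)) * g3 a) y.
Proof.
rewrite dotE !mulrDr !cisD /tensor.
by rewrite !(mulrC x.1.1) !(mulrC x.1.2) !(mulrC x.2); ring.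
Qed.

Lemma FT3_cintegral sg f1 f2 f3 (x : space R) : is_sign sg ->
  testfun f1 -> testfun f2 -> testfun f3 ->
  cintegrable mu3 (fun y => cis (sg * dot y x) * ctens f1 f2 f3 y) /\
  cintegral mu3 setT (fun y => cis (sg * dot y x) * ctens f1 f2 f3 y) = FT3 sg f1 f2 f3 x.
Proof.
move=> ssg t1 t2 t3.
have e : (fun y => cis (sg * dot y x) * ctens f1 f2 f3 y) =
    tensor (fun a => cis (sg * (x.1.1 * a)) * (f1 a)%:C)
      (fun a => cis (sg * (x.1.2 * a)) * (f2 a)%:C) (fun a => cis (sg * (x.2 * a)) * (f3 a)%:C).
  by apply/funext => y; rewrite /= -cis_dot_tensor /tensor /ctens /= !rmorphM.
have [i E] := cintegral_tensor3 (cintegrable_testfun sg x.1.1 t1)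
  (cintegrable_testfun sg x.1.2 t2) (cintegrable_testfun sg x.2 t3).
by rewrite e; split=> //; rewrite E !FT1_cintegral.
Qed.

Lemma FT3_inversion sg f1 f2 f3 (x : space R) : is_sign sg ->
  testfun f1 -> testfun f2 -> testfun f3 ->
  cintegrable mu3 (fun y => cis (- sg * dot y x) * FT3 sg f1 f2 f3 y) /\
  cintegral mu3 setT (fun y => cis (- sg * dot y x) * FT3 sg f1 f2 f3 y) =
    ((2 * pi) ^+ 3)%:C * ctens f1 f2 f3 x.
Proof.
move=> ssg t1 t2 t3.
have c (g : R -> R) (z : R) : (fun a => cis (- sg * (z * a)) * FT1 sg g a) =
    (fun a => cis (- sg * (a * z)) * FT1 sg g a).
  by apply/funext => a; rewrite (mulrC z).
have e : (fun y => cis (- sg * dot y x) * FT3 sg f1 f2 f3 y) = _ :=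
  funext (cis_dot_tensor (- sg) x _ _ _).
rewrite e !c.
have [i E] := cintegral_tensor3 (cintegrable_FT1 sg (- sg) x.1.1 t1)
  (cintegrable_FT1 sg (- sg) x.1.2 t2) (cintegrable_FT1 sg (- sg) x.2 t3).
split=> //; rewrite E !FT1_inversion// /ctens /tensor -!rmorphM; congr (_%:C).
by ring.
Qed.

Lemma FT3_integrable sg f1 f2 f3 : testfun f1 -> testfun f2 -> testfun f3 ->
  cintegrable mu3 (FT3 sg f1 f2 f3).
Proof.
have c0 f : testfun f -> cintegrable mu (FT1 sg f).
  move=> /(cintegrable_FT1 sg 0 0); congr cintegrable.
  by apply/funext => y; rewrite mul0r cis0 mul1r.
by move=> t1 t2 t3; apply: (cintegral_tensor3 (c0 _ t1) (c0 _ t2) (c0 _ t3)).1.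
Qed.

Lemma ctens_integrable f1 f2 f3 : testfun f1 -> testfun f2 -> testfun f3 ->
  cintegrable mu3 (ctens f1 f2 f3).
Proof.
move=> t1 t2 t3; have [+ _] := FT3_cintegral 0 (or_introl erefl) t1 t2 t3.
congr cintegrable; apply/funext => y.
by rewrite (_ : dot y 0 = 0) ?mulr0 ?cis0 ?mul1r// dotE/= !mulr0 !addr0.
Qed.

Lemma fourier_ctens f1 f2 f3 : testfun f1 -> testfun f2 -> testfun f3 ->
  fourier (ctens f1 f2 f3) = FT3 (-1) f1 f2 f3.
Proof.
move=> t1 t2 t3; apply/funext => x.
rewrite -(FT3_cintegral x (or_intror erefl) t1 t2 t3).2.
by apply: eq_cintegral => y; rewrite mulN1r.
Qed.

Lemma inv_fourier_ctens f1 f2 f3 : testfun f1 -> testfun f2 -> testfun f3 ->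
  inv_fourier (ctens f1 f2 f3) = fun x => (((2 * pi) ^+ 3)^-1)%:C * FT3 1 f1 f2 f3 x.
Proof.
move=> t1 t2 t3; apply/funext => x; rewrite /inv_fourier.
apply: (congr1 (fun z => (((2 * pi) ^+ 3)^-1)%:C * z)).
rewrite -(FT3_cintegral x (or_introl erefl) t1 t2 t3).2.
by apply: eq_cintegral => y; rewrite mul1r dotC.
Qed.

Lemma pi3_neq0 : (2 * pi) ^+ 3 != 0 :> R.
Proof. by rewrite expf_neq0// mulf_neq0// gt_eqF// pi_gt0. Qed.

Lemma inv_fourierK f1 f2 f3 : testfun f1 -> testfun f2 -> testfun f3 ->
  inv_fourier (fourier (ctens f1 f2 f3)) = ctens f1 f2 f3.
Proof.
move=> t1 t2 t3; rewrite fourier_ctens//; apply/funext => x.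
transitivity ((((2 * pi) ^+ 3)^-1)%:C *
    cintegral mu3 setT (fun y => cis (- -1 * dot y x) * FT3 (-1) f1 f2 f3 y)).
  apply: (congr1 (fun z => (((2 * pi) ^+ 3)^-1)%:C * z)).
  by apply: eq_cintegral => y; rewrite opprK mul1r dotC.
rewrite (FT3_inversion x (or_intror erefl) t1 t2 t3).2.
by rewrite mulrA -rmorphM mulVf ?pi3_neq0// mul1r.
Qed.

Lemma fourierK f1 f2 f3 : testfun f1 -> testfun f2 -> testfun f3 ->
  fourier (inv_fourier (ctens f1 f2 f3)) = ctens f1 f2 f3.
Proof.
move=> t1 t2 t3; rewrite inv_fourier_ctens//; apply/funext => x.
have [i e] := FT3_inversion x (or_introl erefl) t1 t2 t3.
transitivity (cintegral mu3 setT (fun y => (((2 * pi) ^+ 3)^-1)%:C *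
    (cis (- 1 * dot y x) * FT3 1 f1 f2 f3 y))).
  by apply: eq_cintegral => y; rewrite mulN1r; ring.
by rewrite cintegralZ// e mulrA -rmorphM mulVf ?pi3_neq0// mul1r.
Qed.

Lemma schwartz_ctens f1 f2 f3 : testfun f1 -> testfun f2 -> testfun f3 ->
  schwartz (ctens f1 f2 f3).
Proof.
move=> t1 t2 t3; split; last exact: schwartzR0.
by apply: schwartzR_tensor; exact: testfun_rapid.
Qed.

(** Expanding the product of three complex factors, the real and the imaginary part are each a sum
    of four real tensors with rapid factors. *)
Lemma schwartz_FT3 (k sg : R) f1 f2 f3 : testfun f1 -> testfun f2 -> testfun f3 ->
  schwartz (fun x => k%:C * FT3 sg f1 f2 f3 x).
Proof.
move=> t1 t2 t3.
have c1 := rapid_scale k (@rapid_ReFT1 sg f1 t1).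
have s1 := rapid_scale k (@rapid_ImFT1 sg f1 t1).
have c2 := @rapid_ReFT1 sg f2 t2; have s2 := @rapid_ImFT1 sg f2 t2.
have c3 := @rapid_ReFT1 sg f3 t3; have s3 := @rapid_ImFT1 sg f3 t3.
have N1 := rapid_scale (-1) c1; have N2 := rapid_scale (-1) s1.
have S (F G : space R -> R) : F = G -> schwartzR F -> schwartzR G by move=> ->.
split.
- apply: S (schwartzRD (schwartzR_tensor c1 c2 c3) (schwartzRD (schwartzR_tensor N1 s2 s3)
    (schwartzRD (schwartzR_tensor N2 c2 s3) (schwartzR_tensor N2 s2 c3)))).
  by apply/funext => x; rewrite /FT3 /tensor !ReM !ImM/=; ring.
- apply: S (schwartzRD (schwartzR_tensor s1 c2 c3) (schwartzRD (schwartzR_tensor c1 s2 c3)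
    (schwartzRD (schwartzR_tensor c1 c2 s3) (schwartzR_tensor N2 s2 s3)))).
  by apply/funext => x; rewrite /FT3 /tensor !ImM !ReM !ImM/=; ring.
Qed.

Lemma schwartz_fourier_ctens f1 f2 f3 : testfun f1 -> testfun f2 -> testfun f3 ->
  schwartz (fourier (ctens f1 f2 f3)).
Proof.
move=> t1 t2 t3; rewrite fourier_ctens//.
have := @schwartz_FT3 1 (-1) f1 f2 f3 t1 t2 t3.
by congr schwartz; apply/funext => x; rewrite mul1r.
Qed.

Lemma schwartz_inv_fourier_ctens f1 f2 f3 : testfun f1 -> testfun f2 -> testfun f3 ->
  schwartz (inv_fourier (ctens f1 f2 f3)).
Proof. by move=> t1 t2 t3; rewrite inv_fourier_ctens//; exact: schwartz_FT3. Qed.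

End TensorFourier.

(** * Almost-everywhere inequalities from integrals over boxes and against bumps *)

Section AlmostEverywhere.
Context {R : realType} d (T : measurableType d) (mu : {measure set T -> \bar R}).

Lemma ae_mono (P Q : T -> Prop) : (forall x, P x -> Q x) ->
  {ae mu, forall x, P x} -> {ae mu, forall x, Q x}.
Proof. exact: filterS. Qed.

Lemma ae_mono2 (P Q S : T -> Prop) : (forall x, P x -> Q x -> S x) ->
  {ae mu, forall x, P x} -> {ae mu, forall x, Q x} -> {ae mu, forall x, S x}.
Proof. exact: filterS2. Qed.

Lemma ae_forall_countable (I : countType) (P : I -> T -> Prop) :
  (forall i, {ae mu, forall x, P i x}) -> {ae mu, forall x, forall i, P i x}.
Proof.
move=> aeP.
have h n : {ae mu, forall x, if unpickle n is Some i then P i x else True}.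
  by case: (unpickle n) => [i|]; [exact: aeP|exact: aeW].
apply: filterS (ae_foralln h) => x hx i.
by have := hx (pickle i); rewrite pickleK.
Qed.

End AlmostEverywhere.

Section NonnegOneDim.
Context {R : realType}.
Local Notation mu := (@lebesgue_measure R).

Definition ioo (a b : R) : R -> R := \1_(`]a, b[%classic : set R).

Lemma ioo_ge0 a b x : 0 <= ioo a b x.
Proof. by rewrite /ioo indicE. Qed.

Lemma ioo_le1 a b x : ioo a b x <= 1.
Proof. by rewrite /ioo indicE lern1 leq_b1. Qed.

Lemma measurable_ioo a b : measurable_fun setT (ioo a b).
Proof. exact: measurable_indic. Qed.

(** At a Lebesgue point with [f x < 0], the function is close on average to the constant [f x] near
    [x], so its integral over a slightly smaller interval with rational endpoints is negative. *)
Lemma ae_nonneg_of_intervals (f : R -> R) : mu.-integrable setT (EFin \o f) ->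
  (forall a b : rat, 0 <= \int[mu]_y (f y * ioo (ratr a) (ratr b) y)) ->
  {ae mu, forall x, 0 <= f x}.
Proof.
move=> fi hf.
have floc : locally_integrable setT f.
  by have := integrable_locally (@measurableT _ (measurableTypeR R)) fi; rewrite patch_setT.
apply: ae_mono (lebesgue_differentiation floc) => x lx.
rewrite leNgt; apply/negP => fx0.
(* The error on the ball of radius [r] is at most [2 * r * e], that is [- (f x * r) / 2], while the
   rational interval has length at least [r] and contributes at most [f x * r]. *)
pose e := - f x / 4; have e0 : 0 < e by rewrite divr_gt0// oppr_gt0.
move: lx => /fine_cvgP[h1 /cvgrPdist_lt/(_ _ e0) h2].
near ((0:R)^'+) => r.
have r0 : 0 < r by near: r; exact: nbhs_right_gt.
have hr1 : davg f x r \is a fin_num by near: r; exact: h1.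
have hr2 : `|0 - fine (davg f x r)| < e by near: r; exact: h2.
pose D y := `|f y - f x|.
have ball_itv : ball x r = `]x - r, x + r[%classic :> set R by rewrite ball_itv.
have iball : mu.-integrable `]x - r, x + r[ (EFin \o (fun y => f y - f x)).
  have i1 : mu.-integrable `]x - r, x + r[ (EFin \o f) by apply: (integrableS _ _ _ fi).
  have i2 : mu.-integrable `]x - r, x + r[ (EFin \o (fun=> f x)).
    apply: (@integrableS _ _ _ mu `[x - r, x + r]) => //.
      by apply: subset_itvW.
    apply: continuous_compact_integrable; first exact: segment_compact.
    by apply: continuous_subspaceT => y; exact: cvg_cst.
  exact: (integrableB _ i1 i2).
have muB : mu (ball x r) = (2 * r)%:E.
  rewrite ball_itv lebesgue_measure_itv/= lte_fin ifT; last by lra.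
  by rewrite -EFinB; congr EFin; lra.
have IB : \int[mu]_(y in `]x - r, x + r[) D y <= 2 * r * e.
  have E : davg f x r = ((2 * r)^-1 * \int[mu]_(y in `]x - r, x + r[) D y)%:E.
    have ED : (\int[mu]_(y in `]x - r, x + r[) D y)%:E = (\int[mu]_(y in `](x - r)%R, (x + r)%R[) (D y)%:E)%E.
      by apply: Rintegral_EFin; [exact: measurable_itv|exact: (integrable_norm iball)].
    rewrite /davg /iavg muB ball_itv [RHS]EFinM ED inver ifF//.
    by apply: gt_eqF; lra.
  have D0 : 0 <= \int[mu]_(y in `]x - r, x + r[) D y by apply: Rintegral_ge0 => y _; exact: normr_ge0.
  move: hr2; rewrite E/= sub0r normrN ger0_norm; last by rewrite mulr_ge0// invr_ge0; lra.
  by rewrite ltr_pdivrMl ?mulr_gt0// => /ltW.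
have [a] : exists a : rat, x - r < ratr a < x - r / 2 by apply: rat_in_itvoo; lra.
move=> /andP[a1 a2].
have [b] : exists b : rat, x + r / 2 < ratr b < x + r by apply: rat_in_itvoo; lra.
move=> /andP[b1 b2].
pose A : R := ratr a; pose B : R := ratr b.
have := hf a b; rewrite -/A -/B; apply/negP; rewrite -ltNge.
have iD : mu.-integrable setT (EFin \o (fun y => D y * ioo (x - r) (x + r) y)).
  have : mu.-integrable setT ((EFin \o D) \_ `]x - r, x + r[).
    by apply/(integrable_mkcond _ _).1 => //; exact: (integrable_norm iball).
  apply: eq_integrable => // y _; rewrite /= patchE /ioo indicE.
  by case: (y \in _); rewrite ?mulr1 ?mulr0.
have iI : mu.-integrable setT (EFin \o (fun y => f x * ioo A B y)).
  exact: (integrableZl (@measurableT _ _) (f x) (integrable_indic_itv A B false true)).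
have iF : mu.-integrable setT (EFin \o (fun y => f y * ioo A B y)).
  apply: (@integrable_le_fin R _ (measurableTypeR R) mu setT _ (fun y => `|f y|)).
  - exact: measurableT.
  - apply: measurable_funM; last exact: measurable_ioo.
    by apply/measurable_EFinP; exact: measurable_int fi.
  - by move=> y _; rewrite normrM ler_piMr// ger0_norm ?ioo_ge0// ioo_le1.
  - exact: (integrable_norm fi).
apply: (@le_lt_trans _ _ (\int[mu]_y (f x * ioo A B y + D y * ioo (x - r) (x + r) y))).
  apply: le_Rintegral => //.
    exact: (integrableD (@measurableT _ _) iI iD).
  move=> y _; rewrite /ioo !indicE.
  have [yAB|] := boolP (y \in `]A, B[%classic).
    rewrite (_ : y \in `]x - r, x + r[%classic) ?mulr1.
      by rewrite -lerBlDl ler_norm.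
    by move: yAB; rewrite !inE/= !in_itv/= => /andP[]; rewrite /A /B; lra.
  by rewrite /= !mulr0 add0r mulr_ge0 ?ler0n ?normr_ge0.
rewrite RintegralD// RintegralZl//; last exact: integrable_indic_itv.
have -> : \int[mu]_y (D y * ioo (x - r) (x + r) y) = \int[mu]_(y in `]x - r, x + r[) D y.
  rewrite [RHS]Rintegral_mkcond; apply: eq_Rintegral => y _; rewrite patchE /ioo indicE.
  by case: (y \in _); rewrite ?mulr1 ?mulr0.
have -> : \int[mu]_y ioo A B y = B - A.
  have AB : A < B by rewrite /A /B; lra.
  have mAB : mu (`]A, B[%classic : set R) = (B - A)%:E.
    by rewrite lebesgue_measure_itv/= lte_fin AB.
  rewrite /Rintegral /ioo integral_indic// setIT -[RHS]/(fine (B - A)%:E); congr fine.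
  exact: mAB.
have : f x * (B - A) <= f x * r.
  by rewrite ler_wnM2l ?ltW//; rewrite /A /B; lra.
have : 2 * r * e = - (f x * r) / 2 by rewrite /e; field.
have : f x * r < 0 by rewrite nmulr_rlt0.
move: IB; move: (f x * (B - A)) (f x * r) (2 * r * e) (\int[mu]_(y in _) D y) => *; lra.
Unshelve. all: by end_near. Qed.

End NonnegOneDim.

Section NonnegProduct.
Context {R : realType} d (X : measurableType d) (m : {sigma_finite_measure set X -> \bar R}).
Local Notation mu := (@lebesgue_measure R).

(** The product measure of the exceptional set is the integral of the measures of its sections. *)
Lemma ae_product (P : X * R -> Prop) : measurable [set z : X * measurableTypeR R | ~ P z] ->
  {ae m, forall x, {ae mu, forall y, P (x, y)}} -> {ae (m \x mu)%E, forall z, P z}.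
Proof.
move=> mP h; exists [set z | ~ P z]; split => //.
rewrite /product_measure1; apply/eqP; rewrite -[eqbRHS](@integral0 _ _ _ m setT); apply/eqP.
apply: ae_eq_integral => //; first exact: measurable_fun_xsection.
apply: filterS h => x hx _ /=; apply: (measure_negligible (measurable_xsection _ mP)).
case: hx => N [mN N0 hN]; exists N; split => // y.
by rewrite /xsection/= inE => /hN.
Qed.

(** A null set of [x] is discarded for each interval, so only countably many intervals can be used;
    the one-dimensional criterion is satisfied with rational endpoints. *)
Lemma ae_nonneg_product (f : X * measurableTypeR R -> R) : (m \x mu)%E.-integrable setT (EFin \o f) ->
  (forall a b, {ae m, forall x, 0 <= \int[mu]_y (f (x, y) * ioo a b y)}) ->
  {ae (m \x mu)%E, forall z, 0 <= f z}.
Proof.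
move=> fi fab.
have mf : measurable_fun setT f by apply/measurable_EFinP; exact: measurable_int fi.
apply: ae_product.
  rewrite (_ : [set z | _] = f @^-1` `]-oo, 0[%classic); last first.
    by apply/seteqP; split => z /=; rewrite in_itv/= ltNge => /negP.
  by rewrite -[X in measurable X]setTI; exact: mf.
have h1 : {ae m, forall x, forall q : rat * rat, 0 <= \int[mu]_y (f (x, y) * ioo (ratr q.1) (ratr q.2) y)}.
  by apply: ae_forall_countable => q; exact: fab.
have h2 := ae_integrable1 fi.
apply: ae_mono2 h1 h2 => x hq fxi.
by apply: ae_nonneg_of_intervals => // a b; exact: (hq (a, b)).
Qed.

End NonnegProduct.

Section NonnegTensors.
Context {R : realType}.
Local Notation mu := (@lebesgue_measure R).
Local Notation mu2 := (@lebesgue2 R).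
Local Notation mu3 := (@lebesgue3 R).

Definition cube (A : R) : set (space R) := `[- A, A] `*` `[- A, A] `*` `[- A, A].

Lemma ioo_mul (a b c d x : R) :
  ioo a b x * ioo c d x = ioo (Num.max a c) (Num.min b d) x.
Proof.
rewrite /ioo !indicE -natrM mulnb; congr (_%:R); congr nat_of_bool.
rewrite !mem_setE /= !in_itv/= gt_max lt_min.
by rewrite andbACA.
Qed.

Lemma measurable_proj1 : measurable_fun setT (fun x : measurableTypeR R * measurableTypeR R * measurableTypeR R => x.1.1).
Proof. exact: (measurableT_comp measurable_fst measurable_fst). Qed.

Lemma measurable_proj2 : measurable_fun setT (fun x : measurableTypeR R * measurableTypeR R * measurableTypeR R => x.1.2).
Proof. exact: (measurableT_comp measurable_snd measurable_fst). Qed.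

Lemma measurable_tensor (f1 f2 f3 : R -> R) : measurable_fun setT f1 ->
  measurable_fun setT f2 -> measurable_fun setT f3 ->
  measurable_fun setT (tensor f1 f2 f3 : measurableTypeR R * measurableTypeR R * measurableTypeR R -> R).
Proof.
move=> m1 m2 m3; apply: measurable_funM; first apply: measurable_funM.
- exact: (measurableT_comp m1 measurable_proj1).
- exact: (measurableT_comp m2 measurable_proj2).
- exact: (measurableT_comp m3 measurable_snd).
Qed.

Definition box (a1 b1 a2 b2 a3 b3 : R) : space R -> R :=
  tensor (ioo a1 b1) (ioo a2 b2) (ioo a3 b3).

Lemma box_ge0 a1 b1 a2 b2 a3 b3 x : 0 <= box a1 b1 a2 b2 a3 b3 x.
Proof. by rewrite /box /tensor !mulr_ge0 ?ioo_ge0. Qed.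

Lemma box_le1 a1 b1 a2 b2 a3 b3 x : box a1 b1 a2 b2 a3 b3 x <= 1.
Proof. by rewrite /box /tensor !mulr_ile1 ?mulr_ge0 ?ioo_ge0 ?ioo_le1. Qed.

Lemma measurable_box a1 b1 a2 b2 a3 b3 :
  measurable_fun setT (box a1 b1 a2 b2 a3 b3 : measurableTypeR R * measurableTypeR R * measurableTypeR R -> R).
Proof. by apply: measurable_tensor; exact: measurable_ioo. Qed.

Lemma integrableM_ioo d (T : measurableType d) (m : {measure set T -> \bar R})
    (f g : T -> R) : m.-integrable setT (EFin \o f) -> measurable_fun setT g ->
  (forall x, 0 <= g x <= 1) -> m.-integrable setT (EFin \o (fun x => f x * g x)).
Proof.
move=> fi mg g01; have mf : measurable_fun setT f by apply/measurable_EFinP; exact: measurable_int fi.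
apply: (@integrable_le_fin _ _ _ m setT _ (fun x => `|f x|)) => //.
- exact: measurable_funM.
- move=> x _; have /andP[g0 g1] := g01 x.
  by rewrite normrM ler_piMr// ger0_norm.
- exact: integrable_norm.
Qed.

Lemma ioo_01 (a b x : R) : 0 <= ioo a b x <= 1.
Proof. by rewrite ioo_ge0 ioo_le1. Qed.

Lemma ioo_01b (a b x : R) : ioo a b x = 0 \/ ioo a b x = 1.
Proof. by rewrite /ioo indicE; case: (_ \in _); [right|left]. Qed.

(** Restricted to the two values of an indicator, for which the identity is pointwise: the sections
    to which it is applied are not known to be integrable one by one. *)
Lemma Rintegral01 d (T : measurableType d) (m : {measure set T -> \bar R}) (c : R) (f : T -> R) :
  c = 0 \/ c = 1 -> \int[m]_x (c * f x) = c * \int[m]_x f x.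
Proof.
move=> [->|->]; last by rewrite mul1r; apply: eq_Rintegral => x _; rewrite mul1r.
by rewrite mul0r -[RHS](mul0r (fine (m setT))) -Rintegral_cst//; apply: eq_Rintegral => x _; rewrite mul0r.
Qed.

(** The coordinates are peeled off one at a time: integrating the last variable over an interval
    leaves an integrable function of the others, to which the same criterion applies. *)
Lemma ae_nonneg_of_boxes (f : space R -> R) : mu3.-integrable setT (EFin \o f) ->
  (forall a1 b1 a2 b2 a3 b3, 0 <= \int[mu3]_x (f x * box a1 b1 a2 b2 a3 b3 x)) ->
  {ae mu3, forall x, 0 <= f x}.
Proof.
move=> fi fbox; apply: (@ae_nonneg_product R _ _ mu2 f fi) => a3 b3.
have m3 : measurable_fun setT (fun x : measurableTypeR R * measurableTypeR R * measurableTypeR R => ioo a3 b3 x.2).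
  exact: (measurableT_comp (measurable_ioo a3 b3) measurable_snd).
have i3 := integrableM_ioo fi m3 (fun x => ioo_01 a3 b3 x.2).
have [j3 _] := @Rintegral_prod1 R _ _ _ _ mu2 mu _ i3.
set K3 := (fun x => \int[mu]_y _) in j3.
apply: (@ae_nonneg_product R _ _ mu K3 j3) => a2 b2.
have m2 : measurable_fun setT (fun x : measurableTypeR R * measurableTypeR R => ioo a2 b2 x.2).
  exact: (measurableT_comp (measurable_ioo a2 b2) measurable_snd).
have i2 := integrableM_ioo j3 m2 (fun x => ioo_01 a2 b2 x.2).
have [j2 _] := @Rintegral_prod1 R _ _ _ _ mu mu _ i2.
apply: (ae_nonneg_of_intervals j2) => p q; set a1 : R := ratr p; set b1 : R := ratr q.
have := fbox a1 b1 a2 b2 a3 b3; congr (0 <= _).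
have i1 := integrableM_ioo fi (measurable_box a1 b1 a2 b2 a3 b3) (fun x => introT andP (conj (box_ge0 _ _ _ _ _ _ x) (box_le1 _ _ _ _ _ _ x))).
have [k1 ->] := @Rintegral_prod1 R _ _ _ _ mu2 mu _ i1.
have [k2 ->] := @Rintegral_prod1 R _ _ _ _ mu mu _ k1.
apply: eq_Rintegral => x _; rewrite [RHS]mulrC -Rintegral01//; last exact: ioo_01b.
apply: eq_Rintegral => y _; rewrite [in RHS](mulrC (K3 _)) mulrA /K3 -Rintegral01; last first.
  by case: (ioo_01b a1 b1 x) => ->; case: (ioo_01b a2 b2 y) => ->; rewrite ?mul0r ?mul1r; auto.
by apply: eq_Rintegral => t _; rewrite /box /tensor/=; ring.
Qed.

Lemma ioo_out (A x : R) : ~ `[- A, A]%classic x -> ioo (- A) A x = 0.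
Proof.
move=> h; rewrite /ioo indicE memNset// => h'; apply: h.
by move: h'; rewrite /= !in_itv/= => /andP[/ltW -> /ltW ->].
Qed.

Lemma box_out_cube (A : R) x : ~ cube A x -> box (- A) A (- A) A (- A) A x = 0.
Proof.
move=> h; rewrite /box /tensor.
have [h1|h1] := pselect (`[- A, A]%classic x.1.1); last by rewrite ioo_out// !mul0r.
have [h2|h2] := pselect (`[- A, A]%classic x.1.2); last by rewrite (ioo_out h2) mulr0 mul0r.
have [h3|h3] := pselect (`[- A, A]%classic x.2); last by rewrite (ioo_out h3) mulr0.
by exfalso; apply: h.
Qed.

Lemma integrable_cube_ioo (f : space R -> R) (A : R) : measurable_fun setT f ->
  mu3.-integrable (cube A) (EFin \o f) ->
  mu3.-integrable setT (EFin \o (fun x => f x * box (- A) A (- A) A (- A) A x)).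
Proof.
move=> mf fi.
have mA : measurable (cube A : set (measurableTypeR R * measurableTypeR R * measurableTypeR R)).
  by apply: measurableX; first apply: measurableX; exact: measurable_itv.
apply: (@le_integrable _ _ _ mu3 setT measurableT _ ((EFin \o f) \_ (cube A))).
- by apply/measurable_EFinP; apply: measurable_funM => //; exact: measurable_box.
- move=> x _; rewrite /= patchE.
  have [h|h] := boolP (x \in cube A).
    by rewrite lee_fin normrM ler_piMr// ger0_norm ?box_ge0 ?box_le1.
  by rewrite box_out_cube ?mulr0 ?normr0 ?abse_ge0//; move: h; rewrite notin_setE.
- exact: (integrable_mkcond _ mA).1 fi.
Qed.


(** Bumps converge to indicators of intervals, so the hypothesis passes to boxes by dominated
    convergence. As [g] is integrable on bounded sets only, the box criterion is applied to [g] cut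
    off to larger and larger boxes. *)
Lemma ae_nonneg_of_tensors (g : space R -> R) : measurable_fun setT g ->
  (forall A : R, mu3.-integrable (cube A) (EFin \o g)) ->
  (forall f1 f2 f3 : R -> R, testfun f1 -> testfun f2 -> testfun f3 ->
    (forall x, 0 <= f1 x) -> (forall x, 0 <= f2 x) -> (forall x, 0 <= f3 x) ->
    0 <= \int[mu3]_x (g x * tensor f1 f2 f3 x)) ->
  {ae mu3, forall x, 0 <= g x}.
Proof.
move=> mg gi gt.
have gA (A : R) : mu3.-integrable setT (EFin \o (fun x => g x * box (- A) A (- A) A (- A) A x)).
  exact: integrable_cube_ioo.
have gbox a1 b1 a2 b2 a3 b3 : 0 <= \int[mu3]_x (g x * box a1 b1 a2 b2 a3 b3 x).
  pose A := `|a1| + `|b1| + (`|a2| + `|b2|) + (`|a3| + `|b3|) + 1.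
  pose T n : space R -> R := tensor (bump a1 b1 n) (bump a2 b2 n) (bump a3 b3 n).
  have le (a b x : R) n : `|a| + `|b| + 1 <= A -> bump a b n x <= ioo (- A) A x.
    move=> hA; have [xab|/negP xab] := boolP (a < x < b); last first.
      by rewrite bump_out ?ioo_ge0//; apply/negP.
    rewrite /ioo indicE mem_set ?bump_le1//= in_itv/=; move/andP: xab => [ax xb].
    have := ler_norm b; have := ler_norm (- a); rewrite normrN.
    by have := normr_ge0 a; have := normr_ge0 b; lra.
  have p1 := normr_ge0 a1; have p2 := normr_ge0 b1; have p3 := normr_ge0 a2.
  have p4 := normr_ge0 b2; have p5 := normr_ge0 a3; have p6 := normr_ge0 b3.
  have A1 : `|a1| + `|b1| + 1 <= A by rewrite /A; lra.
  have A2 : `|a2| + `|b2| + 1 <= A by rewrite /A; lra.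
  have A3 : `|a3| + `|b3| + 1 <= A by rewrite /A; lra.
  have T0 n x : 0 <= T n x.
    exact: (mulr_ge0 (mulr_ge0 (bump_ge0 _ _ _ _) (bump_ge0 _ _ _ _)) (bump_ge0 _ _ _ _)).
  have mb (a b : R) n : measurable_fun setT (bump a b n).
    by apply: continuous_measurable_fun; apply: testfun_continuous; exact: testfun_bump.
  have cvg : \int[mu3]_x (g x * T n x) @[n --> \oo] --> \int[mu3]_x (g x * box a1 b1 a2 b2 a3 b3 x).
    apply: (@Rintegral_dominated R _ _ mu3 setT _ _
      (fun x => `|g x * box (- A) A (- A) A (- A) A x|)) => //.
    - by move=> n; apply: measurable_funM => //; apply: measurable_tensor.
    - by apply: measurable_funM => //; exact: measurable_box.
    - move=> x _; apply: cvgM; first exact: cvg_cst.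
      by apply: cvgM; first apply: cvgM; exact: bump_cvg.
    - exact: (integrable_norm (gA A)).
    - move=> n x _; rewrite [leLHS]normrM [leRHS]normrM ler_wpM2l//.
      rewrite (ger0_norm (T0 n x)) (ger0_norm (box_ge0 _ _ _ _ _ _ _)).
      apply: ler_pM; [|exact: bump_ge0|apply: ler_pM; [exact: bump_ge0|exact: bump_ge0|exact: le|exact: le]|exact: le].
      by apply: mulr_ge0; exact: bump_ge0.
  rewrite -(cvg_lim _ cvg)//; apply: limr_ge; first by apply/cvg_ex; eexists; exact: cvg.
  apply: nearW => n; rewrite /T; apply: gt; try exact: testfun_bump; move=> x; exact: bump_ge0.
have box_mul a1 b1 a2 b2 a3 b3 (A : R) x : box (- A) A (- A) A (- A) A x * box a1 b1 a2 b2 a3 b3 x =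
    box (Num.max (- A) a1) (Num.min A b1) (Num.max (- A) a2) (Num.min A b2)
      (Num.max (- A) a3) (Num.min A b3) x.
  by rewrite /box /tensor -!ioo_mul; ring.
(* The cut-off meets each testing box in a box again. *)
have h (n : nat) : {ae mu3, forall x, 0 <= g x * box (- n%:R) n%:R (- n%:R) n%:R (- n%:R) n%:R x}.
  apply: ae_nonneg_of_boxes => // a1 b1 a2 b2 a3 b3.
  by under eq_Rintegral do rewrite -mulrA box_mul; exact: gbox.
apply: ae_mono (ae_foralln h) => x hx.
pose n := Num.bound (`|x.1.1| + `|x.1.2| + `|x.2|).
have nP : `|x.1.1| + `|x.1.2| + `|x.2| < n%:R by apply: archi_boundP; rewrite !addr_ge0.
have := hx n; rewrite (_ : box _ _ _ _ _ _ x = 1) ?mulr1//.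
have one y : `|y| < n%:R -> ioo (- n%:R) n%:R y = 1.
  by rewrite ltr_norml => hy; rewrite /ioo indicE mem_set//= in_itv.
have p1 := normr_ge0 x.1.1; have p2 := normr_ge0 x.1.2; have p3 := normr_ge0 x.2.
by rewrite /box /tensor !one ?mulr1//; lra.
Qed.

End NonnegTensors.

(** * Topology against product measurability, and the testing criteria *)

Section MeasurableSpace.
Context {R : realType}.
Local Notation mspace := (measurableTypeR R * measurableTypeR R * measurableTypeR R)%type.
Local Notation mu3 := (@lebesgue3 R).

(** An open set is the countable union of the rational boxes it contains. This links compact sets
    and continuous functions, which belong to the topology of [space R], with the product
    sigma-algebra used for integration. *)
Lemma measurable_open3 (U : set (space R)) : open U -> measurable (U : set mspace).
Proof.
move=> oU.
pose B (q : (rat * rat) * (rat * rat) * (rat * rat)) : set mspace :=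
  `](ratr q.1.1.1 : R), (ratr q.1.1.2 : R)[%classic `*`
  `](ratr q.1.2.1 : R), (ratr q.1.2.2 : R)[%classic `*`
  `](ratr q.2.1 : R), (ratr q.2.2 : R)[%classic.
pose F q : set mspace := if `[< B q `<=` U >] then B q else set0.
rewrite (_ : U = \bigcup_q F q).
  apply: countable_bigcupT_measurable; first exact: countableP.
  move=> q; rewrite /F; case: asboolP => _; last exact: measurable0.
  by apply: measurableX; first apply: measurableX; exact: measurable_itv.
apply/seteqP; split; last by move=> x [q _]; rewrite /F; case: asboolP => // + Bx; apply.
move=> -[[x1 x2] x3] Ux.
have /nbhs_ballP[e /= e0 sub] : nbhs ((x1, x2), x3) U by exact: open_nbhs_nbhs.
have ex (x : R) : exists p : rat * rat, ((ratr p.1 : R) < x < ratr p.2) /\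
    (x - e < ratr p.1 :> R) /\ (ratr p.2 < x + e :> R).
  have [a] : exists a : rat, x - e < ratr a < x by apply: rat_in_itvoo; lra.
  move=> /andP[a1 a2].
  have [b] : exists b : rat, x < ratr b < x + e by apply: rat_in_itvoo; lra.
  by move=> /andP[b1 b2]; exists (a, b); rewrite /= a1 a2 b1 b2.
have [p1 [h1 [l1 r1]]] := ex x1; have [p2 [h2 [l2 r2]]] := ex x2.
have [p3 [h3 [l3 r3]]] := ex x3.
exists ((p1, p2), p3) => //; rewrite /F asboolT.
  by rewrite /B; split; first split; rewrite /= in_itv.
have near_ball (x y : R) (p : rat * rat) : x - e < ratr p.1 -> ratr p.2 < x + e ->
    (ratr p.1 : R) < y < ratr p.2 -> ball x e y.
  move=> pl pr /andP[yl yr]; rewrite /ball/= /ball_ ltr_norml; lra.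
move=> [[y1 y2] y3] [[/= + +] +]; rewrite !in_itv/= => k1 k2 k3; apply: sub.
by split; first split; [exact: near_ball k1|exact: near_ball k2|exact: near_ball k3].
Qed.

Lemma measurable_compact3 (K : set (space R)) : compact K -> measurable (K : set mspace).
Proof.
move=> /compact_closed h; rewrite -(setCK K); apply: measurableC; apply: measurable_open3.
by apply: closed_openC; apply: h; exact: norm_hausdorff.
Qed.

Lemma continuous_measurable3 (f : space R -> R) : continuous f ->
  measurable_fun setT (f : mspace -> R).
Proof.
move=> /continuousP cf; apply: (measurability _ (RGenOpens.measurableE R)).
move=> _ [_ [a [b ->] <-]]; rewrite setTI; apply: measurable_open3.
exact/cf/interval_open.
Qed.

Lemma compact_cube (A : R) : compact (cube A).
Proof. by apply: compact_setX; first apply: compact_setX; exact: segment_compact. Qed.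

Lemma bigcup_cube : \bigcup_n cube n%:R = [set: space R].
Proof.
apply/seteqP; split=> // x _.
pose n := Num.bound (`|x.1.1| + `|x.1.2| + `|x.2|).
have nP : `|x.1.1| + `|x.1.2| + `|x.2| < n%:R by apply: archi_boundP; rewrite !addr_ge0.
have p1 := normr_ge0 x.1.1; have p2 := normr_ge0 x.1.2; have p3 := normr_ge0 x.2.
by exists n => //; split; first split; rewrite /= in_itv/= -ler_norml; lra.
Qed.

(** The form of local integrability suited to testing: cubes contain the supports of tensors and
    exhaust the space. *)
Definition lint (g : space R -> R[i]) := cmeasurable (g : mspace -> R[i]) /\
  forall A : R, mu3.-integrable (cube A) (EFin \o (fun x => complex.Re (g x))) /\
    mu3.-integrable (cube A) (EFin \o (fun x => complex.Im (g x))).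

Lemma measurable_of_cubes (f : space R -> R) :
  (forall n : nat, measurable_fun (cube n%:R : set mspace) (f : mspace -> R)) ->
  measurable_fun setT (f : mspace -> R).
Proof.
move=> h; rewrite -bigcup_cube; apply/measurable_fun_bigcup => //.
by move=> n; apply: measurable_compact3; exact: compact_cube.
Qed.

Lemma lint_locally_integrable g : locally_integrable3 g -> lint g.
Proof.
move=> gl; split; last by move=> A; exact: gl (@compact_cube A).
split; apply: measurable_of_cubes => n; have [gr gi] := gl _ (@compact_cube n%:R).
  by apply/measurable_EFinP; exact: measurable_int gr.
by apply/measurable_EFinP; exact: measurable_int gi.
Qed.

Lemma lint_cintegrable g : cintegrable mu3 g -> lint g.
Proof.
move=> gi; split; first exact: cintegrable_measurable gi.
move=> A; have mA := measurable_compact3 (@compact_cube A); case: gi => gr gi.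
by split; [apply: (integrableS _ mA _ gr)|apply: (integrableS _ mA _ gi)].
Qed.

Lemma locally_integrableB (g h : space R -> R[i]) : locally_integrable3 g -> locally_integrable3 h ->
  locally_integrable3 (fun x => g x - h x).
Proof.
move=> gl hl K cK; have mK := measurable_compact3 cK.
have [gr gi] := gl _ cK; have [hr hi] := hl _ cK; split.
  have := integrableB mK gr hr; apply: eq_integrable => //.
  by move=> x _ /=; rewrite ReD ReN.
have := integrableB mK gi hi; apply: eq_integrable => //.
by move=> x _ /=; rewrite ImD ImN.
Qed.

(* A tensor test function is supported in a cube. *)
Lemma lint_integrable g f1 f2 f3 : lint g -> testfun f1 -> testfun f2 -> testfun f3 ->
  cintegrable mu3 (fun x => g x * ctens f1 f2 f3 x).
Proof.
move=> [mg gi] t1 t2 t3.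
have [M1 h1] := testfun_bounded t1; have [M2 h2] := testfun_bounded t2.
have [M3 h3] := testfun_bounded t3.
case: (t1) (t2) (t3) => _ [A1 s1] [_ [A2 s2]] [_ [A3 s3]].
pose A := `|A1| + `|A2| + `|A3|.
have mA := measurable_compact3 (@compact_cube A).
have mt : measurable_fun setT (tensor f1 f2 f3 : mspace -> R).
  by apply: measurable_tensor; apply: continuous_measurable_fun; exact: testfun_continuous.
have le (f : R -> R) (B M y : R) : (forall x, `|f x| <= M) -> (forall x, B < `|x| -> f x = 0) ->
    `|B| <= A -> `|f y| <= M * \1_(`[- A, A]%classic : set R) y.
  move=> hM hs BA; rewrite indicE; have [yA|yA] := boolP (y \in _); first by rewrite mulr1.
  rewrite mulr0 hs ?normr0//; move: yA; rewrite notin_setE/= in_itv/= -ler_norml => /negP.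
  by rewrite -ltNge; have := ler_norm B; lra.
have n1 := normr_ge0 A1; have n2 := normr_ge0 A2; have n3 := normr_ge0 A3.
pose G x := (M1 * M2 * M3) * (\1_(cube A) x * (`|complex.Re (g x)| + `|complex.Im (g x)|)).
apply: (@cintegrable_le R _ _ mu3 _ G).
- by apply: cmeasurableM => //; exact: cmeasurable_real.
- move=> x; rewrite cabsM cabsC.
  have E : \1_(cube A) x = \1_(`[- A, A]%classic : set R) x.1.1 * \1_(`[- A, A]%classic : set R) x.1.2 *
      \1_(`[- A, A]%classic : set R) x.2 :> R.
    rewrite !indicE -!natrM !mulnb; congr (nat_of_bool _)%:R.
    by rewrite /cube !in_setX.
  rewrite /G E mulrC (_ : forall a b c d e f g : R, a * b * c * (d * e * f * g) = (a * d) * (b * e) * (c * f) * g); last by move=> *; ring.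
  apply: ler_pM => //; [exact: cabs_ge0| |exact: cabs_le].
  have B1 : `|A1| <= A by rewrite /A; lra.
  have B2 : `|A2| <= A by rewrite /A; lra.
  have B3 : `|A3| <= A by rewrite /A; lra.
  rewrite /tensor !normrM; apply: ler_pM => //; last exact: (le _ _ _ _ h3 s3 B3).
  by apply: ler_pM => //; [exact: (le _ _ _ _ h1 s1 B1)|exact: (le _ _ _ _ h2 s2 B2)].
- have iI : mu3.-integrable setT
      (EFin \o (fun x => \1_(cube A) x * (`|complex.Re (g x)| + `|complex.Im (g x)|))).
    have [gr gim] := gi A.
    have := (integrable_mkcond _ mA).1 (integrableD mA (integrable_norm gr) (integrable_norm gim)).
    apply: eq_integrable => // x _; rewrite /= patchE indicE.
    by case: (x \in _); rewrite ?mul1r ?mul0r.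
  exact: (integrableZl (@measurableT _ _) _ iI).
Qed.

(** The nonnegativity criterion is applied to [B] minus each of $\pm\mathrm{Re}\,g$ and
    $\pm\mathrm{Im}\,g$, with [B] replaced by its finite part. Each part of [g] is thus bounded by
    [B], whence the factor 2 for the modulus. *)
Lemma ae_le_of_tensors g (B : mspace -> \bar R) : lint g ->
  measurable_fun setT B -> (forall x, 0 <= B x)%E -> (\int[mu3]_x B x < +oo)%E ->
  (forall f1 f2 f3 : R -> R, testfun f1 -> testfun f2 -> testfun f3 ->
    (forall x, 0 <= f1 x) -> (forall x, 0 <= f2 x) -> (forall x, 0 <= f3 x) ->
    ((cabs (cintegral mu3 setT (fun x => g x * ctens f1 f2 f3 x)))%:E <=
     \int[mu3]_x (B x * (tensor f1 f2 f3 x)%:E))%E) ->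
  {ae mu3, forall x, ((cabs (g x))%:E <= 2%:E * B x)%E}.
Proof.
move=> gl mB B0 Boo H.
pose b x := fine (B x).
have Bi : mu3.-integrable setT B.
  apply/integrableP; split => //; apply: le_lt_trans Boo.
  by rewrite le_eqVlt; apply/orP; left; apply/eqP; apply: eq_integral => x _; rewrite gee0_abs.
have Bfin : {ae mu3, forall x, B x = (b x)%:E}.
  apply: ae_mono (integrable_ae (@measurableT _ _) Bi) => x h.
  by rewrite /b fineK//; exact: h.
have mb : measurable_fun setT b by exact: measurableT_comp.
have b0 x : 0 <= b x by exact: fine_ge0.
have bi : mu3.-integrable setT (EFin \o b).
  apply: le_integrable Bi => //; first exact/measurable_EFinP.
  by move=> x _; rewrite /= /b; case: (B x) => //=; rewrite normr0 leey.
have key (s : R) (p : R[i] -> R) : (s = 1 \/ s = -1) -> (p = @complex.Re R \/ p = @complex.Im R) ->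
    {ae mu3, forall x, 0 <= b x - s * p (g x)}.
  move=> hs hp.
  have mA A := measurable_compact3 (@compact_cube A).
  have [mr mi] := gl.1.
  have mp : measurable_fun setT (fun x => p (g x) : R) by case: hp => ->.
  have ip A : mu3.-integrable (cube A) (EFin \o (fun x => p (g x))).
    by have [? ?] := gl.2 A; case: hp => ->.
  have ib A : mu3.-integrable (cube A) (EFin \o b) by apply: (integrableS _ (mA A) _ bi).
  apply: ae_nonneg_of_tensors.
  - by apply: measurable_funB => //; apply: measurable_funM => //; exact: measurable_cst.
  - by move=> A; exact: (integrableB (mA A) (ib A) (integrableZl (mA A) s (ip A))).
  - move=> f1 f2 f3 t1 t2 t3 p1 p2 p3.
    have T0 x : 0 <= tensor f1 f2 f3 x by rewrite /tensor !mulr_ge0.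
    have gi := lint_integrable gl t1 t2 t3.
    have mt : measurable_fun setT (tensor f1 f2 f3 : mspace -> R).
      by apply: measurable_tensor; apply: continuous_measurable_fun; exact: testfun_continuous.
    have bt : mu3.-integrable setT (EFin \o (fun x => b x * tensor f1 f2 f3 x)).
      have [M1 h1] := testfun_bounded t1; have [M2 h2] := testfun_bounded t2.
      have [M3 h3] := testfun_bounded t3.
      apply: (@integrable_le_fin _ _ _ mu3 setT _ (fun x => (M1 * M2 * M3) * b x)) => //.
      + exact: measurable_funM.
      + move=> x _; rewrite normrM (ger0_norm (b0 x)) mulrC ler_wpM2r//.
        by rewrite /tensor !normrM ler_pM ?mulr_ge0// ler_pM.
      + exact: (integrableZl (@measurableT _ _) _ bi).
    have pt0 : mu3.-integrable setT (EFin \o (fun x => p (g x) * tensor f1 f2 f3 x)).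
      case: gi => gr gm; case: hp => ->.
        by move: gr; apply: eq_integrable => // x _; rewrite /= ReM/= mulr0 subr0.
      by move: gm; apply: eq_integrable => // x _; rewrite /= ImM/= mulr0 add0r.
    have pt : mu3.-integrable setT (EFin \o (fun x => s * (p (g x) * tensor f1 f2 f3 x))).
      exact: (integrableZl (@measurableT _ _) s pt0).
    have ept : \int[mu3]_x (s * (p (g x) * tensor f1 f2 f3 x)) =
        s * p (cintegral mu3 setT (fun x => g x * ctens f1 f2 f3 x)).
      rewrite RintegralZl//; congr (_ * _); case: hp => ->; rewrite /cintegral/=; apply: eq_Rintegral => x _.
        by rewrite ReM/= mulr0 subr0.
      by rewrite ImM/= mulr0 add0r.
    have eb : (\int[mu3]_x (B x * (tensor f1 f2 f3 x)%:E))%E =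
        (\int[mu3]_x (b x * tensor f1 f2 f3 x))%:E.
      rewrite Rintegral_EFin//; apply: ae_eq_integral => //.
      + by apply: emeasurable_funM => //; exact/measurable_EFinP.
      + by apply/measurable_EFinP; exact: measurable_funM.
      + by apply: ae_mono Bfin => x -> _; rewrite -EFinM.
    have := H f1 f2 f3 t1 t2 t3 p1 p2 p3; rewrite eb lee_fin => h.
    under eq_Rintegral do rewrite mulrBl -mulrA.
    rewrite RintegralB// ept subr_ge0; apply: le_trans h.
    apply: (le_trans (ler_norm _)); rewrite normrM.
    have -> : `|s| = 1 by case: hs => ->; rewrite ?normrN normr1.
    by rewrite mul1r; case: hp => ->; [exact: normRe_le|exact: normIm_le].
have a1 := key 1 (@complex.Re R) (or_introl erefl) (or_introl erefl).
have a2 := key (-1) (@complex.Re R) (or_intror erefl) (or_introl erefl).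
have a3 := key 1 (@complex.Im R) (or_introl erefl) (or_intror erefl).
have a4 := key (-1) (@complex.Im R) (or_intror erefl) (or_intror erefl).
have a12 := ae_mono2 (fun x h1 h2 => conj h1 h2) a1 a2.
have a34 := ae_mono2 (fun x h1 h2 => conj h1 h2) a3 a4.
have a := ae_mono2 (fun x h1 h2 => conj h1 h2) a12 a34.
apply: ae_mono2 a Bfin => x [[r1 r2] [r3 r4]] ->.
rewrite -EFinM lee_fin (le_trans (cabs_le _))// mulr2n mulrDl mul1r lerD// ler_norml; lra.
Qed.

(** The domination criterion for [g - h] with the zero majorant. *)
Lemma ae_eq_of_tensors g h : lint g -> lint h ->
  (forall f1 f2 f3 : R -> R, testfun f1 -> testfun f2 -> testfun f3 ->
    cintegral mu3 setT (fun x => g x * ctens f1 f2 f3 x) =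
    cintegral mu3 setT (fun x => h x * ctens f1 f2 f3 x)) ->
  {ae mu3, forall x, g x = h x}.
Proof.
move=> gl hl H.
have dl : lint (fun x => g x - h x).
  split; first by apply: cmeasurableD; [exact: gl.1|apply: cmeasurableN; exact: hl.1].
  move=> A; have mA := measurable_compact3 (@compact_cube A).
  have [gr gi] := gl.2 A; have [hr hi] := hl.2 A; split.
    have := integrableB mA gr hr; apply: eq_integrable => //.
    by move=> x _ /=; rewrite ReD ReN.
  have := integrableB mA gi hi; apply: eq_integrable => //.
  by move=> x _ /=; rewrite ImD ImN.
have := @ae_le_of_tensors (fun x => g x - h x) (cst 0%E) dl _ _ _ _.
move=> /(_ (measurable_cst _) (fun=> lexx _)).
rewrite integral0 => /(_ (ltry _)) hh.
have /hh : forall f1 f2 f3 : R -> R, testfun f1 -> testfun f2 -> testfun f3 ->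
    (forall x, 0 <= f1 x) -> (forall x, 0 <= f2 x) -> (forall x, 0 <= f3 x) ->
    ((cabs (cintegral mu3 setT (fun x => (g x - h x) * ctens f1 f2 f3 x)))%:E <=
     \int[mu3]_x (cst 0 x * (tensor f1 f2 f3 x)%:E))%E.
  move=> f1 f2 f3 t1 t2 t3 _ _ _.
  have gi := lint_integrable gl t1 t2 t3; have hi := lint_integrable hl t1 t2 t3.
  rewrite (@eq_cintegral _ _ _ mu3 _ (fun x => g x * ctens f1 f2 f3 x + - (h x * ctens f1 f2 f3 x))).
    rewrite cintegralD//; last exact: cintegrableN.
    rewrite cintegralN// H// subrr cabs0; apply: integral_ge0 => x _.
    by rewrite mul0e.
  by move=> x; rewrite mulrBl.
apply: ae_mono => x; rewrite mule0 lee_fin => h0.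
apply/eqP; rewrite -subr_eq0; apply/eqP; apply: cabs_eq0.
by apply/eqP; rewrite eq_le h0 cabs_ge0.
Qed.

End MeasurableSpace.

(** * Euclidean norms in three dimensions and their measurability *)

Section Norms.
Context {R : realType}.
Implicit Types (z w : 'I_3 -> R[i]).

Lemma sum3E (K : nmodType) (F : 'I_3 -> K) : \sum_(j < 3) F j = F 0 + F 1 + F 2%:R.
Proof.
rewrite !big_ord_recl big_ord0 addr0 addrA; congr (_ + _ + _); congr F; exact: val_inj.
Qed.

Lemma cnorm3_ge0 z : 0 <= cnorm3 z.
Proof. exact: sqrtr_ge0. Qed.

Lemma cabs_le_cnorm3 z k : cabs (z k) <= cnorm3 z.
Proof.
rewrite -(ger0_norm (cabs_ge0 (z k))) -sqrtr_sqr ler_wsqrtr//.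
rewrite (bigD1 k)//= lerDl; apply: sumr_ge0 => j _; exact: sqr_ge0.
Qed.

(** The constant comes from $\sqrt3\le 2$. *)
Lemma cnorm3_le z (M : R) : (forall k, cabs (z k) <= M) -> cnorm3 z <= 2 * M.
Proof.
move=> h; have M0 : 0 <= M := le_trans (cabs_ge0 _) (h 0).
rewrite -[leRHS]ger0_norm ?mulr_ge0// -sqrtr_sqr ler_wsqrtr// sum3E.
have k j : cabs (z j) ^+ 2 <= M ^+ 2 by rewrite lerXn2r ?nnegrE ?cabs_ge0.
have := k 0; have := k 1; have := k 2%:R; have := sqr_ge0 M.
move: (cabs (z 0) ^+ 2) (cabs (z 1) ^+ 2) (cabs (z 2%:R) ^+ 2) => a b c.
rewrite exprMn; move: (M ^+ 2) => m; lra.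
Qed.

Lemma cauchy_schwarz3 (a b : 'I_3 -> R) :
  \sum_(j < 3) a j * b j <= Num.sqrt (\sum_(j < 3) a j ^+ 2) * Num.sqrt (\sum_(j < 3) b j ^+ 2).
Proof.
have sq (c : 'I_3 -> R) : 0 <= \sum_(j < 3) c j ^+ 2 by apply: sumr_ge0 => j _; exact: sqr_ge0.
rewrite -sqrtrM// (le_trans (ler_norm _))// -sqrtr_sqr ler_wsqrtr// !sum3E.
move: (a 0) (a 1) (a 2%:R) (b 0) (b 1) (b 2%:R) => a0 a1 a2 b0 b1 b2.
(* Lagrange's identity. *)
rewrite -subr_ge0 (_ : _ - _ = (a0 * b1 - a1 * b0) ^+ 2 + (a0 * b2 - a2 * b0) ^+ 2 + (a1 * b2 - a2 * b1) ^+ 2); last by ring.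
by rewrite !addr_ge0 ?sqr_ge0.
Qed.

Lemma cnorm3D z w : cnorm3 (fun k => z k + w k) <= cnorm3 z + cnorm3 w.
Proof.
have sq (c : 'I_3 -> R) : 0 <= \sum_(j < 3) c j ^+ 2 by apply: sumr_ge0 => j _; exact: sqr_ge0.
rewrite -(ler_pXn2r (n := 2))// ?nnegrE ?addr_ge0 ?cnorm3_ge0//.
rewrite sqrrD !sqr_sqrtr//.
have cs : \sum_(j < 3) cabs (z j) * cabs (w j) <= cnorm3 z * cnorm3 w.
  exact: (cauchy_schwarz3 (fun k => cabs (z k)) (fun k => cabs (w k))).
apply: (@le_trans _ _ (\sum_(j < 3) (cabs (z j) + cabs (w j)) ^+ 2)).
  by apply: ler_sum => j _; rewrite lerXn2r ?nnegrE ?addr_ge0 ?cabs_ge0// cabsD.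
under eq_bigr do rewrite sqrrD.
rewrite !sum3E; rewrite !sum3E in cs; move: cs.
by move: (cnorm3 z * cnorm3 w) => q cs; lra.
Qed.

Lemma cnorm3_dist z w : `|cnorm3 z - cnorm3 w| <= cnorm3 (fun k => z k - w k).
Proof.
have h (a b : 'I_3 -> R[i]) : cnorm3 a - cnorm3 b <= cnorm3 (fun k => a k - b k).
  rewrite lerBlDr; apply: le_trans (cnorm3D _ _).
  by rewrite le_eqVlt; apply/orP; left; apply/eqP; congr cnorm3; apply/funext => k; rewrite subrK.
rewrite ler_norml h andbT lerNl opprB (le_trans (h w z))//.
rewrite le_eqVlt; apply/orP; left; apply/eqP; congr Num.sqrt; apply: eq_bigr => k _.
by rewrite -cabsN opprB.
Qed.

Lemma enorm3E (x : space R) : enorm3 x = Num.sqrt (\sum_(j < 3) coord x j ^+ 2).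
Proof. by rewrite /enorm3 /dot; congr Num.sqrt; apply: eq_bigr => j _; rewrite expr2. Qed.

Lemma enorm3_ge0 (x : space R) : 0 <= enorm3 x.
Proof. exact: sqrtr_ge0. Qed.

Lemma coord_le_enorm3 (x : space R) k : `|coord x k| <= enorm3 x.
Proof.
rewrite enorm3E -sqrtr_sqr ler_wsqrtr// (bigD1 k)//= lerDl.
by apply: sumr_ge0 => j _; exact: sqr_ge0.
Qed.

End Norms.

Section Measurability.
Context {R : realType} d (T : measurableType d).
Local Notation mspace := (measurableTypeR R * measurableTypeR R * measurableTypeR R)%type.

Lemma measurable_cnorm3 (z : T -> 'I_3 -> R[i]) : (forall k, cmeasurable (fun x => z x k)) ->
  measurable_fun setT (fun x => cnorm3 (z x)).
Proof.
move=> mz; have ms : measurable_fun setT (Num.sqrt : R -> R).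
  by apply: continuous_measurable_fun; exact: sqrt_continuous.
apply: (measurableT_comp ms); apply: measurable_sum => k.
by apply: measurable_funX; exact: measurable_cabs.
Qed.

Lemma measurable_coord (x : T -> mspace) k : measurable_fun setT x ->
  measurable_fun setT (fun t => coord (x t) k).
Proof.
move=> mx.
have m1 := measurableT_comp (@measurable_proj1 R) mx.
have m2 := measurableT_comp (@measurable_proj2 R) mx.
have m3 := measurableT_comp (@measurable_snd _ _ _ _) mx.
case: k => [[|[|[|//]]] ?]; rewrite /coord/=; [exact: m1|exact: m2|exact: m3].
Qed.

Lemma measurable_dot (x y : T -> mspace) : measurable_fun setT x -> measurable_fun setT y ->
  measurable_fun setT (fun t => dot (x t) (y t)).
Proof.
move=> mx my; apply: measurable_sum => k.
by apply: measurable_funM; exact: measurable_coord.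
Qed.

Lemma measurable_enorm3 (x : T -> mspace) : measurable_fun setT x ->
  measurable_fun setT (fun t => enorm3 (x t)).
Proof.
move=> mx; have ms : measurable_fun setT (Num.sqrt : R -> R).
  by apply: continuous_measurable_fun; exact: sqrt_continuous.
by apply: (measurableT_comp ms); exact: measurable_dot.
Qed.

Lemma measurable_add3 (x y : T -> mspace) : measurable_fun setT x -> measurable_fun setT y ->
  measurable_fun setT (fun t => (x t + y t : space R) : mspace).
Proof.
move=> mx my.
have x1 := measurableT_comp (@measurable_proj1 R) mx.
have x2 := measurableT_comp (@measurable_proj2 R) mx.
have x3 := measurableT_comp (@measurable_snd _ _ _ _) mx.
have y1 := measurableT_comp (@measurable_proj1 R) my.
have y2 := measurableT_comp (@measurable_proj2 R) my.
have y3 := measurableT_comp (@measurable_snd _ _ _ _) my.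
apply: (@measurable_fun_pair _ _ _ T (measurableTypeR R * measurableTypeR R)%type (measurableTypeR R)).
  by apply: measurable_fun_pair; exact: measurable_funD.
exact: measurable_funD.
Qed.

Lemma measurable_opp3 (x : T -> mspace) : measurable_fun setT x ->
  measurable_fun setT (fun t => (- x t : space R) : mspace).
Proof.
move=> mx.
have x1 := measurableT_comp (@measurable_proj1 R) mx.
have x2 := measurableT_comp (@measurable_proj2 R) mx.
have x3 := measurableT_comp (@measurable_snd _ _ _ _) mx.
apply: (@measurable_fun_pair _ _ _ T (measurableTypeR R * measurableTypeR R)%type (measurableTypeR R)).
  by apply: measurable_fun_pair; exact: measurable_funN.
exact: measurable_funN.
Qed.

End Measurability.

(** * Convolution of nonnegative functions *)

Section Convolution.
Context {R : realType}.
Local Notation mspace := (measurableTypeR R * measurableTypeR R * measurableTypeR R)%type.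
Local Notation mu := (@lebesgue_measure R).
Local Notation mu2 := (@lebesgue2 R).
Local Notation mu3 := (@lebesgue3 R).
Local Open Scope ereal_scope.

Lemma ge0_integral_shift3 (a : space R) (f : mspace -> \bar R) : measurable_fun setT f ->
  (forall x, 0 <= f x) -> \int[mu3]_x f (x + a)%R = \int[mu3]_x f x.
Proof.
move=> mf f0.
have mfa : measurable_fun setT (fun x : mspace => f ((x : space R) + a)%R).
  apply: (measurableT_comp mf); apply: measurable_add3; first exact: measurable_id.
  exact: measurable_cst.
rewrite (@fubini_tonelli1 _ _ _ _ R mu2 mu _ mfa (fun x => f0 _)).
rewrite (@fubini_tonelli1 _ _ _ _ R mu2 mu _ mf f0).
have mF := @measurable_fun_fubini_tonelli_F _ _ _ _ R mu f mf f0.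
pose F := fubini_F mu f.
have F0 z : 0 <= F z by apply: integral_ge0 => y _; exact: f0.
have mFa : measurable_fun setT (fun z : measurableTypeR R * measurableTypeR R => F (z.1 + a.1.1, z.2 + a.1.2)%R).
  apply: (measurableT_comp mF); apply: measurable_fun_pair; apply: measurable_funD.
  - exact: measurable_fst.
  - exact: measurable_cst.
  - exact: measurable_snd.
  - exact: measurable_cst.
transitivity (\int[mu2]_z F (z.1 + a.1.1, z.2 + a.1.2)%R).
  apply: eq_integral => z _; rewrite /fubini_F.
  rewrite -[RHS](ge0_integral_shift a.2)//.
  exact: (measurableT_comp mf (pair1_measurable _)).
rewrite (@fubini_tonelli1 _ _ _ _ R mu mu _ mFa (fun x => F0 _)).
rewrite (@fubini_tonelli1 _ _ _ _ R mu mu _ mF F0).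
have mF2 := @measurable_fun_fubini_tonelli_F _ _ _ _ R mu F mF F0.
transitivity (\int[mu]_z fubini_F mu F (z + a.1.1)%R); last first.
  by apply: ge0_integral_shift => // z; apply: integral_ge0 => y _; exact: F0.
apply: eq_integral => z _; rewrite /fubini_F.
rewrite -[RHS](ge0_integral_shift a.1.2)//.
exact: (measurableT_comp mF (pair1_measurable _)).
Qed.

(** Values are extended because the convolution of integrable functions is in general finite almost
    everywhere only. *)
Definition conv (F G : mspace -> \bar R) (x : mspace) : \bar R :=
  \int[mu3]_y (F y * G ((x : space R) - (y : space R))%R).

Lemma conv_ge0 F G : (forall x, 0 <= F x) -> (forall x, 0 <= G x) ->
  forall x, 0 <= conv F G x.
Proof. by move=> F0 G0 x; apply: integral_ge0 => y _; rewrite mule_ge0. Qed.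

(** The parameter will be time: this yields convolutions that are measurable jointly in time and
    frequency. *)
Lemma measurable_conv_param d (P : measurableType d) (F G : P * mspace -> \bar R) :
  measurable_fun setT F -> measurable_fun setT G ->
  (forall z, 0 <= F z) -> (forall z, 0 <= G z) ->
  measurable_fun setT (fun z : P * mspace => conv (fun y => F (z.1, y)) (fun y => G (z.1, y)) z.2).
Proof.
move=> mF mG F0 G0.
pose h (q : (P * mspace) * mspace) := F (q.1.1, q.2) *
  G (q.1.1, ((q.1.2 : space R) - (q.2 : space R))%R).
apply: (@measurable_fun_fubini_tonelli_F _ _ _ _ R mu3 h); last first.
  by move=> q; rewrite mule_ge0.
have m11 : measurable_fun setT (fun q : (P * mspace) * mspace => q.1.1).
  exact: (measurableT_comp measurable_fst measurable_fst).
have m12 : measurable_fun setT (fun q : (P * mspace) * mspace => q.1.2).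
  exact: (measurableT_comp measurable_snd measurable_fst).
apply: emeasurable_funM.
  by apply: (measurableT_comp mF); apply: measurable_fun_pair => //; exact: measurable_snd.
apply: (measurableT_comp mG); apply: measurable_fun_pair => //.
apply: measurable_add3 => //; apply: measurable_opp3; exact: measurable_snd.
Qed.

Lemma measurable_conv F G : measurable_fun setT F -> measurable_fun setT G ->
  (forall z, 0 <= F z) -> (forall z, 0 <= G z) -> measurable_fun setT (conv F G).
Proof.
move=> mF mG F0 G0.
have h := @measurable_conv_param _ (measurableTypeR R) (fun z => F z.2) (fun z => G z.2)
  (measurableT_comp mF measurable_snd) (measurableT_comp mG measurable_snd) (fun z => F0 _) (fun z => G0 _).
exact: (measurableT_comp h (pair1_measurable (0%R : measurableTypeR R))).
Qed.

Lemma measurable_sub_pair (G : mspace -> \bar R) : measurable_fun setT G ->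
  measurable_fun setT (fun z : mspace * mspace => G ((z.1 : space R) - (z.2 : space R))%R).
Proof.
move=> mG; apply: (measurableT_comp mG); apply: measurable_add3.
  exact: measurable_fst.
by apply: measurable_opp3; exact: measurable_snd.
Qed.

(* Fubini and translation invariance. *)
Lemma conv_pairing F G (p : mspace -> \bar R) :
  measurable_fun setT F -> measurable_fun setT G -> measurable_fun setT p ->
  (forall z, 0 <= F z) -> (forall z, 0 <= G z) -> (forall z, 0 <= p z) ->
  \int[mu3]_x (conv F G x * p x) =
  \int[mu3]_y (F y * \int[mu3]_x (G x * p ((x : space R) + (y : space R))%R)).
Proof.
move=> mF mG mp F0 G0 p0.
pose h (z : mspace * mspace) := F z.2 * G ((z.1 : space R) - (z.2 : space R))%R * p z.1.
have mh : measurable_fun setT h.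
  apply: emeasurable_funM; last exact: (measurableT_comp mp measurable_fst).
  apply: emeasurable_funM; first exact: (measurableT_comp mF measurable_snd).
  exact: measurable_sub_pair.
have h0 z : 0 <= h z by rewrite /h !mule_ge0.
transitivity (\int[mu3]_x \int[mu3]_y h (x, y)).
  apply: eq_integral => x _; rewrite /conv -ge0_integralZr//.
  - apply: emeasurable_funM => //.
    exact: (measurableT_comp (measurable_sub_pair mG) (pair1_measurable _)).
  - by move=> y _; rewrite mule_ge0.
transitivity (\int[mu3]_y \int[mu3]_x h (x, y)).
  exact: (@fubini_tonelli _ _ _ _ R mu3 mu3 h mh h0).
apply: eq_integral => y _; rewrite /h/=.
have mGp : measurable_fun setT (fun x : mspace => G x * p ((x : space R) + (y : space R))%R).
  apply: emeasurable_funM => //; apply: (measurableT_comp mp); apply: measurable_add3.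
    exact: measurable_id.
  exact: measurable_cst.
rewrite -(@ge0_integral_shift3 (- (y : space R))%R _ mGp); last by move=> x; rewrite mule_ge0.
rewrite -ge0_integralZl//.
- by apply: eq_integral => x _; rewrite subrK muleA.
- apply: (measurableT_comp mGp); apply: measurable_add3; first exact: measurable_id.
  exact: measurable_cst.
- by move=> x _; rewrite mule_ge0.
Qed.

(** The pairing identity with the constant function 1. *)
Lemma conv_integral F G : measurable_fun setT F -> measurable_fun setT G ->
  (forall z, 0 <= F z) -> (forall z, 0 <= G z) ->
  \int[mu3]_x conv F G x = (\int[mu3]_x F x) * (\int[mu3]_x G x).
Proof.
move=> mF mG F0 G0; have := @conv_pairing F G (cst 1) mF mG (measurable_cst _) F0 G0 (fun=> lee01).
under eq_integral do rewrite mule1.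
have G1 : 0 <= \int[mu3]_x G x by exact: integral_ge0.
move=> ->; rewrite -(@ge0_integralZr _ _ _ mu3 setT measurableT F mF _ (fun y _ => F0 y) G1).
by apply: eq_integral => y _; congr (_ * _); apply: eq_integral => x _; rewrite mule1.
Qed.

End Convolution.

(** * Bounded functions acting as inverse Fourier transforms *)

Section Multipliers.
Context {R : realType}.
Local Notation mspace := (measurableTypeR R * measurableTypeR R * measurableTypeR R)%type.
Local Notation mu3 := (@lebesgue3 R).
Local Notation c := (((2 * pi) ^+ 3)^-1 : R).
Implicit Types (f g v w G : space R -> R[i]).

Lemma c_gt0 : 0 < c.
Proof. by rewrite invr_gt0 exprn_gt0// mulr_gt0// pi_gt0. Qed.

Lemma cmeasurable_character (e : space R) :
  cmeasurable (fun x : mspace => cis (dot x e)).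
Proof.
by apply: cmeasurable_cis; apply: measurable_dot; [exact: measurable_id|exact: measurable_cst].
Qed.

Lemma cintegrable_character (e : space R) G : cintegrable mu3 G ->
  cintegrable mu3 (fun x => cis (dot x e) * G x).
Proof.
move=> Gi; apply: (cintegrable_bounded (cmeasurable_character e) (M := 1) _ Gi).
by move=> x; rewrite cabs_cis.
Qed.

Lemma cintegrable_kernel f G : cintegrable mu3 f -> cintegrable mu3 G ->
  cintegrable (mu3 \x mu3)%E (fun z => cis (dot z.1 z.2) * (G z.1 * f z.2)).
Proof.
move=> fi Gi.
have ti := @cintegrable_tensor R _ _ _ _ mu3 mu3 _ _ Gi fi.
apply: (cintegrable_bounded (M := 1) _ _ ti); last by move=> x; rewrite cabs_cis.
by apply: cmeasurable_cis; apply: measurable_dot; [exact: measurable_fst|exact: measurable_snd].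
Qed.

Lemma inv_fourierE f x : inv_fourier f x = c%:C * cintegral mu3 setT (fun e => cis (dot x e) * f e).
Proof. by []. Qed.

(** Fubini yields measurability in [x] of an integral over [e] when the integrand is integrable on
    the product, but $e^{ix\cdot e}f(e)$ does not decay in [x]. Multiplying it by a Gaussian in [x],
    which never vanishes, and dividing afterwards repairs this. *)
Lemma cmeasurable_inv_fourier f : cintegrable mu3 f -> cmeasurable (inv_fourier f : mspace -> R[i]).
Proof.
move=> fi.
suff m0 : cmeasurable (fun x : mspace => cintegral mu3 setT (fun e => cis (dot x e) * f e)).
  exact: (cmeasurableM (cmeasurable_cst _ c%:C) m0).
pose G : space R -> R[i] := tensor (fun x => (expR (- x ^+ 2))%:C) (fun x => (expR (- x ^+ 2))%:C)
  (fun x => (expR (- x ^+ 2))%:C).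
have gi : cintegrable (@lebesgue_measure R) (fun x => (expR (- x ^+ 2))%:C).
  split; last exact: integrable0.
  exact: integrableT_gauss.
have [Gi _] := cintegral_tensor3 gi gi gi; rewrite -/G in Gi.
have G0 x : G x != 0.
  by rewrite /G /tensor !mulf_neq0// eq_complex/= negb_and gt_eqF// expR_gt0.
have [/cintegrable_measurable m _] := @cintegral_prod1 _ _ _ _ _ mu3 mu3 _ (cintegrable_kernel fi Gi).
have e x : cintegral mu3 setT (fun e => cis (dot x e) * f e) =
    (G x)^-1 * cintegral mu3 setT (fun y => cis (dot x y) * (G x * f y)).
  rewrite -cintegralZ.
    by apply: eq_cintegral => y; rewrite [RHS]mulrCA mulKf.
  have := cintegrableZ (G x) (cintegrable_character x fi); congr cintegrable.
  by apply/funext => y; rewrite dotC mulrCA.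
rewrite (funext e); apply: (@cmeasurableM R _ mspace (fun x => (G x)^-1) _ _ m).
have GE x : (G x)^-1 = (expR (x.1.1 ^+ 2) * expR (x.1.2 ^+ 2) * expR (x.2 ^+ 2))%:C.
  rewrite /G /tensor -!rmorphM/= -fmorphV; congr (_%:C).
  by rewrite -!expRD -expRN; congr expR; ring.
rewrite (funext GE); apply: cmeasurable_real.
have me : measurable_fun setT (fun x : R => expR (x ^+ 2)).
  apply: continuous_measurable_fun => x; apply: continuous_comp; last exact: continuous_expR.
  exact: exprn_continuous.
exact: (measurable_tensor me me me).
Qed.

Lemma inv_fourier_bounded f : cintegrable mu3 f ->
  exists M, forall x, cabs (inv_fourier f x) <= M.
Proof.
move=> fi; exists (c * \int[mu3]_x cabs (f x)) => x.
rewrite inv_fourierE cabsM cabsC (ger0_norm (ltW c_gt0)) (ler_pM2l c_gt0).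
have e : (fun e => cis (dot x e) * f e) = (fun e => cis (dot e x) * f e).
  by apply/funext => y; rewrite dotC.
rewrite e; apply: le_trans (cabs_cintegral (cintegrable_character x fi)) _.
by rewrite le_eqVlt; apply/orP; left; apply/eqP; apply: eq_Rintegral => y _; rewrite cabsM cabs_cis mul1r.
Qed.

(** Fubini, the kernel $e^{ix\cdot e}$ being symmetric in its two variables. *)
Lemma inv_fourier_swap f G : cintegrable mu3 f -> cintegrable mu3 G ->
  cintegral mu3 setT (fun x => inv_fourier f x * G x) =
  cintegral mu3 setT (fun e => f e * inv_fourier G e).
Proof.
move=> fi Gi; have ki := cintegrable_kernel fi Gi.
have := @cintegral_swap _ _ _ _ _ mu3 mu3 _ ki; rewrite /= => sw.
have [/= k1 _] := @cintegral_prod1 _ _ _ _ _ mu3 mu3 _ ki.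
have [/= k2 _] := @cintegral_prod2 _ _ _ _ _ mu3 mu3 _ ki.
transitivity (c%:C * cintegral mu3 setT (fun x => cintegral mu3 setT (fun y => cis (dot x y) * (G x * f y)))).
  rewrite -(cintegralZ c%:C k1); apply: eq_cintegral => x.
  rewrite inv_fourierE -mulrA; congr (_ * _); rewrite mulrC -cintegralZ.
    by apply: eq_cintegral => y; rewrite mulrCA.
  have := cintegrable_character x fi; congr cintegrable; apply/funext => y.
  by rewrite dotC.
rewrite sw -(cintegralZ c%:C k2); apply: eq_cintegral => y.
rewrite inv_fourierE [RHS]mulrCA; congr (_ * _); rewrite -cintegralZ.
  by apply: eq_cintegral => x; rewrite dotC; ring.
have := cintegrable_character y Gi; congr cintegrable; apply/funext => x.
by rewrite dotC.
Qed.

(* [v] acts under integrals as the inverse Fourier transform of [f]. *)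
Definition multiplier v f := [/\ cmeasurable (v : mspace -> R[i]),
  exists M, forall x, cabs (v x) <= M &
  forall G, cintegrable mu3 G ->
    cintegral mu3 setT (fun x => v x * G x) = cintegral mu3 setT (fun e => f e * inv_fourier G e)].

Lemma multiplier0 : multiplier (fun=> 0) (fun=> 0).
Proof.
split; first exact: cmeasurable_cst.
  by exists 0 => x; rewrite cabs0.
move=> G Gi; transitivity (cintegral mu3 setT (fun=> 0)).
  by apply: eq_cintegral => x; rewrite mul0r.
by apply: eq_cintegral => x; rewrite mul0r.
Qed.

Lemma lint_bounded v : cmeasurable (v : mspace -> R[i]) -> (exists M, forall x, cabs (v x) <= M) -> lint v.
Proof.
move=> mv [M hM]; split=> // A.
have mA := measurable_compact3 (@compact_cube R A).
have [mr mi] := mv.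
have ib (a b : R) : (@lebesgue_measure R).-integrable setT (EFin \o ioo a b).
  exact: integrable_indic_itv.
(* The open box of half-width [A + 1] contains the closed cube of half-width [A]. *)
pose B := A + 1.
have i3 : mu3.-integrable setT (EFin \o box (- B) B (- B) B (- B) B).
  have i2 := integrable_tensor (ib (- B) B) (ib (- B) B).
  exact: (@integrable_tensor R _ _ _ _ lebesgue2 _ _ _ i2 (ib (- B) B)).
have iM : mu3.-integrable (cube A) (EFin \o (fun=> M)).
  have := integrableS (@measurableT _ _) mA (@subsetT _ _) (integrableZl (@measurableT _ _) M i3).
  apply: eq_integrable => // x /[!inE] -[[/= + +] +]; rewrite !in_itv/= => k1 k2 k3.
  have one y : - A <= y <= A -> ioo (- B) B y = 1.
    by move=> hy; rewrite /ioo indicE mem_set//= in_itv/= /B; lra.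
  by rewrite /box /tensor !one// !mulr1 mule1.
split; apply: (@integrable_le_fin _ _ _ mu3 _ _ (fun=> M)) => //.
- exact: measurable_funTS.
- by move=> x _; exact: le_trans (normRe_le _) (hM x).
- exact: measurable_funTS.
- by move=> x _; exact: le_trans (normIm_le _) (hM x).
Qed.

End Multipliers.

(** * Transforms of products *)

Section Pairings.
Context {R : realType}.
Local Notation mspace := (measurableTypeR R * measurableTypeR R * measurableTypeR R)%type.
Local Notation mu3 := (@lebesgue3 R).
Local Notation c := (((2 * pi) ^+ 3)^-1 : R).
Implicit Types (f g v w : space R -> R[i]) (F K : mspace -> \bar R).

Definition nonneg_test (f1 f2 f3 : R -> R) :=
  [/\ testfun f1, testfun f2 & testfun f3] /\
  [/\ forall x, 0 <= f1 x, forall x, 0 <= f2 x & forall x, 0 <= f3 x].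

Definition mass F := [/\ measurable_fun setT F, forall x, (0 <= F x)%E & (\int[mu3]_x F x < +oo)%E].

Lemma mass_conv F K : mass F -> mass K -> mass (conv F K).
Proof.
move=> [mF F0 Ff] [mK K0 Kf]; split.
- exact: measurable_conv.
- exact: conv_ge0.
- by rewrite conv_integral// lte_mul_pinfty ?integral_ge0// ge0_fin_numE ?integral_ge0.
Qed.

Lemma massD F K : mass F -> mass K -> mass (fun x => F x + K x)%E.
Proof.
move=> [mF F0 Ff] [mK K0 Kf]; split.
- exact: emeasurable_funD.
- by move=> x; rewrite adde_ge0.
- by rewrite ge0_integralD// lte_add_pinfty.
Qed.

Lemma massZ (k : R) F : 0 <= k -> mass F -> mass (fun x => k%:E * F x)%E.
Proof.
move=> k0 [mF F0 Ff]; split.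
- exact: measurable_funeM.
- by move=> x; rewrite mule_ge0.
- by rewrite ge0_integralZl_EFin// lte_mul_pinfty// ?lee_fin.
Qed.

Lemma mass0 : mass (cst 0%E).
Proof. by split => //; rewrite integral0. Qed.

Definition shifted_test (f1 f2 f3 : R -> R) (eta x : space R) : \bar R :=
  (tensor f1 f2 f3 (x + eta))%:E.

Lemma measurable_shifted_test (f1 f2 f3 : R -> R) eta : testfun f1 -> testfun f2 -> testfun f3 ->
  measurable_fun setT (shifted_test f1 f2 f3 eta : mspace -> \bar R).
Proof.
move=> t1 t2 t3; apply/measurable_EFinP.
have mt : measurable_fun setT (tensor f1 f2 f3 : mspace -> R).
  by apply: measurable_tensor; apply: continuous_measurable_fun; exact: testfun_continuous.
apply: (measurableT_comp mt); apply: measurable_add3; [exact: measurable_id|exact: measurable_cst].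
Qed.

Lemma shifted_test_ge0 (f1 f2 f3 : R -> R) eta x : nonneg_test f1 f2 f3 -> (0 <= shifted_test f1 f2 f3 eta x)%E.
Proof. by move=> [_ [p1 p2 p3]]; rewrite lee_fin /tensor !mulr_ge0. Qed.

(* [K] controls the Fourier transform of [w]: in the bound below the left-hand side is
   the pairing of that transform, translated by [eta], with a test function. *)
Definition hat_bounded w (C : R) K := [/\ cmeasurable (w : mspace -> R[i]),
  exists M, forall x, cabs (w x) <= M &
  forall (f1 f2 f3 : R -> R) eta, nonneg_test f1 f2 f3 ->
    ((cabs (cintegral mu3 setT (fun x => w x * (cis (dot x eta) * fourier (ctens f1 f2 f3) x))))%:E <=
     C%:E * \int[mu3]_x (K x * shifted_test f1 f2 f3 eta x))%E].

Lemma cintegrable_fourier_ctens (f1 f2 f3 : R -> R) : testfun f1 -> testfun f2 -> testfun f3 ->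
  cintegrable mu3 (fourier (ctens f1 f2 f3)).
Proof. by move=> t1 t2 t3; rewrite fourier_ctens//; exact: FT3_integrable. Qed.

Lemma dotDr (x y z : space R) : dot x (y + z) = dot x y + dot x z.
Proof. by rewrite !dotE/=; ring. Qed.

Lemma inv_fourier_character f (e x : space R) :
  inv_fourier (fun y => cis (dot y e) * f y) x = inv_fourier f (x + e).
Proof.
rewrite !inv_fourierE; congr (_ * _); apply: eq_cintegral => y.
by rewrite mulrA -cisD (dotC x y) (dotC (x + e)) dotDr.
Qed.

Lemma cabs_cintegral_mul_le f g (B : mspace -> \bar R) : cintegrable mu3 (fun x => f x * g x) ->
  (forall x, ((cabs (f x) * cabs (g x))%:E <= B x)%E) ->
  ((cabs (cintegral mu3 setT (fun x => f x * g x)))%:E <= \int[mu3]_x B x)%E.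
Proof.
move=> fgi h; apply: le_trans (cabs_cintegral_EFin fgi) _.
apply: ge0_le_lower_integral => x _; first by rewrite lee_fin cabs_ge0.
by rewrite cabsM.
Qed.

(** On the frequency side inversion gives back the test function, evaluated at [x + eta]. *)
Lemma hat_bounded_multiplier v f F : multiplier v f -> cintegrable mu3 f ->
  (forall x, ((cabs (f x))%:E <= F x)%E) -> hat_bounded v 1 F.
Proof.
move=> [mv bv hv] fi fF; split => // f1 f2 f3 eta nt.
have [[t1 t2 t3] _] := nt.
have Gi := cintegrable_character eta (cintegrable_fourier_ctens t1 t2 t3).
rewrite hv// mul1e.
have E x : inv_fourier (fun y => cis (dot y eta) * fourier (ctens f1 f2 f3) y) x =
    (tensor f1 f2 f3 (x + eta))%:C.
  by rewrite inv_fourier_character inv_fourierK.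
apply: cabs_cintegral_mul_le.
  have [M hM] := inv_fourier_bounded Gi.
  have := cintegrable_bounded (cmeasurable_inv_fourier Gi) hM fi; congr cintegrable.
  by apply/funext => x; rewrite mulrC.
move=> x; rewrite E cabsC EFinM /shifted_test; apply: lee_pmul => //; rewrite ?lee_fin ?cabs_ge0//.
by rewrite ger0_norm// -lee_fin; exact: shifted_test_ge0.
Qed.

(** Moving [v] to the frequency side leaves the integral of [f x] times the inverse transform, at
    [x], of [w] multiplied by a character and the test transform. That inverse transform is [c]
    times the pairing for [w] translated by [x + eta]; this is why [hat_bounded] ranges over all
    translations. [conv_pairing] then assembles the bounds into a convolution, each product costing
    one factor [c]. *)
Lemma hat_bounded_mul v f F w C K : multiplier v f -> cintegrable mu3 f ->
  (forall x, ((cabs (f x))%:E <= F x)%E) -> measurable_fun setT F ->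
  0 <= C -> measurable_fun setT K -> (forall x, (0 <= K x)%E) ->
  hat_bounded w C K -> hat_bounded (fun x => v x * w x) (c * C) (conv F K).
Proof.
move=> [mv [M hM] hv] fi fF mF C0 mK K0 [mw [N hN] hw].
have F0 x : (0 <= F x)%E by apply: le_trans (fF x); rewrite lee_fin cabs_ge0.
split.
- exact: (cmeasurableM mv mw).
- by exists (M * N) => x; rewrite cabsM ler_pM ?cabs_ge0.
move=> f1 f2 f3 eta nt; have [[t1 t2 t3] _] := nt.
have Gi := cintegrable_character eta (cintegrable_fourier_ctens t1 t2 t3).
have wGi := cintegrable_bounded mw hN Gi.
rewrite (@eq_cintegral _ _ _ mu3 _ (fun x => v x * (w x * (cis (dot x eta) * fourier (ctens f1 f2 f3) x)))); last first.
  by move=> x; rewrite -mulrA.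
rewrite hv//.
have [L hL] := inv_fourier_bounded wGi.
have mT e := measurable_shifted_test e t1 t2 t3.
have T0 e x := @shifted_test_ge0 f1 f2 f3 e x nt.
have bound x : ((cabs (inv_fourier (fun y => w y * (cis (dot y eta) * fourier (ctens f1 f2 f3) y)) x))%:E
    <= (c * C)%:E * \int[mu3]_y (K y * shifted_test f1 f2 f3 (x + eta)%R y))%E.
  rewrite inv_fourierE cabsM cabsC (ger0_norm (ltW (c_gt0))) EFinM [in leRHS]EFinM -muleA.
  rewrite lee_wpmul2l ?lee_fin ?(ltW c_gt0)//.
  rewrite (@eq_cintegral _ _ _ mu3 _ (fun y => w y * (cis (dot y (x + eta)) * fourier (ctens f1 f2 f3) y))).
    exact: hw.
  by move=> y; rewrite dotDr cisD (dotC x y); ring.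
rewrite (@conv_pairing _ F K)//.
rewrite -ge0_integralZl//; last 3 first.
- apply: emeasurable_funM => //.
  pose h (z : mspace * mspace) := (K z.2 * (tensor f1 f2 f3 ((z.2 : space R) + ((z.1 : space R) + eta)))%:E)%E.
  have mh : measurable_fun setT h.
    apply: emeasurable_funM; first exact: (measurableT_comp mK measurable_snd).
    apply/measurable_EFinP.
    have mt : measurable_fun setT (tensor f1 f2 f3 : mspace -> R).
      by apply: measurable_tensor; apply: continuous_measurable_fun; exact: testfun_continuous.
    apply: (measurableT_comp mt); apply: measurable_add3; first exact: measurable_snd.
    by apply: measurable_add3; [exact: measurable_fst|exact: measurable_cst].
  have h0 z : (0 <= h z)%E by rewrite mule_ge0//; exact: (T0 _ _).
  have := @measurable_fun_fubini_tonelli_F _ _ _ _ R mu3 h mh h0.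
  by congr measurable_fun; apply/funext => x; apply: eq_integral => y _; rewrite /h /shifted_test -addrA.
- by move=> x _; rewrite mule_ge0// integral_ge0// => y _; rewrite mule_ge0.
- by rewrite lee_fin mulr_ge0// ltW// c_gt0.
apply: cabs_cintegral_mul_le.
  have := cintegrable_bounded (cmeasurable_inv_fourier wGi) hL fi; congr cintegrable.
  by apply/funext => x; rewrite mulrC.
move=> x; rewrite EFinM [leRHS]muleCA; apply: lee_pmul => //; rewrite ?lee_fin ?cabs_ge0//.
apply: le_trans (bound x) _.
rewrite lee_wpmul2l ?lee_fin ?mulr_ge0 ?(ltW c_gt0)//.
rewrite le_eqVlt; apply/orP; left; apply/eqP; apply: eq_integral => y _.
by rewrite /shifted_test addrA.
Qed.

Lemma hat_boundedD v w C F K : 0 <= C -> measurable_fun setT F -> measurable_fun setT K ->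
  (forall x, (0 <= F x)%E) -> (forall x, (0 <= K x)%E) ->
  hat_bounded v C F -> hat_bounded w C K ->
  hat_bounded (fun x => v x + w x) C (fun x => F x + K x)%E.
Proof.
move=> C0 mF mK F0 K0 [mv [M hM] hv] [mw [N hN] hw]; split.
- exact: (cmeasurableD mv mw).
- by exists (M + N) => x; apply: le_trans (cabsD _ _) _; rewrite lerD.
move=> f1 f2 f3 eta nt; have [[t1 t2 t3] _] := nt.
have Gi := cintegrable_character eta (cintegrable_fourier_ctens t1 t2 t3).
rewrite (@eq_cintegral _ _ _ mu3 _ (fun x => v x * (cis (dot x eta) * fourier (ctens f1 f2 f3) x) +
  w x * (cis (dot x eta) * fourier (ctens f1 f2 f3) x))); last by move=> x; rewrite mulrDl.
rewrite cintegralD; [|exact: (cintegrable_bounded mv hM Gi)|exact: (cintegrable_bounded mw hN Gi)].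
apply: (@le_trans _ _ (C%:E * \int[mu3]_x (F x * shifted_test f1 f2 f3 eta x) +
    C%:E * \int[mu3]_x (K x * shifted_test f1 f2 f3 eta x))%E).
  by apply: le_trans (leeD (hv f1 f2 f3 eta nt) (hw f1 f2 f3 eta nt)); rewrite -EFinD lee_fin cabsD.
have T0 x := @shifted_test_ge0 f1 f2 f3 eta x nt.
have mT := measurable_shifted_test eta t1 t2 t3.
rewrite -ge0_muleDr; [|by apply: integral_ge0 => x _; rewrite mule_ge0|by apply: integral_ge0 => x _; rewrite mule_ge0].
rewrite -ge0_integralD//.
- rewrite le_eqVlt; apply/orP; left; apply/eqP; congr (_ * _)%E; apply: eq_integral => x _.
  by rewrite ge0_muleDl.
- by move=> x _; rewrite mule_ge0.
- exact: emeasurable_funM.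
- by move=> x _; rewrite mule_ge0.
- exact: emeasurable_funM.
Qed.

Lemma hat_bounded_le w C F K : 0 <= C -> (forall x, (0 <= F x)%E) -> (forall x, (F x <= K x)%E) ->
  hat_bounded w C F -> hat_bounded w C K.
Proof.
move=> C0 F0 FK [mw bw hw]; split => // f1 f2 f3 eta nt; apply: le_trans (hw _ _ _ eta nt) _.
have T0 x := @shifted_test_ge0 f1 f2 f3 eta x nt.
rewrite lee_wpmul2l ?lee_fin//; apply: ge0_le_lower_integral => x _; first by rewrite mule_ge0.
by rewrite lee_wpmul2r.
Qed.

(** The index counts convolutions, not factors: index [n] goes with the power [n.+1] and the
    constant [c ^+ n]. *)
Fixpoint conv_pow F (n : nat) : mspace -> \bar R :=
  if n is n'.+1 then conv F (conv_pow F n') else F.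

Lemma conv_pow_ge0 F n : (forall x, (0 <= F x)%E) -> forall x, (0 <= conv_pow F n x)%E.
Proof. by move=> F0; elim: n => [|n IH] //=; exact: conv_ge0. Qed.

Lemma measurable_conv_pow F n : measurable_fun setT F -> (forall x, (0 <= F x)%E) ->
  measurable_fun setT (conv_pow F n).
Proof.
move=> mF F0; elim: n => [|n IH] //=; apply: measurable_conv => //; exact: conv_pow_ge0.
Qed.

Lemma hat_bounded_pow v f F n : multiplier v f -> cintegrable mu3 f ->
  (forall x, ((cabs (f x))%:E <= F x)%E) -> measurable_fun setT F ->
  hat_bounded (fun x => v x ^+ n.+1) (c ^+ n) (conv_pow F n).
Proof.
move=> vf fi fF mF; have F0 x : (0 <= F x)%E by apply: le_trans (fF x); rewrite lee_fin cabs_ge0.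
elim: n => [|n IH]; first exact: (hat_bounded_multiplier vf fi fF).
under eq_fun do rewrite exprS; rewrite exprS /=.
apply: (hat_bounded_mul vf fi fF) => //.
- by rewrite exprn_ge0// ltW// c_gt0.
- exact: measurable_conv_pow.
- exact: conv_pow_ge0.
Qed.

Lemma conv_pow_integral F n : measurable_fun setT F -> (forall x, (0 <= F x)%E) ->
  (\int[mu3]_x conv_pow F n x = (\int[mu3]_x F x) ^+ n.+1)%E.
Proof.
move=> mF F0; elim: n => [|n IH]; first by [].
rewrite /= conv_integral//; [|exact: measurable_conv_pow|exact: conv_pow_ge0].
by rewrite IH.
Qed.

End Pairings.

(** * Transforms and continuous representatives of distributions *)

Section Distributions.
Context {R : realType}.
Local Notation mspace := (measurableTypeR R * measurableTypeR R * measurableTypeR R)%type.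
Local Notation mu3 := (@lebesgue3 R).
Local Notation c := (((2 * pi) ^+ 3)^-1 : R).
Implicit Types (T : dist R) (u : vdist R) (B : mspace -> \bar R).

Lemma has_fourier_Fhat T : (exists g, has_fourier T g) -> has_fourier T (Fhat T).
Proof. by move=> h; exact: (xgetPex (fun=> 0) h). Qed.

(* When no transform (resp. representing function) exists the definitions return [0], for
   which every upper bound below is trivial: existence never has to be proved. *)
Lemma Fhat_cases T : Fhat T = (fun=> 0) \/ has_fourier T (Fhat T).
Proof.
have [h|h] := pselect (exists g, has_fourier T g); first by right; exact: has_fourier_Fhat.
by left; apply: xgetPN => g hg; apply: h; exists g.
Qed.

Lemma fun_of_cases T : fun_of T = (fun=> 0) \/ represents (fun_of T) T.
Proof.
have [h|h] := pselect (exists v, represents v T); first by right; exact: (xgetPex (fun=> 0) h).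
by left; apply: xgetPN => g hg; apply: h; exists g.
Qed.

Lemma lint_Fhat T : lint (Fhat T).
Proof.
have [->|[h _]] := Fhat_cases T; last exact: lint_locally_integrable.
by apply: lint_cintegrable; exact: cintegrable0.
Qed.

Lemma cmeasurable_Fhat T : cmeasurable (Fhat T : mspace -> R[i]).
Proof. by have [] := lint_Fhat T. Qed.

Lemma has_fourier_ctens T g (f1 f2 f3 : R -> R) : has_fourier T g ->
  testfun f1 -> testfun f2 -> testfun f3 ->
  T (fourier (ctens f1 f2 f3)) = cintegral mu3 setT (fun x => g x * ctens f1 f2 f3 x).
Proof. by move=> [_ h] t1 t2 t3; rewrite h//; exact: schwartz_ctens. Qed.

Lemma Fhat_unique T g : has_fourier T g -> {ae mu3, forall x, Fhat T x = g x}.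
Proof.
move=> hg; have h := has_fourier_Fhat (ex_intro _ g hg).
apply: ae_eq_of_tensors; [exact: lint_Fhat|exact: lint_locally_integrable hg.1|].
by move=> f1 f2 f3 t1 t2 t3; rewrite -(has_fourier_ctens h t1 t2 t3) -(has_fourier_ctens hg t1 t2 t3).
Qed.

Lemma Fhat_bound T B : mass B ->
  (forall f1 f2 f3 : R -> R, nonneg_test f1 f2 f3 ->
    ((cabs (T (fourier (ctens f1 f2 f3))))%:E <= \int[mu3]_x (B x * (tensor f1 f2 f3 x)%:E))%E) ->
  {ae mu3, forall x, ((cabs (Fhat T x))%:E <= 2%:E * B x)%E}.
Proof.
move=> [mB B0 Bf] h; have [->|hT] := Fhat_cases T.
  by apply: aeW => x; rewrite cabs0 mule_ge0.
apply: ae_le_of_tensors => //; first exact: lint_Fhat.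
move=> f1 f2 f3 t1 t2 t3 p1 p2 p3.
by rewrite -(has_fourier_ctens hT t1 t2 t3); exact: h.
Qed.

Lemma Fhat_Finv (h : space R -> R[i]) : cintegrable mu3 h ->
  {ae mu3, forall x, cabs (Fhat (Finv h) x) <= cabs (h x)}.
Proof.
move=> hi; have [->|hT] := Fhat_cases (Finv h).
  by apply: aeW => x; rewrite cabs0 cabs_ge0.
have : {ae mu3, forall x, Fhat (Finv h) x = h x}.
  apply: ae_eq_of_tensors; [exact: lint_Fhat|exact: lint_cintegrable|].
  move=> f1 f2 f3 t1 t2 t3; rewrite -(has_fourier_ctens hT t1 t2 t3).
  by rewrite /Finv inv_fourierK.
by apply: ae_mono => x ->.
Qed.

Lemma heat_ctens (s : R) T (f1 f2 f3 : R -> R) : testfun f1 -> testfun f2 -> testfun f3 ->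
  heat s T (fourier (ctens f1 f2 f3)) =
  cintegral mu3 setT (fun x => (expR (- s * enorm3 x ^+ 2))%:C * Fhat T x * ctens f1 f2 f3 x).
Proof. by move=> t1 t2 t3; rewrite /heat /Finv inv_fourierK. Qed.

Definition hatnorm u (x : mspace) : R := cnorm3 (fun k => Fhat (u k) x).

Lemma hatnorm_ge0 u x : 0 <= hatnorm u x.
Proof. exact: cnorm3_ge0. Qed.

Lemma measurable_hatnorm u : measurable_fun setT (hatnorm u).
Proof. by apply: measurable_cnorm3 => k; exact: cmeasurable_Fhat. Qed.

Lemma Xenorm0E u : Xenorm 0 u = (\int[mu3]_x (hatnorm u x)%:E)%E.
Proof. by apply: eq_integral => x _; rewrite powRr0 mul1r. Qed.

Lemma Xenorm2E u : Xenorm 2 u = (\int[mu3]_x (enorm3 x ^+ 2 * hatnorm u x)%:E)%E.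
Proof.
by apply: eq_integral => x _; rewrite -(powR_mulrn 2) ?enorm3_ge0.
Qed.

Lemma inX_mass u : inX 0 u -> mass (fun x => (hatnorm u x)%:E).
Proof.
move=> [_]; rewrite Xenorm0E => h; split => //.
  by apply/measurable_EFinP; exact: measurable_hatnorm.
by move=> x; rewrite lee_fin hatnorm_ge0.
Qed.

Lemma inX_cintegrable u k : inX 0 u -> cintegrable mu3 (Fhat (u k)).
Proof.
move=> /inX_mass[_ _ h]; apply: cintegrable_fin; first exact: cmeasurable_Fhat.
apply: le_lt_trans h; apply: ge0_le_lower_integral => x _; rewrite lee_fin ?cabs_ge0//.
exact: (cabs_le_cnorm3 (fun k => Fhat (u k) x)).
Qed.

Lemma inX_has_fourier rho u k : inX rho u -> has_fourier (u k) (Fhat (u k)).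
Proof. by move=> [h _]; have [_ e] := h k; exact: has_fourier_Fhat. Qed.

(** A bounded continuous representative has the same pairings with tensors as the inverse transform
    of [f], hence equals it almost everywhere, and [g] is [f]. With no representative, [fun_of T] is
    0 and so is [g]. *)
Lemma fun_of_multiplier T (f : space R -> R[i]) : cintegrable mu3 f ->
  (forall f1 f2 f3 : R -> R, testfun f1 -> testfun f2 -> testfun f3 ->
    T (ctens f1 f2 f3) = cintegral mu3 setT (fun x => f x * inv_fourier (ctens f1 f2 f3) x)) ->
  exists g, [/\ multiplier (fun_of T) g, cintegrable mu3 g & forall x, cabs (g x) <= cabs (f x)].
Proof.
move=> fi hT; have [->|] := fun_of_cases T.
  exists (fun=> 0); split; [exact: multiplier0|exact: cintegrable0|].
  by move=> x; rewrite cabs0 cabs_ge0.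
set v := fun_of T => -[cr ci bv hv]; exists f; split => //.
have mv : cmeasurable (v : mspace -> R[i]) by split; exact: continuous_measurable3.
have mV := cmeasurable_inv_fourier fi; have [M hM] := inv_fourier_bounded fi.
have vV : {ae mu3, forall x, v x = inv_fourier f x}.
  apply: ae_eq_of_tensors; [exact: lint_bounded|by apply: lint_bounded => //; exists M|].
  move=> f1 f2 f3 t1 t2 t3; rewrite inv_fourier_swap//; last exact: ctens_integrable.
  by rewrite -hT//; apply/esym; apply: hv; exact: schwartz_ctens.
split => // G Gi; have mG := cintegrable_measurable Gi.
rewrite -inv_fourier_swap//; apply: cintegral_ae_eq.
- exact: (cmeasurableM mv mG).
- exact: (cmeasurableM mV mG).
- by apply: ae_mono vV => x ->.
Qed.

(* [w] is a version of the transform of [u] dominated everywhere by [U], which makes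
   pointwise bounds on convolutions insensitive to the choice of [Fhat]. *)
Definition dominated_hat u (w : 'I_3 -> space R -> R[i]) (U : space R -> R) :=
  [/\ forall k, cmeasurable (w k : mspace -> R[i]),
    forall k, {ae mu3, forall x, w k x = Fhat (u k) x},
    mass (fun x => (U x)%:E) & forall x, cnorm3 (fun k => w k x) <= U x].

Lemma dominated_hat_integrable u w U k : dominated_hat u w U -> cintegrable mu3 (w k).
Proof.
move=> [mw _ [_ _ h] wU]; apply: cintegrable_fin; first exact: mw.
apply: le_lt_trans h; apply: ge0_le_lower_integral => x _; rewrite lee_fin ?cabs_ge0//.
exact: le_trans (cabs_le_cnorm3 (fun k => w k x) k) (wU x).
Qed.

(** The transform is set to 0 off the measurable set where [U] equals its modulus: it changes on a
    null set, and the domination holds everywhere. *)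
Lemma dominated_hat_exists u (U : space R -> R) : inX 0 u -> mass (fun x => (U x)%:E) ->
  {ae mu3, forall x, U x = hatnorm u x} -> exists w, dominated_hat u w U.
Proof.
move=> hu [mU U0 Uf] ae.
have mU' : measurable_fun setT (U : mspace -> R) by apply/measurable_EFinP.
have mA : measurable [set x : mspace | U x = hatnorm u x].
  have := @measurable_fun_eqr _ mspace R setT _ _ mU' (measurable_hatnorm u).
  move=> /(_ measurableT [set true] I); rewrite setTI.
  by congr measurable; apply/seteqP; split => x /= /eqP.
set A := (X in measurable X) in mA.
exists (fun k x => (\1_A x)%:C * Fhat (u k) x); split => //.
- move=> k; apply: cmeasurableM; last exact: cmeasurable_Fhat.
  by apply: cmeasurable_real; exact: measurable_indic.
- by move=> k; apply: ae_mono ae => x e; rewrite indicE mem_set// mul1r.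
- move=> x; rewrite indicE; have [xA|xA] := pselect (A x).
    rewrite mem_set// xA /hatnorm le_eqVlt; apply/orP; left; apply/eqP; congr cnorm3.
    by apply/funext => k; rewrite mul1r.
  rewrite memNset// (_ : cnorm3 _ = 0); first by have := U0 x; rewrite lee_fin.
  by rewrite /cnorm3 sum3E !mul0r cabs0 expr0n !addr0 sqrtr0.
Qed.

(** A tensor is the Fourier transform of a Schwartz function, namely of its own inverse transform,
    so the defining property of the transform of [u k] applies to it. *)
Lemma inX_ctens u w U k (f1 f2 f3 : R -> R) : inX 0 u -> dominated_hat u w U ->
  testfun f1 -> testfun f2 -> testfun f3 ->
  u k (ctens f1 f2 f3) = cintegral mu3 setT (fun x => w k x * inv_fourier (ctens f1 f2 f3) x).
Proof.
move=> /(@inX_has_fourier _ _ k)[_ h] [mw aew _ _] t1 t2 t3; rewrite -{1}(fourierK t1 t2 t3) h; last first.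
  exact: schwartz_inv_fourier_ctens t1 t2 t3.
have mI := cmeasurable_inv_fourier (ctens_integrable t1 t2 t3).
apply: cintegral_ae_eq.
- exact: (cmeasurableM (cmeasurable_Fhat _) mI).
- exact: (cmeasurableM (mw k) mI).
- by apply: ae_mono (aew k) => x ->.
Qed.

Lemma inX_multiplier u w U k : inX 0 u -> dominated_hat u w U -> exists g,
  [/\ multiplier (fun_of (u k)) g, cintegrable mu3 g & forall x, cabs (g x) <= cabs (w k x)].
Proof.
move=> hu hw; apply: fun_of_multiplier; first exact: dominated_hat_integrable hw.
by move=> f1 f2 f3 t1 t2 t3; exact: inX_ctens hw _ _ _.
Qed.

Lemma cpderiv_ctens j (f1 f2 f3 g1 g2 g3 : R -> R) :
  (forall z : R, is_derive z 1 f1 (g1 z)) -> (forall z : R, is_derive z 1 f2 (g2 z)) ->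
  (forall z : R, is_derive z 1 f3 (g3 z)) ->
  cpderiv j (ctens f1 f2 f3) = ctens (if j == 0%N :> nat then g1 else f1)
    (if j == 1%N :> nat then g2 else f2) (if j == 2%N :> nat then g3 else f3).
Proof.
move=> d1 d2 d3; apply/funext => x; rewrite /cpderiv /ctens -(derive_tensor j d1 d2 d3).
by apply: complex_ext => //=; exact: (derive_cst (0 : R)).
Qed.

Lemma inv_fourier_cpderiv j (f1 f2 f3 : R -> R) x : testfun f1 -> testfun f2 -> testfun f3 ->
  [/\ exists g1 g2 g3, [/\ testfun g1, testfun g2, testfun g3 &
        cpderiv j (ctens f1 f2 f3) = ctens g1 g2 g3] &
    inv_fourier (cpderiv j (ctens f1 f2 f3)) x = (0 +i* (- coord x j)) * inv_fourier (ctens f1 f2 f3) x].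
Proof.
move=> t1 t2 t3.
have [g1 s1 d1] := testfun_derive t1; have [g2 s2 d2] := testfun_derive t2.
have [g3 s3 d3] := testfun_derive t3.
rewrite (cpderiv_ctens j d1 d2 d3); split.
  by exists (if j == 0%N :> nat then g1 else f1), (if j == 1%N :> nat then g2 else f2),
    (if j == 2%N :> nat then g3 else f3); split => //; case: ifP.
rewrite (inv_fourier_ctens t1 t2 t3) inv_fourier_ctens; [|by case: ifP|by case: ifP|by case: ifP].
rewrite [RHS]mulrCA; congr (_ * _); rewrite /FT3 /tensor.
have E f g (z : R) : testfun f -> testfun g -> (forall z : R, is_derive z 1 f (g z)) ->
    FT1 1 g z = (0 +i* (- z)) * FT1 1 f z.
  by move=> tf tg d; rewrite (FT1_derive z (or_introl erefl) tf tg d) mulN1r.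
case: j => [[|[|[|//]]] ?]; rewrite /coord /=.
- by rewrite (E f1 g1)// !mulrA.
- by rewrite (E f2 g2)//; ring.
- by rewrite (E f3 g3)//; ring.
Qed.

(** The transform of the derivative is $i\xi_j\hat u_k$, which the finite first moment makes
    integrable. *)
Lemma dderiv_multiplier u w U k j : inX 0 u -> dominated_hat u w U ->
  (\int[mu3]_x (enorm3 x * U x)%:E < +oo)%E -> exists g,
  [/\ multiplier (fun_of (dderiv j (u k))) g, cintegrable mu3 g &
    forall x, cabs (g x) <= `|coord x j| * cabs (w k x)].
Proof.
move=> hu hw h1; have [mw _ _ wU] := hw.
pose f (x : space R) := (0 +i* coord x j) * w k x.
have cf x : cabs (f x) = `|coord x j| * cabs (w k x).
  by rewrite cabsM cabsE/= expr0n add0r sqrtr_sqr.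
have mf : cmeasurable (f : mspace -> R[i]).
  apply: cmeasurableM; last exact: mw.
  split; first exact: measurable_cst.
  exact: (measurable_coord j (@measurable_id _ _ _)).
have fi : cintegrable mu3 f.
  apply: cintegrable_fin => //; apply: le_lt_trans h1; apply: ge0_le_lower_integral => x _.
    by rewrite lee_fin cabs_ge0.
  rewrite lee_fin cf ler_pM ?cabs_ge0 ?coord_le_enorm3//.
  exact: le_trans (cabs_le_cnorm3 (fun k => w k x) k) (wU x).
have [|g [g1 g2 g3]] := @fun_of_multiplier (dderiv j (u k)) f fi; last first.
  by exists g; split => // x; rewrite -cf.
move=> f1 f2 f3 t1 t2 t3; rewrite /dderiv.
have [[g1 [g2 [g3 [s1 s2 s3 e]]]] _] := inv_fourier_cpderiv j 0 t1 t2 t3.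
rewrite e (inX_ctens k hu hw s1 s2 s3) -e.
have E x : w k x * inv_fourier (cpderiv j (ctens f1 f2 f3)) x =
    - (f x * inv_fourier (ctens f1 f2 f3) x).
  have [_ ->] := inv_fourier_cpderiv j x t1 t2 t3.
  rewrite /f (_ : 0 +i* (- coord x j) = - (0 +i* coord x j)); last first.
    by apply: complex_ext; rewrite /= ?oppr0.
  by ring.
have fi' : cintegrable mu3 (fun x => f x * inv_fourier (ctens f1 f2 f3) x).
  have [M hM] := inv_fourier_bounded (ctens_integrable t1 t2 t3).
  have := cintegrable_bounded (cmeasurable_inv_fourier (ctens_integrable t1 t2 t3)) hM fi.
  by congr cintegrable; apply/funext => x; rewrite mulrC.
by rewrite (eq_cintegral mu3 E) cintegralN// opprK.
Qed.

End Distributions.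

(** * Bounds for the nonlinear terms and the Leray projector *)

Section NonlinearBounds.
Context {R : realType}.
Local Notation mspace := (measurableTypeR R * measurableTypeR R * measurableTypeR R)%type.
Local Notation mu3 := (@lebesgue3 R).
Local Notation c := (((2 * pi) ^+ 3)^-1 : R).
Implicit Types (u : vdist R) (B F K : mspace -> \bar R) (U : space R -> R).

Lemma regular_hat_bounded w (C : R) K (f1 f2 f3 : R -> R) : hat_bounded w C K -> nonneg_test f1 f2 f3 ->
  ((cabs (regular w (fourier (ctens f1 f2 f3))))%:E <=
   C%:E * \int[mu3]_x (K x * (tensor f1 f2 f3 x)%:E))%E.
Proof.
move=> [_ _ h] nt; have := h _ _ _ (0 : space R) nt.
rewrite (eq_integral (fun x => (K x * (tensor f1 f2 f3 x)%:E)%E)); last first.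
  by move=> x _; rewrite /shifted_test addr0.
have d0 (x : space R) : dot x 0 = 0 by rewrite dotE/= !mulr0 !addr0.
rewrite (@eq_cintegral _ _ _ mu3 _ (fun x => w x * fourier (ctens f1 f2 f3) x)) => [//|x].
by rewrite d0 cis0 mul1r.
Qed.

Lemma Fhat_hat_bounded w (C : R) K : 0 <= C -> mass K -> hat_bounded w C K ->
  {ae mu3, forall x, ((cabs (Fhat (regular w) x))%:E <= (2 * C)%:E * K x)%E}.
Proof.
move=> C0 [mK K0 Kf] h; have hm := massZ C0 (And3 mK K0 Kf).
suff hb (f1 f2 f3 : R -> R) : nonneg_test f1 f2 f3 ->
    ((cabs (regular w (fourier (ctens f1 f2 f3))))%:E <=
     \int[mu3]_x (C%:E * K x * (tensor f1 f2 f3 x)%:E))%E.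
  by have := Fhat_bound hm hb; apply: ae_mono => x; rewrite muleA -EFinM.
move=> nt; apply: le_trans (regular_hat_bounded h nt) _.
have [[t1 t2 t3] [p1 p2 p3]] := nt.
rewrite -ge0_integralZl_EFin//.
- by rewrite le_eqVlt; apply/orP; left; apply/eqP; apply: eq_integral => x _; rewrite muleA.
- by move=> x _; rewrite mule_ge0// lee_fin /tensor !mulr_ge0.
- apply: emeasurable_funM => //; apply/measurable_EFinP.
  by apply: measurable_tensor; apply: continuous_measurable_fun; exact: testfun_continuous.
Qed.

Lemma measurable_conv_integrand F K (x : mspace) : measurable_fun setT F -> measurable_fun setT K ->
  measurable_fun setT (fun y : mspace => (F y * K ((x : space R) - (y : space R))%R)%E).
Proof.
move=> mF mK; apply: emeasurable_funM => //.
exact: (measurableT_comp (measurable_sub_pair mK) (pair1_measurable _)).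
Qed.

Definition weighted U (x : mspace) : \bar R := (enorm3 x * U x)%:E.

Lemma measurable_weighted U : mass (fun x => (U x)%:E) -> measurable_fun setT (weighted U).
Proof.
move=> [/measurable_EFinP mU _ _]; apply/measurable_EFinP; apply: measurable_funM => //.
exact: (measurable_enorm3 (@measurable_id _ _ _)).
Qed.

Lemma weighted_ge0 U : mass (fun x => (U x)%:E) -> forall x, (0 <= weighted U x)%E.
Proof. by move=> [_ U0 _] x; rewrite lee_fin mulr_ge0 ?enorm3_ge0// -lee_fin. Qed.

Lemma mass_weighted U : mass (fun x => (U x)%:E) -> (\int[mu3]_x weighted U x < +oo)%E ->
  mass (weighted U).
Proof. by move=> hU h; split => //; [exact: measurable_weighted|exact: weighted_ge0]. Qed.

(** The three terms $u_j\partial_ju_k$ are first bounded by convolutions of $|w_j|$ with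
    $|\xi_j||w_k|$. Cauchy-Schwarz in $j$ is applied to their sum under the integral sign, so that
    no factor 3 is lost. *)
Lemma convection_bound u w U k : inX 0 u -> dominated_hat u w U ->
  (\int[mu3]_x weighted U x < +oo)%E ->
  {ae mu3, forall x, ((cabs (Fhat (convection u k) x))%:E <=
    (2 * c)%:E * conv (fun x => (U x)%:E) (weighted U) x)%E}.
Proof.
move=> hu hw h1; have [mw _ hU wU] := hw; have mW := mass_weighted hU h1.
have [mU U0 _] := hU; have [mE E0 _] := mW.
apply: Fhat_hat_bounded; [exact/ltW/c_gt0|exact: mass_conv|].
pose a j (x : mspace) := (cabs (w j x))%:E.
pose b j (x : mspace) := (`|coord x j| * cabs (w k x))%:E.
have ma j : measurable_fun setT (a j).
  by apply/measurable_EFinP; apply: measurable_cabs; exact: mw.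
have mb j : measurable_fun setT (b j).
  apply/measurable_EFinP; apply: measurable_funM; last by apply: measurable_cabs; exact: mw.
  apply: measurableT_comp => //; exact: (measurable_coord j (@measurable_id _ _ _)).
have a0 j x : (0 <= a j x)%E by rewrite lee_fin cabs_ge0.
have b0 j x : (0 <= b j x)%E by rewrite lee_fin mulr_ge0 ?cabs_ge0.
have hb j : hat_bounded (fun x => fun_of (u j) x * fun_of (dderiv j (u k)) x) c (conv (a j) (b j)).
  have [f [fm fi fle]] := inX_multiplier j hu hw.
  have [g [gm gi gle]] := dderiv_multiplier k j hu hw h1.
  rewrite -[c]mulr1; apply: (hat_bounded_mul fm fi _ (ma j)) => //.
  by apply: (hat_bounded_multiplier gm gi) => x; rewrite lee_fin.
have c0 : 0 <= c by exact/ltW/c_gt0.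
have mc j : measurable_fun setT (conv (a j) (b j)) by exact: measurable_conv.
have cc0 j x : (0 <= conv (a j) (b j) x)%E by exact: conv_ge0.
have hs := hat_boundedD c0 (emeasurable_funD (mc 0) (mc 1)) (mc 2%:R)
  (fun x => adde_ge0 (cc0 0 x) (cc0 1 x)) (cc0 2%:R)
  (hat_boundedD c0 (mc 0) (mc 1) (cc0 0) (cc0 1) (hb 0) (hb 1)) (hb 2%:R).
rewrite (_ : (fun x => \sum_(j < 3) _) = (fun x => fun_of (u 0) x * fun_of (dderiv 0 (u k)) x +
   fun_of (u 1) x * fun_of (dderiv 1 (u k)) x +
   fun_of (u 2%:R) x * fun_of (dderiv 2%:R (u k)) x)); last first.
  by apply/funext => x; rewrite sum3E.
apply: (hat_bounded_le c0 _ _ hs) => x; first by apply: adde_ge0 => //; exact: adde_ge0.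
rewrite /conv.
have mi j := measurable_conv_integrand x (ma j) (mb j).
rewrite -ge0_integralD//; [|by move=> y _; rewrite mule_ge0|by move=> y _; rewrite mule_ge0].
rewrite -ge0_integralD//; [|by move=> y _; rewrite adde_ge0 ?mule_ge0|exact: emeasurable_funD
  |by move=> y _; rewrite mule_ge0].
apply: ge0_le_lower_integral => y _; first by rewrite !adde_ge0 ?mule_ge0.
rewrite /a /b /weighted -!EFinM -!EFinD lee_fin; set z : space R := _ - _.
have -> : cabs (w 0 y) * (`|coord z 0| * cabs (w k z)) +
    cabs (w 1 y) * (`|coord z 1| * cabs (w k z)) +
    cabs (w 2%:R y) * (`|coord z 2%:R| * cabs (w k z)) =
    (\sum_(j < 3) cabs (w j y) * `|coord z j|) * cabs (w k z) by rewrite sum3E; ring.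
rewrite mulrA; apply: ler_pM.
- by apply: sumr_ge0 => j _; rewrite mulr_ge0 ?cabs_ge0.
- exact: cabs_ge0.
- apply: le_trans (cauchy_schwarz3 (fun j => cabs (w j y)) (fun j => `|coord z j|)) _.
  rewrite enorm3E; under [X in Num.sqrt _ * Num.sqrt X]eq_bigr do rewrite real_normK ?num_real//.
  by rewrite ler_wpM2r ?sqrtr_ge0//; exact: wU.
- exact: le_trans (cabs_le_cnorm3 (fun k => w k z) k) (wU z).
Qed.

Lemma power_bound u w U n j k : inX 0 u -> dominated_hat u w U ->
  {ae mu3, forall x, ((cabs (Fhat (power_term n.+1 j u k) x))%:E <=
    (2 * c ^+ n)%:E * conv_pow (fun x => (U x)%:E) n x)%E}.
Proof.
move=> hu hw; have [mw _ hU wU] := hw; have [mU U0 Uf] := hU.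
have c0 : 0 <= c ^+ n by apply: exprn_ge0; exact/ltW/c_gt0.
have hm : mass (conv_pow (fun x => (U x)%:E) n).
  elim: n {c0} => [|n IH] //=; exact: mass_conv.
have [f [fm fi fle]] := inX_multiplier j hu hw.
have hb : hat_bounded (fun x => fun_of (u j) x ^+ n.+1) (c ^+ n) (conv_pow (fun x => (U x)%:E) n).
  apply: (hat_bounded_pow n fm fi) => // x; rewrite lee_fin; apply: le_trans (fle x) _.
  exact: le_trans (cabs_le_cnorm3 (fun k => w k x) j) (wU x).
rewrite /power_term; case: ifP => _; first exact: Fhat_hat_bounded.
have [m1 m2 m3] := hm.
(* In the other components the term is the zero distribution, and testing it with the zero bound
   shows that its transform vanishes almost everywhere. *)
have : {ae mu3, forall x, ((cabs (Fhat ((fun=> 0) : dist R) x))%:E <= 2%:E * (cst 0%E x))%E}.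
  apply: Fhat_bound; first exact: mass0.
  move=> f1 f2 f3 _; rewrite cabs0; apply: integral_ge0 => x _; by rewrite mul0e.
by apply: ae_mono => x /le_trans; apply; rewrite mule0 mule_ge0 ?lee_fin ?mulr_ge0.
Qed.

(** The constant is $1+3$: the identity contributes [B], and the gradient part is at most
    $\sum_j|\xi_j||\hat G_j||\xi_k|/|\xi|^2\le 3B$. *)
Lemma leray_bound (G : vdist R) B k : mass B ->
  (forall j, {ae mu3, forall x, ((cabs (Fhat (G j) x))%:E <= B x)%E}) ->
  cintegrable mu3 (Fhat (leray G k)) /\
  {ae mu3, forall x, ((cabs (Fhat (leray G k) x))%:E <= 4%:E * B x)%E}.
Proof.
move=> [mB B0 Bf] hG.
have mG j : cmeasurable (Fhat (G j) : mspace -> R[i]) by exact: cmeasurable_Fhat.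
have mcoord j : measurable_fun setT (fun x : mspace => coord x j).
  exact: (measurable_coord j (@measurable_id _ _ _)).
pose h (xi : space R) := Fhat (G k) xi -
    (\sum_(j < 3) (coord xi j)%:C * Fhat (G j) xi) / (enorm3 xi ^+ 2)%:C * (coord xi k)%:C.
have mh : cmeasurable (h : mspace -> R[i]).
  apply: cmeasurableD => //; apply: cmeasurableN; apply: cmeasurableM; last exact: cmeasurable_real.
  apply: cmeasurableM.
    by apply: cmeasurable_sum => j; apply: cmeasurableM => //; exact: cmeasurable_real.
  have e : (fun x : mspace => (enorm3 x ^+ 2)%:C^-1) = (fun x => ((enorm3 x ^+ 2) `^ (-1))%:C).
    by apply/funext => x; rewrite powR_inv1 ?sqr_ge0// fmorphV.
  rewrite e; apply: cmeasurable_real; apply: (measurableT_comp (measurable_powR (-1))).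
  by apply: measurable_funX; exact: (measurable_enorm3 (@measurable_id _ _ _)).
have hle : {ae mu3, forall x, ((cabs (h x))%:E <= 4%:E * B x)%E}.
  have := @ae_forall_countable _ _ _ mu3 'I_3 (fun j x => ((cabs (Fhat (G j) x))%:E <= B x)%E) hG.
  apply: ae_mono => x hx.
  have [Bx|Bx] := eqVneq (B x) +oo%E; first by rewrite Bx mulry gtr0_sg// mul1e leey.
  have Bfin : B x \is a fin_num by rewrite ge0_fin_numE// lt_neqAle Bx leey.
  rewrite -(fineK Bfin) -EFinM lee_fin; set b := fine (B x).
  have hb j : cabs (Fhat (G j) x) <= b by rewrite -lee_fin fineK.
  have b0 : 0 <= b by apply: le_trans (hb 0); exact: cabs_ge0.
  rewrite (_ : 4 * b = b + 3 * b); last by ring.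
  apply: le_trans (cabsD _ _) _; rewrite cabsN lerD// mulrAC -mulrA cabsM.
  have -> : (coord x k)%:C / (enorm3 x ^+ 2)%:C = (coord x k / enorm3 x ^+ 2)%:C :> R[i].
    by rewrite -fmorphV -rmorphM.
  rewrite cabsC normrM normfV (ger0_norm (sqr_ge0 _)).
  have hs : cabs (\sum_(j < 3) (coord x j)%:C * Fhat (G j) x) <= 3 * (enorm3 x * b).
    apply: le_trans (cabs_sum _ _) _; rewrite sum3E !cabsM !cabsC.
    have q j : `|coord x j| * cabs (Fhat (G j) x) <= enorm3 x * b.
      by apply: ler_pM; rewrite ?cabs_ge0 ?coord_le_enorm3.
    by have := q 0; have := q 1; have := q 2%:R; lra.
  (* At frequency 0 the quotient is 0 by the convention on division, and the bound still holds. *)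
  have [e0|e0] := eqVneq (enorm3 x) 0.
    by rewrite e0 expr0n invr0 !mulr0 mulr_ge0.
  have ep : 0 < enorm3 x by rewrite lt_neqAle eq_sym e0 enorm3_ge0.
  have -> : 3 * b = 3 * (enorm3 x * b) * (enorm3 x / enorm3 x ^+ 2) by field.
  apply: ler_pM; rewrite ?cabs_ge0 ?mulr_ge0 ?invr_ge0 ?sqr_ge0//.
  by rewrite ler_wpM2r ?invr_ge0 ?sqr_ge0 ?coord_le_enorm3.
have hf : (\int[mu3]_x (cabs (h x))%:E < +oo)%E.
  have : (\int[mu3]_x (4%:E * B x) < +oo)%E by have [] := massZ (ler0n R 4) (And3 mB B0 Bf).
  apply: le_lt_trans; apply: ae_ge0_le_integral => //.
  - by move=> x _; rewrite lee_fin cabs_ge0.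
  - by apply/measurable_EFinP; exact: measurable_cabs.
  - by move=> x _; rewrite mule_ge0.
  - exact: measurable_funeM.
  - by apply: ae_mono hle.
have hi := cintegrable_fin mh hf.
have F1 := Fhat_Finv hi.
have hle' : {ae mu3, forall x, ((cabs (Fhat (leray G k) x))%:E <= 4%:E * B x)%E}.
  by apply: ae_mono2 hle F1 => x p q; apply: le_trans p; rewrite lee_fin.
split => //.
apply: cintegrable_fin; first exact: cmeasurable_Fhat.
apply: le_lt_trans hf; apply: ae_ge0_le_integral => //.
- by move=> x _; rewrite lee_fin cabs_ge0.
- by apply/measurable_EFinP; apply: measurable_cabs; exact: cmeasurable_Fhat.
- by move=> x _; rewrite lee_fin cabs_ge0.
- by apply/measurable_EFinP; exact: measurable_cabs.
- by apply: ae_mono F1 => x q _; rewrite lee_fin.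
Qed.

Lemma heat_leray_bound (s : R) (G : vdist R) B k (f1 f2 f3 : R -> R) : 0 <= s -> mass B ->
  (forall j, {ae mu3, forall x, ((cabs (Fhat (G j) x))%:E <= B x)%E}) ->
  nonneg_test f1 f2 f3 ->
  ((cabs (heat s (leray G k) (fourier (ctens f1 f2 f3))))%:E <=
   \int[mu3]_x (4%:E * B x * (expR (- s * enorm3 x ^+ 2) * tensor f1 f2 f3 x)%:E))%E.
Proof.
move=> s0 hB hG [[t1 t2 t3] [p1 p2 p3]]; have [mB B0 _] := hB.
have [hi hle] := leray_bound k hB hG.
rewrite heat_ctens//.
have T0 x : 0 <= tensor f1 f2 f3 x by rewrite /tensor !mulr_ge0.
have mt : measurable_fun setT (tensor f1 f2 f3 : mspace -> R).
  by apply: measurable_tensor; apply: continuous_measurable_fun; exact: testfun_continuous.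
have me : measurable_fun setT (fun x : mspace => expR (- s * enorm3 x ^+ 2)).
  apply: (measurableT_comp (@measurable_expR R)); apply: measurable_funM => //.
  by apply: measurable_funX; exact: (measurable_enorm3 (@measurable_id _ _ _)).
have hi' : cintegrable mu3 (fun x => (expR (- s * enorm3 x ^+ 2))%:C * Fhat (leray G k) x * ctens f1 f2 f3 x).
  have l : lint (fun x => (expR (- s * enorm3 x ^+ 2))%:C * Fhat (leray G k) x).
    apply: lint_cintegrable; apply: (cintegrable_bounded (M := 1) _ _ hi).
      exact: cmeasurable_real.
    move=> x; rewrite cabsC ger0_norm ?expR_ge0// -expR0 ler_expR mulNr oppr_le0.
    by rewrite mulr_ge0 ?sqr_ge0.
  exact: lint_integrable.
apply: le_trans (cabs_cintegral_EFin hi') _.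
apply: ae_ge0_le_integral => //.
- by move=> x _; rewrite lee_fin cabs_ge0.
- apply/measurable_EFinP; apply: measurable_cabs; exact: cintegrable_measurable hi'.
- by move=> x _; rewrite !mule_ge0// lee_fin mulr_ge0 ?expR_ge0.
- apply: emeasurable_funM; first exact: measurable_funeM.
  by apply/measurable_EFinP; exact: measurable_funM.
apply: ae_mono hle => x hx _; rewrite /ctens !cabsM !cabsC (ger0_norm (expR_ge0 _)) (ger0_norm (T0 x)).
rewrite (_ : expR _ * _ * _ = cabs (Fhat (leray G k) x) * (expR (- s * enorm3 x ^+ 2) * tensor f1 f2 f3 x)); last by ring.
by rewrite EFinM lee_wpmul2r// lee_fin mulr_ge0 ?expR_ge0.
Qed.

End NonlinearBounds.

(** * Continuity in time of the modulus of the transform *)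

Section HatDistance.
Context {R : realType}.
Local Notation mspace := (measurableTypeR R * measurableTypeR R * measurableTypeR R)%type.
Local Notation mu3 := (@lebesgue3 R).
Implicit Types (u v w : vdist R) (f : space R -> R).

Lemma schwartzR_continuous f : schwartzR f -> continuous f.
Proof. by move=> [h _] x; apply: differentiable_continuous; exact: (h [::] x). Qed.

Lemma schwartzR_bounded f : schwartzR f -> exists M, forall x, `|f x| <= M.
Proof.
by move=> [_ /(_ 0%N [::])[M hM]]; exists M => x; have := hM x; rewrite expr0 mul1r.
Qed.

Lemma cintegrable_schwartz g phi : schwartz phi -> cintegrable mu3 g ->
  cintegrable mu3 (fun x => g x * phi x).
Proof.
move=> [h1 h2] gi; have [M hM] := schwartzR_bounded h1; have [N hN] := schwartzR_bounded h2.
have mphi : cmeasurable (phi : mspace -> R[i]).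
  by split; apply: continuous_measurable3; exact: schwartzR_continuous.
have := cintegrable_bounded mphi (M := M + N) _ gi.
under eq_fun do rewrite mulrC; apply => x.
by apply: le_trans (cabs_le _) _; exact: lerD.
Qed.

Lemma Fhat_vsub u v k : inX 0 u -> inX 0 v ->
  {ae mu3, forall x, Fhat (vsub u v k) x = Fhat (u k) x - Fhat (v k) x}.
Proof.
move=> hu hv; apply: Fhat_unique.
have [lu eu] := inX_has_fourier k hu; have [lv ev] := inX_has_fourier k hv.
have iu := inX_cintegrable k hu; have iv := inX_cintegrable k hv.
split; first exact: locally_integrableB.
move=> phi sp; rewrite /vsub eu// ev// /regular.
have iup := cintegrable_schwartz sp iu; have ivp := cintegrable_schwartz sp iv.
rewrite [RHS](@eq_cintegral _ _ _ mu3 _ (fun x => Fhat (u k) x * phi x + - (Fhat (v k) x * phi x))).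
  by rewrite (cintegralD iup (cintegrableN ivp)) (cintegralN ivp).
by move=> x; rewrite mulrBl.
Qed.

Lemma integrable_hatnorm u : inX 0 u -> mu3.-integrable setT (EFin \o hatnorm u).
Proof.
move=> /inX_mass[mu mu0 h]; apply/integrableP; split => //.
by rewrite (eq_integral (fun x => (hatnorm u x)%:E)) => [//|x _]; apply: gee0_abs; exact: mu0.
Qed.

Lemma Xnorm0E u : Xnorm 0 u = \int[mu3]_x hatnorm u x.
Proof. by rewrite /Xnorm Xenorm0E. Qed.

(** Weaker than the distance of $\mathcal X^0$, but the moduli are all that the estimates use, and
    the triangle inequality is that of $L^1$, with no transform of a difference to compute. *)
Definition hatdist u v := \int[mu3]_x `|hatnorm u x - hatnorm v x|.

Lemma integrable_hatdist u v : inX 0 u -> inX 0 v ->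
  mu3.-integrable setT (EFin \o (fun x => `|hatnorm u x - hatnorm v x|)).
Proof.
move=> /integrable_hatnorm hu /integrable_hatnorm hv.
by have := integrable_abse (integrableB (@measurableT _ _) hu hv).
Qed.

Lemma hatdistC u v : hatdist u v = hatdist v u.
Proof. by apply: eq_Rintegral => x _; rewrite distrC. Qed.

Lemma hatdist_triangle v u w : inX 0 u -> inX 0 v -> inX 0 w ->
  hatdist u w <= hatdist u v + hatdist v w.
Proof.
move=> hu hv hw; rewrite /hatdist -RintegralD//; [|exact: integrable_hatdist..].
apply: le_Rintegral => //; [exact: integrable_hatdist| |].
  exact: (integrableD (@measurableT _ _) (integrable_hatdist hu hv) (integrable_hatdist hv hw)).
by move=> x _; rewrite -[X in `|X|](subrKA (hatnorm v x)) ler_normD.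
Qed.

Lemma hatdist_vsub u v : inX 0 u -> inX 0 v -> hatdist u v <= Xnorm 0 (vsub u v).
Proof.
move=> hu hv.
have ae : {ae mu3, forall x, `|hatnorm u x - hatnorm v x| <= hatnorm (vsub u v) x}.
  have := @ae_forall_countable _ _ _ mu3 'I_3
    (fun k x => Fhat (vsub u v k) x = Fhat (u k) x - Fhat (v k) x) (fun k => Fhat_vsub k hu hv).
  apply: ae_mono => x hx; apply: le_trans (cnorm3_dist _ _) _.
  by rewrite le_eqVlt; apply/orP; left; apply/eqP; congr cnorm3; apply/funext => k; rewrite -hx.
(* [Xnorm] is the [fine] of an integral, and [fine] would turn an infinite value into 0; finiteness
   has to come before the comparison. *)
have fin : (\int[mu3]_x (hatnorm (vsub u v) x)%:E < +oo)%E.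
  have : (\int[mu3]_x (hatnorm u x + hatnorm v x)%:E < +oo)%E.
    have [_ _] := massD (inX_mass hu) (inX_mass hv).
    by under eq_integral do rewrite -EFinD.
  apply: le_lt_trans; apply: ae_ge0_le_integral => //.
  - by move=> x _; rewrite lee_fin hatnorm_ge0.
  - by apply/measurable_EFinP; exact: measurable_hatnorm.
  - by move=> x _; rewrite lee_fin addr_ge0 ?hatnorm_ge0.
  - by apply/measurable_EFinP; apply: measurable_funD; exact: measurable_hatnorm.
  have := @ae_forall_countable _ _ _ mu3 'I_3
    (fun k x => Fhat (vsub u v k) x = Fhat (u k) x - Fhat (v k) x) (fun k => Fhat_vsub k hu hv).
  apply: ae_mono => x hx _; rewrite lee_fin.
  have := cnorm3D (fun k => Fhat (u k) x) (fun k => - Fhat (v k) x).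
  rewrite [X in _ + X](_ : _ = hatnorm v x); last first.
    by congr Num.sqrt; apply: eq_bigr => k _; rewrite cabsN.
  apply: le_trans; rewrite le_eqVlt; apply/orP; left; apply/eqP; congr cnorm3.
  by apply/funext => k; rewrite hx.
have i0 : (0 <= \int[mu3]_x (hatnorm (vsub u v) x)%:E)%E.
  by apply: integral_ge0 => x _; rewrite lee_fin hatnorm_ge0.
have ifin : (\int[mu3]_x (hatnorm (vsub u v) x)%:E)%E \is a fin_num by rewrite ge0_fin_numE.
rewrite /Xnorm Xenorm0E -lee_fin (fineK ifin) Rintegral_EFin//; last exact: integrable_hatdist.
apply: ae_ge0_le_integral => //.
- by have /measurable_int := integrable_hatdist hu hv.
- by move=> x _; rewrite lee_fin hatnorm_ge0.
- by apply/measurable_EFinP; exact: measurable_hatnorm.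
- by apply: ae_mono ae => x h _; rewrite lee_fin.
Qed.

Lemma Xnorm_dist u v : inX 0 u -> inX 0 v -> `|Xnorm 0 u - Xnorm 0 v| <= hatdist u v.
Proof.
move=> hu hv; have iu := integrable_hatnorm hu; have iv := integrable_hatnorm hv.
rewrite !Xnorm0E -RintegralB//; apply: le_trans (le_normr_Rintegral _ _) _ => //.
exact: (integrableB (@measurableT _ _) iu iv).
Qed.

Lemma C_X_hatdist (I : set R) (u : R -> vdist R) t (e : R) : C_X 0 I u -> I t -> 0 < e ->
  exists2 r : R, 0 < r & forall s, I s -> `|s - t| < r -> hatdist (u s) (u t) < e.
Proof.
move=> [hI hC] It e0; have /cvgrPdist_lt/(_ _ e0) := hC t It.
rewrite /prop_near1 withinE => -[V].
move=> /nbhs_ballP[r /= r0 hr] hV; exists r => // s Is st.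
have : (I `&` V) s by split => //; apply: hr; rewrite /ball/= distrC.
rewrite setIC -hV => -[/= h _].
apply: le_lt_trans (hatdist_vsub (hI _ Is) (hI _ It)) _.
by move: h; rewrite sub0r normrN; exact: le_lt_trans (ler_norm _).
Qed.

Lemma C_X_Xnorm_continuous (I : set R) (u : R -> vdist R) : C_X 0 I u ->
  {within I, continuous (fun t => Xnorm 0 (u t))}.
Proof.
move=> hC; apply/subspace_continuousP => t It; apply/cvgrPdist_lt => e e0.
have [r r0 hr] := C_X_hatdist hC It e0; have [hI _] := hC.
rewrite near_withinE; exists r => //= s st Is.
apply: le_lt_trans (Xnorm_dist (hI _ It) (hI _ Is)) _.
by rewrite hatdistC; apply: hr => //; rewrite distrC.
Qed.

(** Heine's theorem, by compactness of [[0, T]]. The admissible step is an inverse integer so that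
    it can serve as the mesh of a grid. *)
Lemma C_X_uniform (T : R) (u : R -> vdist R) (e : R) : C_X 0 `[0, T] u -> 0 < e ->
  exists n : nat, forall s t, `[0, T]%classic s -> `[0, T]%classic t ->
    `|s - t| <= n.+1%:R^-1 -> hatdist (u s) (u t) <= e.
Proof.
move=> hC e0; have [hI _] := hC.
pose P (n : nat) (t : R) := forall s, `[0, T]%classic s -> `[0, T]%classic t ->
  `|s - t| <= n.+1%:R^-1 -> hatdist (u s) (u t) <= e.
have /compact_near_coveringP/(_ nat \oo P _) := @segment_compact R 0 T.
case=> [x xI|n _ /(_ n (leqnn n)) h]; last by exists n => s t sI tI; exact: (h t tI s sI tI).
have e2 : 0 < e / 2 by rewrite divr_gt0.
have [r r0 hr] := C_X_hatdist hC xI e2.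
have r2 : 0 < r / 2 by rewrite divr_gt0.
have [N _ hN] := near_infty_natSinv_lt (PosNum r2).
exists (ball x (r / 2), [set n | (N <= n)%N]); first by split; [exact: nbhsx_ballx|exists N].
move=> [t n] /= [xt Nn] s sI tI st.
have st2 : `|s - t| < r / 2 by exact: le_lt_trans st (hN _ Nn).
have hx : hatdist (u t) (u x) < e / 2.
  apply: hr => //; rewrite distrC; apply: lt_trans xt _; lra.
have hs : hatdist (u s) (u x) < e / 2.
  apply: hr => //; rewrite -(subrKA t); apply: le_lt_trans (ler_normD _ _) _.
  rewrite [r]splitr ltrD// distrC; exact: xt.
apply: le_trans (hatdist_triangle (hI _ sI) (hI _ xI) (hI _ tI)) _.
by rewrite (hatdistC (u x)) [leRHS]splitr; apply: lerD; exact: ltW.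
Qed.

End HatDistance.

(** * A version of the modulus that is measurable in time and frequency *)

Section JointVersion.
Context {R : realType}.
Local Notation mspace := (measurableTypeR R * measurableTypeR R * measurableTypeR R)%type.
Local Notation mu3 := (@lebesgue3 R).
Implicit Types (u : R -> vdist R).

Lemma measurable_countable_choice (G : nat -> mspace -> R) (N : R -> nat) :
  (forall i, measurable_fun setT (G i)) ->
  (forall i, measurable [set t : measurableTypeR R | N t = i]) ->
  measurable_fun setT (fun z : measurableTypeR R * mspace => G (N z.1) z.2).
Proof.
move=> mG mN _ B mB; rewrite setTI.
rewrite (_ : _ @^-1` B = \bigcup_i ([set t : measurableTypeR R | N t = i] `*` (G i @^-1` B))).
  apply: bigcup_measurable => i _; apply: measurableX => //.
  by have := mG i measurableT B mB; rewrite setTI.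
by apply/seteqP; split => [z Bz|z [i _ [/= <-]]//]; exists (N z.1).
Qed.

(** Rounding down keeps the grid point below [t], hence inside [[0, T]]. *)
Definition grid (n : nat) (t : R) : nat := Num.truncn (t * n.+1%:R).

Lemma measurable_grid n i : measurable [set t : measurableTypeR R | grid n t = i].
Proof.
have m : measurable_fun setT (fun t : R => (grid n t)%:R : R).
  apply: nondecreasing_measurable => // s t st.
  by rewrite ler_nat; apply: le_truncn; rewrite ler_wpM2r.
have := m measurableT [set i%:R] (measurable_set1 _); rewrite setTI.
congr measurable; apply/seteqP; split => t /= => [/eqP|->//].
by rewrite eqr_nat => /eqP.
Qed.

Lemma grid_near n (t : R) : 0 <= t ->
  0 <= (grid n t)%:R / n.+1%:R :> R /\ (grid n t)%:R / n.+1%:R <= t /\ `|(grid n t)%:R / n.+1%:R - t| <= n.+1%:R^-1.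
Proof.
move=> t0; have n0 : 0 < n.+1%:R :> R by rewrite ltr0n.
have /andP[h1 h2] := truncn_itv (mulr_ge0 t0 (ltW n0)).
have g0 : 0 <= (grid n t)%:R / n.+1%:R :> R by rewrite divr_ge0.
have g1 : (grid n t)%:R / n.+1%:R <= t by rewrite ler_pdivrMr.
split=> //; split=> //.
rewrite ler0_norm ?subr_le0// opprB lerBlDr -[X in X + _]mul1r -mulrDl ler_pdivlMr//.
by rewrite addrC natr1; exact: ltW.
Qed.

(** The series of the errors $|f_n-g|$ has a finite integral, so it converges almost everywhere and
    its terms tend to 0. *)
Lemma ae_cvg_of_summable (f : nat -> mspace -> R) (g : mspace -> R) :
  (forall n, measurable_fun setT (f n)) -> measurable_fun setT g ->
  (forall n, (\int[mu3]_x (`|f n x - g x|)%:E <= (1 / (2 ^ n.+1)%:R)%:E)%E) ->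
  {ae mu3, forall x, f n x @[n --> \oo] --> g x}.
Proof.
move=> mf mg h.
pose S x := (\sum_(0 <= n <oo) (`|f n x - g x|)%:E)%E.
have m1 n : measurable_fun setT (fun x => (`|f n x - g x|)%:E).
  apply/measurable_EFinP; apply: measurableT_comp => //; exact: measurable_funB.
have p0 n x : (0 <= (`|f n x - g x|)%:E)%E by rewrite lee_fin.
have mS : measurable_fun setT S by apply: ge0_emeasurable_sum.
have S0 x : (0 <= S x)%E by apply: nneseries_ge0.
have Sf : (\int[mu3]_x S x < +oo)%E.
  rewrite integral_nneseries//; apply: le_lt_trans (ltry 1).
  apply: le_trans (@epsilon_trick0 R 1 xpredT ler01); apply: lee_nneseries => // n _ _; exact: integral_ge0.
have iS : mu3.-integrable setT S.
  by apply/integrableP; split => //; under eq_integral do rewrite gee0_abs//.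
have := integrable_ae (@measurableT _ _) iS; apply: ae_mono => x /(_ I) Sx.
have St : (S x < +oo)%E by rewrite -ge0_fin_numE.
have := @nneseries_tail_cvg R (fun n => (`|f n x - g x|)%:E) xpredT St (fun k _ => p0 k x) => tl.
apply/subr_cvg0/norm_cvg0P.
suff : (`|f n x - g x|)%:E @[n --> \oo] --> (0:R)%:E by move/fine_cvgP => [].
apply: (@squeeze_cvge _ _ _ _ (cst 0%E) _ _ _ _ (cvg_cst _) tl); apply: nearW => n /=.
rewrite p0/= (@nneseries_split_cond _ _ _ 1) ?addn1// big_nat1 leeDl//.
by apply: nneseries_ge0 => k _ _; exact: p0.
Qed.

(** Freezing time at grid points gives functions that use countably many transforms and are
    therefore jointly measurable. The meshes are chosen by uniform continuity so that the $L^1$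
    errors are at most $2^{-k-1}$ at each time; the upper limit then agrees with the modulus at
    every time of [[0, T]], for almost every frequency. *)
Lemma joint_version (T : R) u : C_X 0 `[0, T] u -> exists U : measurableTypeR R * mspace -> R,
  [/\ measurable_fun setT U, forall z, 0 <= U z &
    forall t, `[0, T]%classic t -> {ae mu3, forall x, U (t, x) = hatnorm (u t) x}].
Proof.
move=> hC; have [hI _] := hC.
have e0 k : 0 < 1 / (2 ^ k.+1)%:R :> R by rewrite divr_gt0// ltr0n expn_gt0.
have [N hN] := choice (fun k => C_X_uniform hC (e0 k)).
pose p k t := (grid (N k) t)%:R / (N k).+1%:R : R.
pose f k (z : measurableTypeR R * mspace) := hatnorm (u (p k z.1)) z.2.
have mf k : measurable_fun setT (f k).
  apply: (@measurable_countable_choice (fun i => hatnorm (u (i%:R / (N k).+1%:R))) (grid (N k))).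
    by move=> i; exact: measurable_hatnorm.
  exact: measurable_grid.
(* Without convergence the upper limit may be infinite; [fine] and the absolute value keep [U] real
   and nonnegative everywhere. *)
exists (fun z => `|fine (limn_esup (fun k => (f k z)%:E))|); split => //.
  apply: measurableT_comp => //.
  apply: (measurableT_comp (fine_measurable measurableT)); apply: measurable_fun_limn_esup => k.
  exact/measurable_EFinP.
move=> t tI; have t0 : 0 <= t by move: tI; rewrite /= in_itv/= => /andP[].
have tT : t <= T by move: tI; rewrite /= in_itv/= => /andP[].
have pI k : `[0, T]%classic (p k t).
  have [h1 [h2 _]] := grid_near (N k) t0.
  by rewrite /= in_itv/= h1 (le_trans h2).
have := @ae_cvg_of_summable (fun k x => f k (t, x)) (hatnorm (u t)) (fun k => measurable_hatnorm (u (p k t)))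
  (measurable_hatnorm (u t)).
have hs k : (\int[mu3]_x (`|f k (t, x) - hatnorm (u t) x|)%:E <= (1 / (2 ^ k.+1)%:R)%:E)%E.
  have [_ [_ h]] := grid_near (N k) t0.
  rewrite -Rintegral_EFin//; last exact: integrable_hatdist (hI _ (pI k)) (hI _ tI).
  rewrite lee_fin; exact: (hN k (p k t) t (pI k) tI h).
move=> /(_ hs); apply: ae_mono => x hx.
have hE : (f k (t, x))%:E @[k --> \oo] --> (hatnorm (u t) x)%:E by apply: cvg_EFin => //; exact: nearW.
rewrite (is_cvg_limn_esupE (cvgP _ hE)) (cvg_lim _ hE)//= ger0_norm//; exact: hatnorm_ge0.
Qed.

Lemma mass_version (U : mspace -> R) (v : vdist R) : inX 0 v -> measurable_fun setT U ->
  (forall x, 0 <= U x) -> {ae mu3, forall x, U x = hatnorm v x} -> mass (fun x => (U x)%:E).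
Proof.
move=> /inX_mass[mv _ v1] mU U0 ae; have mU' : measurable_fun setT (EFin \o U) by exact/measurable_EFinP.
split => //; rewrite (ge0_ae_eq_integral _ mU' mv)//.
- by move=> x _; rewrite lee_fin.
- by move=> x _; rewrite lee_fin hatnorm_ge0.
- by apply: ae_mono ae => x /= -> _.
Qed.

End JointVersion.

(** * The heat factor in time and its dissipation *)

Section TimeKernel.
Context {R : realType}.
Local Notation mu := (@lebesgue_measure R).

(* [ker s tau a] is [exp(- (s - tau) a)] on [0 <= tau <= s] and vanishes elsewhere;
   in particular [ker s tau 0] is the indicator of [0, s]. *)
Definition ker (s tau a : R) : R :=
  if (0 <= tau) && (tau <= s) then expR (- (s - tau) * a) else 0.

Lemma ker_ge0 s tau a : 0 <= ker s tau a.
Proof. by rewrite /ker; case: ifP => // _; exact: expR_ge0. Qed.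

Lemma ker_le s tau a : 0 <= a -> ker s tau a <= ker s tau 0.
Proof.
move=> a0; rewrite /ker; case: ifP => // /andP[_ ts].
by rewrite ler_expR mulr0 mulNr oppr_le0 mulr_ge0// subr_ge0.
Qed.

Lemma measurable_ker d (T : measurableType d) (s tau a : T -> R) :
  measurable_fun setT s -> measurable_fun setT tau -> measurable_fun setT a ->
  measurable_fun setT (fun x => ker (s x) (tau x) (a x)).
Proof.
move=> ms mt ma; apply: measurable_fun_ifT => //.
  by apply: measurable_and; apply: measurable_fun_ler.
apply: (measurableT_comp (@measurable_expR R)); apply: measurable_funM => //.
by apply: measurableT_comp => //; exact: measurable_funB.
Qed.

Lemma integral_ker0 (s : R) (f : R -> \bar R) :
  (\int[mu]_(x in `[0%R, s]) f x = \int[mu]_x ((ker s x 0)%:E * f x))%E.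
Proof.
rewrite integral_mkcond; apply: eq_integral => x _; rewrite /patch mem_setE/= in_itv/= /ker.
by case: ifP => _; rewrite ?mul0e// mulr0 expR0 mul1e.
Qed.

(** What the factor $e^{-(t-\tau)a}$ has lost by time $t$ is the integral of $ae^{-(s-\tau)a}$ over
    $[\tau,t]$, by the fundamental theorem of calculus. Both sides vanish when $\tau\notin[0,t]$. *)
Lemma ker_mass (t tau a : R) :
  ((ker t tau a)%:E + \int[mu]_s (ker t s 0 * (a * ker s tau a))%:E = (ker t tau 0)%:E)%E.
Proof.
have [/andP[t0 tt]|out] := boolP ((0 <= tau) && (tau <= t)); last first.
  rewrite integral0_eq ?adde0; first by rewrite /ker (negbTE out).
  move=> s _; congr EFin; rewrite /ker; case: ifP => [/andP[s0 st]|_]; last by rewrite mul0r.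
  case: ifP => [/andP[h1 h2]|_]; last by rewrite !mulr0.
  by move: out; rewrite h1 (le_trans h2 st).
have -> : (\int[mu]_s (ker t s 0 * (a * ker s tau a))%:E =
    \int[mu]_(s in `[tau, t]) (a * expR (- (s - tau) * a))%:E)%E.
  rewrite [RHS]integral_mkcond; apply: eq_integral => s _.
  rewrite /patch mem_setE/= in_itv/= /ker t0/=; case: (leP tau s) => [ts|ts]/=; last by rewrite !mulr0.
  rewrite (le_trans t0 ts)/=; case: ifP => _; last by rewrite mul0r.
  by rewrite mulr0 expR0 mul1r.
have kt b : ker t tau b = expR (- (t - tau) * b) by rewrite /ker t0 tt.
rewrite !kt mulr0 expR0; have [e|lt] := eqVneq tau t.
  by rewrite e set_itv1 integral_set1 subrr oppr0 mul0r expR0 adde0.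
pose F s := - expR (- (s - tau) * a).
have dF (s : R) : is_derive s 1 F (a * expR (- (s - tau) * a)).
  have d1 : is_derive s 1 (fun s : R => - (s - tau) * a) (- a).
    apply: is_derive_eq; rewrite ?scaler0 ?add0r/GRing.scale/= ?subr0 ?addr0 ?mulr0 ?add0r; ring.
  have d2 := @is_derive1_comp _ expR (fun s : R => - (s - tau) * a) s _ _ (is_derive_expR _) d1.
  apply: (is_derive_eq (is_deriveN d2)).
  by rewrite /GRing.scale/=; ring.
have cF := is_derive_continuous dF.
rewrite (@continuous_FTC2 _ _ F); first last.
- by move=> x _; apply: is_derive1E; exact: dF.
- split; first by move=> x _; have [] := dF x.
  + by apply: cvg_at_right_filter; exact: cF.
  + by apply: cvg_at_left_filter; exact: cF.
- apply: continuous_subspaceT => x.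
  rewrite (_ : (fun s => a * expR (- (s - tau) * a)) = (fun s => (- a) * F s)); last first.
    by apply/funext => y; rewrite mulrNN.
  by apply: cvgM; [exact: cvg_cst|exact: cF].
- by rewrite lt_neqAle lt tt.
by rewrite /F subrr oppr0 mul0r expR0 -EFinB -EFinD; congr EFin; ring.
Qed.

(** The Duhamel bound at a fixed frequency: [n] is the modulus of the initial transform, [a] is
    $|\xi|^2$ and [H] is the source as a function of time. *)
Definition duhamel_bound (n a : R) (H : R -> \bar R) (s : R) : \bar R :=
  ((ker s 0 a * n)%:E + \int[mu]_tau ((ker s tau a)%:E * H tau))%E.

(** Tonelli exchanges the dissipation time [s] and the source time [tau]; [ker_mass] then applies to
    the datum, released at time 0, and to the source, released at time [tau]. Being an equality, it
    keeps the whole dissipation on the left with coefficient 1. *)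
Lemma duhamel_bound_dissipation (n a t : R) (H : R -> \bar R) : 0 <= n -> 0 <= a ->
  measurable_fun setT H -> (forall tau, (0 <= H tau)%E) ->
  (duhamel_bound n a H t + \int[mu]_s ((ker t s 0 * a)%:E * duhamel_bound n a H s) =
   (ker t 0 0 * n)%:E + \int[mu]_tau ((ker t tau 0)%:E * H tau))%E.
Proof.
move=> n0 a0 mH H0.
have mH' : measurable_fun setT (H : measurableTypeR R -> \bar R) by exact: mH.
have mk (s tau b : measurableTypeR R -> R) : measurable_fun setT s -> measurable_fun setT tau ->
    measurable_fun setT b -> measurable_fun setT (fun x => (ker (s x) (tau x) (b x))%:E).
  by move=> ms mt mb; apply/measurable_EFinP; exact: measurable_ker.
have mid := @measurable_id _ (measurableTypeR R) setT.
have mc (r : R) := @measurable_cst _ _ (measurableTypeR R) (measurableTypeR R) setT r.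
pose h (z : measurableTypeR R * measurableTypeR R) : \bar R :=
  ((ker t z.1 0 * (a * ker z.1 z.2 a))%:E * H z.2)%E.
have mfst := @measurable_fst _ _ (measurableTypeR R) (measurableTypeR R).
have msnd := @measurable_snd _ _ (measurableTypeR R) (measurableTypeR R).
have mh : measurable_fun setT h.
  apply: emeasurable_funM; last exact: (measurableT_comp mH' msnd).
  apply/measurable_EFinP; apply: measurable_funM; first exact: measurable_ker.
  by apply: measurable_funM => //; exact: measurable_ker.
have h0 z : (0 <= h z)%E by rewrite mule_ge0// lee_fin !mulr_ge0 ?ker_ge0.
have w0 s tau : 0 <= ker t s 0 * (a * ker s tau a) by rewrite !mulr_ge0 ?ker_ge0.
have mw tau : measurable_fun setT (fun s : measurableTypeR R => (ker t s 0 * (a * ker s tau a))%:E).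
  apply/measurable_EFinP; apply: measurable_funM; first exact: measurable_ker.
  by apply: measurable_funM => //; exact: measurable_ker.
have -> : (\int[mu]_s ((ker t s 0 * a)%:E * duhamel_bound n a H s) =
    \int[mu]_s (n%:E * (ker t s 0 * (a * ker s 0 a))%:E) + \int[mu]_tau \int[mu]_s h (s, tau))%E.
  have -> : (\int[mu]_tau \int[mu]_s h (s, tau) = \int[mu]_s \int[mu]_tau h (s, tau))%E.
    by apply/esym; exact: (@fubini_tonelli _ _ _ _ R mu mu h mh h0).
  rewrite -ge0_integralD//; last 4 first.
  - by move=> s _; rewrite -EFinM lee_fin mulr_ge0.
  - exact: measurable_funeM.
  - by move=> s _; exact: integral_ge0.
  - exact: (@measurable_fun_fubini_tonelli_F _ _ _ _ R mu h mh h0).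
  apply: eq_integral => s _; rewrite /duhamel_bound ge0_muleDr; last 2 first.
  - by rewrite lee_fin mulr_ge0 ?ker_ge0.
  - by apply: integral_ge0 => tau _; rewrite mule_ge0// lee_fin ker_ge0.
  congr (_ + _)%E; first by rewrite -!EFinM; congr EFin; ring.
  rewrite -ge0_integralZl_EFin//.
  - by apply: eq_integral => tau _; rewrite muleA /h -EFinM/= mulrA.
  - by move=> tau _; rewrite mule_ge0// lee_fin ker_ge0.
  - by apply: emeasurable_funM => //; exact: mk.
  - by rewrite mulr_ge0 ?ker_ge0.
rewrite ge0_integralZl_EFin//; last by move=> s _; rewrite lee_fin.
rewrite /duhamel_bound addeACA; congr (_ + _)%E.
  by rewrite mulrC EFinM -muleDr// ?ker_mass -?EFinM 1?mulrC//; apply: ge0_adde_def; rewrite inE ?lee_fin ?ker_ge0// integral_ge0.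
rewrite -ge0_integralD//; last 4 first.
- by move=> tau _; rewrite mule_ge0// lee_fin ker_ge0.
- by apply: emeasurable_funM => //; exact: mk.
- by move=> tau _; exact: integral_ge0.
- exact: (@measurable_fun_fubini_tonelli_G _ _ _ _ R mu h mh h0).
apply: eq_integral => tau _; rewrite /h /=.
rewrite ge0_integralZr//; last by move=> s _; rewrite lee_fin.
by rewrite -ge0_muleDl ?ker_mass// ?lee_fin ?ker_ge0// integral_ge0// => s _; rewrite lee_fin.
Qed.

End TimeKernel.

(** The majorant is raised to infinity on a measurable null set that contains the exceptions: it
    then holds everywhere, with the same integral. *)
Lemma cabs_cintegral_lower_ae d (T : measurableType d) (R : realType)
    (mu : {measure set T -> \bar R}) (D : set T) (f : T -> R[i]) (g : T -> \bar R) :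
  measurable D -> measurable_fun setT g -> (forall x, (0 <= g x)%E) ->
  {ae mu, forall x, D x -> ((cabs (f x))%:E <= g x)%E} ->
  ((cabs (cintegral mu D f))%:E <= 2%:E * \int[mu]_(x in D) g x)%E.
Proof.
move=> mD mg g0 [N [mN N0 hN]].
have [->|gf] := eqVneq (\int[mu]_(x in D) g x)%E +oo%E.
  by rewrite mulry gtr0_sg// mul1e leey.
pose g' x := if x \in N then +oo%E else g x.
have mg' : measurable_fun setT g'.
  apply: measurable_fun_ifT => //; apply: (measurable_fun_bool true).
  by rewrite setTI (_ : _ @^-1` _ = N)//; apply/seteqP; split => x; [move=> /set_mem|move=> /mem_set].
have e : (\int[mu]_(x in D) g' x = \int[mu]_(x in D) g x)%E.
  apply: ge0_ae_eq_integral => //; [exact: measurable_funTS|exact: measurable_funTS| |].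
    by move=> x _; rewrite /g'; case: ifP.
  exists N; split => // x /= h; apply: contra_notP h => xN _.
  by rewrite /g' memNset.
rewrite -e; apply: cabs_cintegral_lower; last by rewrite e lt_neqAle gf leey.
move=> x Dx; rewrite /g'; case: ifPn => [_|/negP xN]; first exact: leey.
by apply: contrapT => h; apply: xN; rewrite inE; apply: hN => /= /(_ Dx).
Qed.

(** * Time integrals in the Duhamel formula *)

Section DuhamelEstimate.
Context {R : realType}.
Local Notation mspace := (measurableTypeR R * measurableTypeR R * measurableTypeR R)%type.
Local Notation mu := (@lebesgue_measure R).
Local Notation mu3 := (@lebesgue3 R).
Local Notation c := (((2 * pi) ^+ 3)^-1 : R).
Implicit Types (u Q : R -> vdist R) (B : measurableTypeR R * mspace -> \bar R)
  (U : measurableTypeR R * mspace -> R).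

(** The contribution of a source [B] to the Duhamel bound at time [s], frequency by frequency. *)
Definition smear (s : R) B (x : mspace) : \bar R :=
  (\int[mu]_tau ((ker s tau (enorm3 x ^+ 2))%:E * B (tau, x)))%E.

Lemma measurable_sqr_enorm3 d (T : measurableType d) (x : T -> mspace) : measurable_fun setT x ->
  measurable_fun setT (fun t => enorm3 (x t) ^+ 2).
Proof. by move=> mx; apply: measurable_funX; exact: measurable_enorm3. Qed.

Lemma measurable_smear_joint B : measurable_fun setT B -> (forall z, (0 <= B z)%E) ->
  measurable_fun setT (fun z : measurableTypeR R * mspace => smear z.1 B z.2).
Proof.
move=> mB B0.
pose h (q : (measurableTypeR R * mspace) * measurableTypeR R) :=
  ((ker q.1.1 q.2 (enorm3 q.1.2 ^+ 2))%:E * B (q.2, q.1.2))%E.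
have m1 : measurable_fun setT (fun q : (measurableTypeR R * mspace) * measurableTypeR R => q.1.1).
  exact: (measurableT_comp measurable_fst measurable_fst).
have m2 : measurable_fun setT (fun q : (measurableTypeR R * mspace) * measurableTypeR R => q.1.2).
  exact: (measurableT_comp measurable_snd measurable_fst).
apply: (@measurable_fun_fubini_tonelli_F _ _ _ _ R mu h); last first.
  by move=> q; rewrite mule_ge0// lee_fin ker_ge0.
apply: emeasurable_funM.
  apply/measurable_EFinP; apply: measurable_ker => //; exact: measurable_sqr_enorm3.
by apply: (measurableT_comp mB); apply: measurable_fun_pair => //; exact: measurable_snd.
Qed.

Lemma measurable_smear s B : measurable_fun setT B -> (forall z, (0 <= B z)%E) ->
  measurable_fun setT (smear s B).
Proof.
move=> mB B0; exact: (measurableT_comp (measurable_smear_joint mB B0) (pair1_measurable (s : measurableTypeR R))).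
Qed.

Lemma smear_ge0 s B : (forall z, (0 <= B z)%E) -> forall x, (0 <= smear s B x)%E.
Proof. by move=> B0 x; apply: integral_ge0 => tau _; rewrite mule_ge0// lee_fin ker_ge0. Qed.

Lemma measurable_ker_line (s : R) (x : mspace) :
  measurable_fun setT (fun tau : measurableTypeR R => (ker s tau (enorm3 x ^+ 2))%:E).
Proof. by apply/measurable_EFinP; exact: measurable_ker. Qed.

Lemma measurable_line B (x : mspace) : measurable_fun setT B ->
  measurable_fun setT (fun tau : measurableTypeR R => B (tau, x)).
Proof. by move=> mB; exact: (measurableT_comp mB (pair2_measurable x)). Qed.

Lemma smearD s B1 B2 x : measurable_fun setT B1 -> measurable_fun setT B2 ->
  (forall z, (0 <= B1 z)%E) -> (forall z, (0 <= B2 z)%E) ->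
  (smear s (fun z => B1 z + B2 z) x = smear s B1 x + smear s B2 x)%E.
Proof.
move=> m1 m2 p1 p2; rewrite /smear -ge0_integralD//.
- by apply: eq_integral => tau _; rewrite ge0_muleDr.
- by move=> tau _; rewrite mule_ge0// lee_fin ker_ge0.
- by apply: emeasurable_funM; [exact: measurable_ker_line|exact: measurable_line].
- by move=> tau _; rewrite mule_ge0// lee_fin ker_ge0.
- by apply: emeasurable_funM; [exact: measurable_ker_line|exact: measurable_line].
Qed.

Lemma smearZ s (r : R) B x : 0 <= r -> measurable_fun setT B -> (forall z, (0 <= B z)%E) ->
  (smear s (fun z => r%:E * B z) x = r%:E * smear s B x)%E.
Proof.
move=> r0 mB B0; rewrite /smear -ge0_integralZl_EFin//.
- by apply: eq_integral => tau _; rewrite muleCA.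
- by move=> tau _; rewrite mule_ge0// lee_fin ker_ge0.
- by apply: emeasurable_funM; [exact: measurable_ker_line|exact: measurable_line].
Qed.

Lemma smear_integral_le (s : R) B : measurable_fun setT B -> (forall z, (0 <= B z)%E) ->
  (\int[mu3]_x smear s B x <= \int[mu]_tau ((ker s tau 0)%:E * \int[mu3]_x B (tau, x)))%E.
Proof.
move=> mB B0.
pose h (z : measurableTypeR R * mspace) := ((ker s z.1 (enorm3 z.2 ^+ 2))%:E * B z)%E.
have mh : measurable_fun setT h.
  apply: emeasurable_funM => //; apply/measurable_EFinP; apply: measurable_ker => //.
  by apply: measurable_sqr_enorm3; exact: measurable_snd.
have h0 z : (0 <= h z)%E by rewrite mule_ge0// lee_fin ker_ge0.
have <- := @fubini_tonelli _ _ _ _ R mu mu3 h mh h0.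
apply: ge0_le_lower_integral => tau _; first exact: integral_ge0.
rewrite -[X in (_ <= X)%E]ge0_integralZl_EFin ?ker_ge0//; last first.
  exact: (measurableT_comp mB (pair1_measurable tau)).
apply: ge0_le_lower_integral => x _ //=.
by rewrite lee_wpmul2r// lee_fin ker_le// sqr_ge0.
Qed.

(** The constant 8 is 4 from the Leray projector times 2 from the time integral, whose real and
    imaginary parts are bounded separately. The bound on the source is asked for almost every time
    only, since the first moment of $\hat u$ is finite at almost every time. *)
Lemma time_integral_bound (Q : R -> vdist R) B (C s : R) k (f1 f2 f3 : R -> R) :
  nonneg_test f1 f2 f3 -> 0 <= C -> measurable_fun setT B -> (forall z, (0 <= B z)%E) ->
  {ae mu, forall tau, `[0, s]%classic tau -> mass (fun x => C%:E * B (tau, x))%E /\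
    forall j, {ae mu3, forall x, ((cabs (Fhat (Q tau j) x))%:E <= C%:E * B (tau, x))%E}} ->
  ((cabs (cintegral mu `[0, s] (fun tau =>
     heat (s - tau) (leray (Q tau) k) (fourier (ctens f1 f2 f3)))))%:E <=
   (8 * C)%:E * \int[mu3]_x (smear s B x * (tensor f1 f2 f3 x)%:E))%E.
Proof.
move=> nt C0 mB B0 hQ; have [[t1 t2 t3] [p1 p2 p3]] := nt.
have T0 x : 0 <= tensor f1 f2 f3 x by rewrite /tensor !mulr_ge0.
have mt : measurable_fun setT (tensor f1 f2 f3 : mspace -> R).
  by apply: measurable_tensor; apply: continuous_measurable_fun; exact: testfun_continuous.
pose h (z : measurableTypeR R * mspace) : \bar R :=
  (4%:E * (C%:E * B z) * (expR (- (s - z.1) * enorm3 z.2 ^+ 2) * tensor f1 f2 f3 z.2)%:E)%E.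
have mfst := @measurable_fst _ _ (measurableTypeR R) mspace.
have msnd := @measurable_snd _ _ (measurableTypeR R) mspace.
have mt2 : measurable_fun setT (fun z : measurableTypeR R * mspace => tensor f1 f2 f3 z.2).
  exact: (measurableT_comp mt msnd).
have mh : measurable_fun setT h.
  apply: emeasurable_funM; first by apply: measurable_funeM; exact: measurable_funeM.
  apply/measurable_EFinP; apply: measurable_funM => //.
  apply: (measurableT_comp (@measurable_expR R)); apply: measurable_funM.
    by apply: measurableT_comp => //; exact: measurable_funB.
  exact: measurable_sqr_enorm3.
have h0 z : (0 <= h z)%E by rewrite !mule_ge0 ?lee_fin// mulr_ge0 ?expR_ge0.
pose g tau := (\int[mu3]_x h (tau, x))%E.
have mg : measurable_fun setT (g : measurableTypeR R -> \bar R).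
  exact: (@measurable_fun_fubini_tonelli_F _ _ _ _ R mu3 h mh h0).
have g0 tau : (0 <= g tau)%E by exact: integral_ge0.
have hg : {ae mu, forall tau, `[0, s]%classic tau ->
    ((cabs (heat (s - tau) (leray (Q tau) k) (fourier (ctens f1 f2 f3))))%:E <= g tau)%E}.
  apply: ae_mono hQ => tau hq ts; have [hm hj] := hq ts.
  apply: heat_leray_bound => //.
  by move: ts; rewrite /= in_itv/= subr_ge0 => /andP[].
apply: le_trans (cabs_cintegral_lower_ae _ mg g0 hg) _; first exact: measurable_itv.
rewrite integral_ker0.
pose h' (z : measurableTypeR R * mspace) : \bar R :=
  ((4 * C)%:E * ((ker s z.1 (enorm3 z.2 ^+ 2))%:E * B z * (tensor f1 f2 f3 z.2)%:E))%E.
have mh' : measurable_fun setT h'.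
  apply: measurable_funeM; apply: emeasurable_funM; last exact/measurable_EFinP.
  apply: emeasurable_funM => //; apply/measurable_EFinP; apply: measurable_ker => //.
  exact: measurable_sqr_enorm3.
have h'0 z : (0 <= h' z)%E.
  by rewrite !mule_ge0 ?lee_fin ?ker_ge0// mulr_ge0.
have -> : (\int[mu]_tau ((ker s tau 0)%:E * g tau) = \int[mu]_tau \int[mu3]_x h' (tau, x))%E.
  apply: eq_integral => tau _; rewrite /g -ge0_integralZl_EFin ?ker_ge0//; last first.
    exact: (measurableT_comp mh (pair1_measurable tau)).
  apply: eq_integral => x _; rewrite /h /h' /=.
  have -> : ker s tau (enorm3 x ^+ 2) = ker s tau 0 * expR (- (s - tau) * enorm3 x ^+ 2).
    by rewrite /ker; case: ifP => _; rewrite ?mul0r// mulr0 expR0 mul1r.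
  move: (tensor f1 f2 f3 x) => p; rewrite !EFinM !muleA; congr (_ * _)%E; rewrite [LHS]muleAC; congr (_ * _ * _)%E.
  by rewrite -!EFinM; congr EFin; ring.
rewrite (@fubini_tonelli _ _ _ _ R mu mu3 h' mh' h'0).
have e x : (\int[mu]_tau h' (tau, x) = (4 * C)%:E * (smear s B x * (tensor f1 f2 f3 x)%:E))%E.
  have C4 : 0 <= 4 * C by rewrite mulr_ge0.
  rewrite /h' /= ge0_integralZl_EFin//; last 2 first.
  - by move=> tau _; rewrite !mule_ge0 ?lee_fin ?ker_ge0.
  - apply: emeasurable_funM => //; apply: emeasurable_funM; first exact: measurable_ker_line.
    exact: measurable_line.
  congr (_ * _)%E; rewrite /smear ge0_integralZr ?lee_fin//.
  - by apply: emeasurable_funM; [exact: measurable_ker_line|exact: measurable_line].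
  - by move=> tau _; rewrite mule_ge0 ?lee_fin ?ker_ge0.
under eq_integral do rewrite e.
rewrite ge0_integralZl_EFin ?mulr_ge0//; last 2 first.
- by move=> x _; rewrite mule_ge0 ?lee_fin// smear_ge0.
- by apply: emeasurable_funM; [exact: measurable_smear|exact/measurable_EFinP].
by rewrite muleA -EFinM mulrA -natrM.
Qed.

End DuhamelEstimate.

(** * Pointwise bound for the transform of the solution *)

Section PointwiseBound.
Context {R : realType}.
Local Notation mspace := (measurableTypeR R * measurableTypeR R * measurableTypeR R)%type.
Local Notation mu := (@lebesgue_measure R).
Local Notation mu3 := (@lebesgue3 R).
Local Notation c := (((2 * pi) ^+ 3)^-1 : R).
Implicit Types (V : space R -> R) (U : measurableTypeR R * mspace -> R).

Definition majorant (alpha : R) (m : nat) V (x : mspace) : \bar R :=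
  (conv (fun y => (V y)%:E) (weighted V) x + alpha%:E * conv_pow (fun y => (V y)%:E) (2 * m) x)%E.

Lemma measurable_convection_joint U : measurable_fun setT U -> (forall z, 0 <= U z) ->
  measurable_fun setT (fun z : measurableTypeR R * mspace =>
    conv (fun y => (U (z.1, y))%:E) (weighted (fun y => U (z.1, y))) z.2).
Proof.
move=> mU U0.
apply: (@measurable_conv_param R _ (measurableTypeR R) (fun z => (U z)%:E)
  (fun z => (enorm3 z.2 * U z)%:E)).
- exact/measurable_EFinP.
- apply/measurable_EFinP; apply: measurable_funM => //.
  by apply: measurable_enorm3; exact: measurable_snd.
- by move=> z; rewrite lee_fin.
- by move=> z; rewrite lee_fin mulr_ge0 ?enorm3_ge0.
Qed.

Lemma measurable_power_joint U n : measurable_fun setT U -> (forall z, 0 <= U z) ->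
  measurable_fun setT (fun z : measurableTypeR R * mspace =>
    conv_pow (fun y => (U (z.1, y))%:E) n z.2).
Proof.
move=> mU U0; elim: n => [|n IH] /=.
  rewrite (_ : (fun z => _) = EFin \o U); first exact/measurable_EFinP.
  by apply/funext => -[].
apply: (@measurable_conv_param R _ (measurableTypeR R) (fun z => (U z)%:E)
  (fun z => conv_pow (fun y => (U (z.1, y))%:E) n z.2)) => //.
- exact/measurable_EFinP.
- by move=> z; apply: conv_pow_ge0 => y; rewrite lee_fin.
Qed.

(** From $\pi\ge 2$. *)
Lemma c_le : c <= 64^-1.
Proof.
rewrite lef_pV2 ?posrE ?exprn_gt0 ?mulr_gt0 ?pi_gt0//.
rewrite (_ : 64 = (2 * 2) ^+ 3 :> R); last by ring.
by rewrite lerXn2r ?nnegrE ?mulr_ge0 ?pi_ge0// ler_pM2l// pi_ge2.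
Qed.

(** The exponent is at least 2, and $4096=64^2$. *)
Lemma cX_le m : (1 <= m)%N -> c ^+ (2 * m) <= 4096^-1.
Proof.
move=> m1; have c0 : 0 <= c by exact/ltW/c_gt0.
have c1 : c <= 1 by apply: le_trans c_le _; rewrite invf_le1//; lra.
apply: le_trans (_ : c ^+ 2 <= _); first by rewrite ler_wiXn2l// leq_pmulr.
rewrite (_ : 4096^-1 = 64^-1 ^+ 2 :> R); last by rewrite exprVn; congr (_^-1); ring.
by apply: lerXn2r => //; [rewrite nnegrE invr_ge0|exact: c_le].
Qed.

Section Bound.
Variables (alpha : R) (m : nat) (u0 : vdist R) (T : R) (u : R -> vdist R).
Variable U : measurableTypeR R * mspace -> R.
Hypotheses (alpha0 : 0 < alpha) (m1 : (1 <= m)%N) (hu0 : inX 0 u0).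
Hypotheses (huI : forall t, `[0, T]%classic t -> inX 0 (u t)) (hD : duhamel alpha m u0 `[0, T] u).
Hypotheses (mU : measurable_fun setT U) (U0 : forall z, 0 <= U z).
Hypothesis aeU : forall t, `[0, T]%classic t -> {ae mu3, forall x, U (t, x) = hatnorm (u t) x}.
Hypothesis hgood : {ae mu, forall t, `[0, T]%classic t ->
  (\int[mu3]_x weighted (fun y => U (t, y)) x < +oo)%E}.

Let H1 (z : measurableTypeR R * mspace) := conv (fun y => (U (z.1, y))%:E) (weighted (fun y => U (z.1, y))) z.2.
Let H2 (z : measurableTypeR R * mspace) := conv_pow (fun y => (U (z.1, y))%:E) (2 * m) z.2.
Let H z := (H1 z + alpha%:E * H2 z)%E.

Hypothesis hfin : (\int[mu]_tau ((ker T tau 0)%:E * \int[mu3]_x H (tau, x)) < +oo)%E.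

Lemma mass_section t : `[0, T]%classic t -> mass (fun x => (U (t, x))%:E).
Proof.
move=> tI; apply: (@mass_version _ (fun x => U (t, x)) (u t)) => //; [exact: huI| |exact: aeU].
exact: (measurableT_comp mU (pair1_measurable t)).
Qed.

Lemma H1_ge0 z : (0 <= H1 z)%E.
Proof.
apply: conv_ge0 => y; first by rewrite lee_fin.
by rewrite lee_fin mulr_ge0 ?enorm3_ge0.
Qed.

Lemma H2_ge0 z : (0 <= H2 z)%E.
Proof. by apply: conv_pow_ge0 => y; rewrite lee_fin. Qed.

Lemma H_ge0 z : (0 <= H z)%E.
Proof. by rewrite adde_ge0 ?H1_ge0// mule_ge0 ?H2_ge0// lee_fin ltW. Qed.

Lemma measurable_H1 : measurable_fun setT H1.
Proof. exact: measurable_convection_joint. Qed.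

Lemma measurable_H2 : measurable_fun setT H2.
Proof. exact: measurable_power_joint. Qed.

Lemma measurable_H : measurable_fun setT H.
Proof.
by apply: emeasurable_funD; [exact: measurable_H1|apply: measurable_funeM; exact: measurable_H2].
Qed.

(** Dropping the heat factor and enlarging [[0, s]] to [[0, T]] reduces finiteness to [hfin]. *)
Lemma mass_smear s : `[0, T]%classic s -> mass (smear s H).
Proof.
move=> sI; split; [exact: measurable_smear measurable_H H_ge0|exact: smear_ge0 H_ge0|].
apply: le_lt_trans hfin; apply: le_trans (smear_integral_le s measurable_H H_ge0) _.
apply: ge0_le_lower_integral => tau _.
  by rewrite mule_ge0 ?lee_fin ?ker_ge0//; apply: integral_ge0 => x _; exact: H_ge0.
rewrite lee_wpmul2r//; first by apply: integral_ge0 => x _; exact: H_ge0.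
rewrite lee_fin /ker; case: ifP => [/andP[t0 ts]|_]; last by case: ifP => // _; exact: expR_ge0.
move: sI; rewrite /= in_itv/= => /andP[_ sT]; rewrite t0 (le_trans ts sT)/=.
by rewrite !mulr0.
Qed.

Lemma good_dominated t : `[0, T]%classic t -> exists w, dominated_hat (u t) w (fun x => U (t, x)).
Proof.
by move=> tI; apply: dominated_hat_exists; [exact: huI|exact: mass_section|exact: aeU].
Qed.

Lemma convection_time_bound s k (f1 f2 f3 : R -> R) : `[0, T]%classic s -> nonneg_test f1 f2 f3 ->
  ((cabs (cintegral mu `[0, s] (fun tau =>
     heat (s - tau) (leray (convection (u tau)) k) (fourier (ctens f1 f2 f3)))))%:E <=
   (8 * (2 * c))%:E * \int[mu3]_x (smear s H1 x * (tensor f1 f2 f3 x)%:E))%E.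
Proof.
move=> sI nt; have c0 := @c_gt0 R.
apply: time_integral_bound => //; [by rewrite mulr_ge0// ltW|exact: measurable_H1|exact: H1_ge0|].
apply: ae_mono hgood => tau hg ts.
have tI : `[0, T]%classic tau.
  move: sI ts; rewrite /= !in_itv/= => /andP[_ sT] /andP[t0 ts].
  by rewrite t0 (le_trans ts sT).
have [w hw] := good_dominated tI; have hm := mass_section tI.
split; last by move=> j; exact: (convection_bound j (huI tI) hw (hg tI)).
apply: massZ; first by rewrite mulr_ge0// ltW.
exact: (mass_conv hm (mass_weighted hm (hg tI))).
Qed.

Lemma power_time_bound s j k (f1 f2 f3 : R -> R) : `[0, T]%classic s -> nonneg_test f1 f2 f3 ->
  ((cabs (cintegral mu `[0, s] (fun tau =>
     heat (s - tau) (leray (power_term (2 * m).+1 j (u tau)) k) (fourier (ctens f1 f2 f3)))))%:E <=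
   (8 * (2 * c ^+ (2 * m)))%:E * \int[mu3]_x (smear s H2 x * (tensor f1 f2 f3 x)%:E))%E.
Proof.
move=> sI nt; have c0 : 0 <= c ^+ (2 * m) by rewrite exprn_ge0// ltW// c_gt0.
apply: time_integral_bound => //; [by rewrite mulr_ge0|exact: measurable_H2|exact: H2_ge0|].
apply: aeW => tau ts.
have tI : `[0, T]%classic tau.
  move: sI ts; rewrite /= !in_itv/= => /andP[_ sT] /andP[t0 ts].
  by rewrite t0 (le_trans ts sT).
have [w hw] := good_dominated tI; have hm := mass_section tI.
split; last by move=> l; exact: (power_bound (2 * m) j l (huI tI) hw).
apply: massZ; first by rewrite mulr_ge0.
by rewrite /H2 /=; elim: (2 * m)%N => [|n IH] //=; exact: mass_conv.
Qed.

(** The Duhamel formula is tested against tensors. Convection has the constant $16c\le 16/64=1/4$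
    and each of the three power terms $16c^{2m}\le 16/4096\le 1/12$, so that together they give a
    quarter of the smeared majorant; the domination criterion doubles it. *)
Lemma coordinate_bound s k : `[0, T]%classic s ->
  {ae mu3, forall x, ((cabs (Fhat (u s k) x -
     (expR (- s * enorm3 x ^+ 2))%:C * Fhat (u0 k) x))%:E <= 2^-1%:E * smear s H x)%E}.
Proof.
move=> sI; have [mS S0 Sf] := mass_smear sI.
have s0 : 0 <= s by move: sI; rewrite /= in_itv/= => /andP[].
have me : measurable_fun setT (fun x : mspace => expR (- s * enorm3 x ^+ 2)).
  apply: (measurableT_comp (@measurable_expR R)); apply: measurable_funM => //.
  by apply: measurable_sqr_enorm3; exact: measurable_id.
have i0 : cintegrable mu3 (fun x => (expR (- s * enorm3 x ^+ 2))%:C * Fhat (u0 k) x).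
  apply: (cintegrable_bounded (M := 1) _ _ (inX_cintegrable k hu0)).
    exact: cmeasurable_real.
  move=> x; rewrite cabsC ger0_norm ?expR_ge0// -expR0 ler_expR mulNr oppr_le0.
  by rewrite mulr_ge0 ?sqr_ge0.
have iu := inX_cintegrable k (huI sI).
have m4 : mass (fun x => 4^-1%:E * smear s H x)%E by apply: massZ.
have [m41 m42 m43] := m4.
suff : {ae mu3, forall x, ((cabs (Fhat (u s k) x -
     (expR (- s * enorm3 x ^+ 2))%:C * Fhat (u0 k) x))%:E <= 2%:E * (4^-1%:E * smear s H x))%E}.
  apply: ae_mono => x; rewrite muleA -EFinM (_ : 2 * 4^-1 = 2^-1)//.
  by rewrite (_ : 4 = 2 * 2 :> R) ?invfM ?mulrA ?mulfV ?mul1r//; ring.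
apply: ae_le_of_tensors => //.
  by apply: lint_cintegrable; apply: cintegrableD => //; exact: cintegrableN.
move=> f1 f2 f3 t1 t2 t3 p1 p2 p3.
have nt : nonneg_test f1 f2 f3 by [].
have l1 := lint_integrable (lint_cintegrable iu) t1 t2 t3.
have l2 := lint_integrable (lint_cintegrable i0) t1 t2 t3.
rewrite (@eq_cintegral _ _ _ mu3 _ (fun x => Fhat (u s k) x * ctens f1 f2 f3 x +
   - ((expR (- s * enorm3 x ^+ 2))%:C * Fhat (u0 k) x * ctens f1 f2 f3 x))); last first.
  by move=> x; rewrite mulrBl.
rewrite (cintegralD l1 (cintegrableN l2)) (cintegralN l2).
have [_ hs] := inX_has_fourier k (huI sI).
have sc := schwartz_ctens t1 t2 t3.
rewrite -(has_fourier_ctens (inX_has_fourier k (huI sI)) t1 t2 t3) -heat_ctens//.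
rewrite (hD sI k (schwartz_fourier_ctens t1 t2 t3)).
have T0 x : (0 <= (tensor f1 f2 f3 x)%:E)%E by rewrite lee_fin /tensor !mulr_ge0.
have mt : measurable_fun setT (fun x : mspace => (tensor f1 f2 f3 x)%:E).
  apply/measurable_EFinP.
  by apply: measurable_tensor; apply: continuous_measurable_fun; exact: testfun_continuous.
have S10 := smear_ge0 s H1_ge0; have S20 := smear_ge0 s H2_ge0.
have mS1 := measurable_smear s measurable_H1 H1_ge0.
have mS2 := measurable_smear s measurable_H2 H2_ge0.
set I1 := (\int[mu3]_x (smear s H1 x * (tensor f1 f2 f3 x)%:E))%E.
set I2 := (\int[mu3]_x (smear s H2 x * (tensor f1 f2 f3 x)%:E))%E.
have I10 : (0 <= I1)%E by apply: integral_ge0 => x _; rewrite mule_ge0.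
have I20 : (0 <= I2)%E by apply: integral_ge0 => x _; rewrite mule_ge0.
have -> : (\int[mu3]_x (4^-1%:E * smear s H x * (tensor f1 f2 f3 x)%:E) =
    4^-1%:E * I1 + (4^-1 * alpha)%:E * I2)%E.
  rewrite [in RHS]EFinM -muleA -ge0_muleDr//; last by rewrite mule_ge0// lee_fin ltW.
  rewrite -ge0_integralZl_EFin//; last 3 first.
  - by move=> x _; rewrite mule_ge0.
  - exact: emeasurable_funM.
  - exact: ltW.
  rewrite -ge0_integralD//; last 4 first.
  - by move=> x _; rewrite mule_ge0.
  - exact: emeasurable_funM.
  - by move=> x _; rewrite !mule_ge0// lee_fin ltW.
  - by apply: measurable_funeM; exact: emeasurable_funM.
  rewrite -ge0_integralZl_EFin//; last 2 first.
  - by move=> x _; rewrite adde_ge0 ?mule_ge0// lee_fin ltW.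
  - by apply: emeasurable_funD; [|apply: measurable_funeM]; exact: emeasurable_funM.
  apply: eq_integral => x _; rewrite -muleA; congr (_ * _)%E.
  rewrite /H smearD//; [|exact: measurable_H1|apply: measurable_funeM; exact: measurable_H2
    |exact: H1_ge0|by move=> z; rewrite mule_ge0 ?H2_ge0// lee_fin ltW].
  rewrite smearZ ?ltW//; [|exact: measurable_H2|exact: H2_ge0].
  by rewrite muleA -ge0_muleDl// mule_ge0// lee_fin ltW.
pose K1 := cintegral mu `[0, s] (fun tau =>
  heat (s - tau) (leray (convection (u tau)) k) (fourier (ctens f1 f2 f3))).
pose K2 j := cintegral mu `[0, s] (fun tau =>
  heat (s - tau) (leray (power_term (2 * m).+1 j (u tau)) k) (fourier (ctens f1 f2 f3))).
have alg (x y z : R[i]) : x - y - z + - x = - (y + z) by ring.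
rewrite alg cabsN.
suff h : ((cabs K1 + alpha * \sum_(j < 3) cabs (K2 j))%:E <=
    4^-1%:E * I1 + (4^-1 * alpha)%:E * I2)%E.
  apply: le_trans h; rewrite lee_fin; apply: le_trans (cabsD _ _) _.
  apply: lerD; first exact: lexx.
  by rewrite cabsM cabsC (gtr0_norm alpha0) (ler_pM2l alpha0); exact: cabs_sum.
rewrite EFinD; apply: leeD.
  apply: (le_trans (convection_time_bound k sI nt)); apply: lee_wpmul2r => //; rewrite lee_fin.
  by have := @c_le; lra.
have hK j : ((cabs (K2 j))%:E <= 12^-1%:E * I2)%E.
  apply: le_trans (power_time_bound j k sI nt) _.
  by rewrite lee_wpmul2r// lee_fin; have := cX_le m1; lra.
(* The quarter is shared equally among the three power terms. *)
have -> : ((4^-1 * alpha)%:E * I2 = alpha%:E * (12^-1%:E * I2 + 12^-1%:E * I2 + 12^-1%:E * I2))%E.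
  have -> : 4^-1 = 12^-1 + 12^-1 + 12^-1 :> R by lra.
  have k0 : (0 <= 12^-1%:E :> \bar R)%E by rewrite lee_fin invr_ge0.
  have k00 : (0 <= 12^-1%:E + 12^-1%:E :> \bar R)%E by rewrite adde_ge0.
  by rewrite -(ge0_muleDl _ k0 k0) -(ge0_muleDl _ k00 k0) mulrC EFinM muleA.
rewrite EFinM; apply: lee_wpmul2l; first by rewrite lee_fin ltW.
by rewrite sum3E !EFinD; apply: leeD; [apply: leeD|]; exact: hK.
Qed.

(** The Euclidean norm of three components at most doubles the factor $1/2$ of each, which brings
    the constant of the source to 1. *)
Lemma pointwise_bound s : `[0, T]%classic s ->
  {ae mu3, forall x, ((U (s, x))%:E <=
    duhamel_bound (hatnorm u0 x) (enorm3 x ^+ 2) (fun tau => H (tau, x)) s)%E}.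
Proof.
move=> sI; have [_ S0 _] := mass_smear sI.
have s0 : 0 <= s by move: sI; rewrite /= in_itv/= => /andP[].
have := @ae_forall_countable _ _ _ mu3 'I_3 _ (fun k => coordinate_bound k sI).
apply: ae_mono2 (aeU sI) => x e hx; rewrite e /duhamel_bound -/(smear s H x).
have -> : ker s 0 (enorm3 x ^+ 2) = expR (- s * enorm3 x ^+ 2) by rewrite /ker lexx s0 subr0.
have [Sx|Sx] := eqVneq (smear s H x) +oo%E; first by rewrite Sx addey// leey.
have Sfin : smear s H x \is a fin_num by rewrite ge0_fin_numE// lt_neqAle Sx leey.
rewrite -(fineK Sfin) -EFinD lee_fin; set r := fine _.
set E := expR _; set g := fun k => Fhat (u s k) x - E%:C * Fhat (u0 k) x.
have hr k : cabs (g k) <= 2^-1 * r.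
  by have := hx k; rewrite -(fineK Sfin) -EFinM lee_fin.
have := cnorm3_le hr; rewrite mulrA mulfV ?mul1r// => hg.
have -> : hatnorm (u s) x = cnorm3 (fun k => E%:C * Fhat (u0 k) x + g k).
  by congr cnorm3; apply/funext => k; rewrite /g addrC subrK.
apply: le_trans (cnorm3D _ _) _; apply: lerD => //.
rewrite /cnorm3 le_eqVlt; apply/orP; left; apply/eqP.
under eq_bigr do rewrite cabsM cabsC exprMn (ger0_norm (expR_ge0 _)).
by rewrite -mulr_sumr sqrtrM ?sqr_ge0// sqrtr_sqr ger0_norm ?expR_ge0.
Qed.

End Bound.
End PointwiseBound.

(** * Absorption of the convection term by the dissipation *)

Section EnergyInequality.
Context {R : realType}.
Local Notation mspace := (measurableTypeR R * measurableTypeR R * measurableTypeR R)%type.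
Local Notation mu := (@lebesgue_measure R).
Local Notation mu3 := (@lebesgue3 R).
Variables (alpha : R) (m : nat) (u0 : vdist R) (T : R) (u : R -> vdist R).
Variable U : measurableTypeR R * mspace -> R.
Hypotheses (alpha0 : 0 < alpha) (m1 : (1 <= m)%N) (hu0 : inX 0 u0).
Hypotheses (hC : C_X 0 `[0, T] u) (hD : duhamel alpha m u0 `[0, T] u).
Hypothesis hX2 : (\int[mu]_(t in `[0%R, T]) Xenorm 2 (u t) < +oo)%E.
Hypotheses (mU : measurable_fun setT U) (U0 : forall z, 0 <= U z).
Hypothesis aeU : forall t, `[0, T]%classic t -> {ae mu3, forall x, U (t, x) = hatnorm (u t) x}.

Let N t := Xnorm 0 (u t).
Let W t := (\int[mu3]_x (enorm3 x ^+ 2 * U (t, x))%:E)%E.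
(** What bounds the mass of the majorant once half of [W] has been set aside; its first factor is
    the Gronwall coefficient. *)
Let E t := (2^-1 * N t ^+ 2 + alpha * N t ^+ (2 * m)) * N t.
Let H (z : measurableTypeR R * mspace) := majorant alpha m (fun y => U (z.1, y)) z.2.

Let inXu t : `[0, T]%classic t -> inX 0 (u t).
Proof. by have [h _] := hC; exact: h. Qed.

Let massU t : `[0, T]%classic t -> mass (fun x => (U (t, x))%:E).
Proof. by move=> tI; exact: (mass_section inXu mU U0 aeU). Qed.

Let sub t tau : `[0, T]%classic t -> `[0, t]%classic tau -> `[0, T]%classic tau.
Proof.
rewrite /= !in_itv/= => /andP[_ tT] /andP[t0 ts].
by rewrite t0 (le_trans ts tT).
Qed.

Lemma Xnorm_version t : `[0, T]%classic t -> (\int[mu3]_x (U (t, x))%:E = (N t)%:E)%E.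
Proof.
move=> tI; have [mUt _ _] := massU tI; have [mh h0 hf] := inX_mass (inXu tI).
rewrite /N Xnorm0E Rintegral_EFin//; last exact: integrable_hatnorm (inXu tI).
apply: ge0_ae_eq_integral => //.
- by move=> x _; rewrite lee_fin.
- by apply: ae_mono (aeU tI) => x /= -> _.
Qed.

Lemma Xenorm2_version t : `[0, T]%classic t -> Xenorm 2 (u t) = W t.
Proof.
move=> tI; have [/measurable_EFinP mUt _ _] := massU tI; have mh := measurable_hatnorm (u t).
have me := measurable_sqr_enorm3 (@measurable_id _ mspace setT).
rewrite Xenorm2E; apply: ge0_ae_eq_integral => //.
- by apply/measurable_EFinP; exact: measurable_funM.
- by apply/measurable_EFinP; exact: measurable_funM.
- by move=> x _; rewrite lee_fin mulr_ge0 ?sqr_ge0 ?hatnorm_ge0.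
- by move=> x _; rewrite lee_fin mulr_ge0 ?sqr_ge0.
- by apply: ae_mono (aeU tI) => x /= -> _.
Qed.

Lemma measurable_dissipation : measurable_fun setT (fun z : measurableTypeR R * mspace =>
  (enorm3 z.2 ^+ 2 * U z)%:E).
Proof.
apply/measurable_EFinP; apply: measurable_funM => //.
by apply: measurable_sqr_enorm3; exact: measurable_snd.
Qed.

Lemma measurable_W : measurable_fun setT (W : measurableTypeR R -> \bar R).
Proof.
apply: (@measurable_fun_fubini_tonelli_F _ _ _ _ R mu3 _ measurable_dissipation).
by move=> z; rewrite lee_fin mulr_ge0 ?sqr_ge0.
Qed.

Lemma W_ge0 t : (0 <= W t)%E.
Proof. by apply: integral_ge0 => x _; rewrite lee_fin mulr_ge0 ?sqr_ge0. Qed.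

Lemma W_integral : (\int[mu]_(t in `[0%R, T]) W t < +oo)%E.
Proof.
apply: le_lt_trans hX2; apply: ge0_le_lower_integral => t tI; first exact: W_ge0.
by rewrite Xenorm2_version.
Qed.

(** As $r\le 1+r^2$, the first moment is bounded by the sum of the mass and of [W t], and the latter
    is finite at almost every time. *)
Lemma W_good : {ae mu, forall t, `[0, T]%classic t ->
  (\int[mu3]_x weighted (fun y => U (t, y)) x < +oo)%E}.
Proof.
have mI : measurable (`[0, T]%classic : set (measurableTypeR R)) by exact: measurable_itv.
have i : mu.-integrable `[0, T] W.
  apply/integrableP; split; first exact: measurable_funTS measurable_W.
  by under eq_integral do rewrite gee0_abs ?W_ge0//; exact: W_integral.
have := integrable_ae mI i; apply: ae_mono => t h tI; have := h tI.
rewrite ge0_fin_numE ?W_ge0// => Wt.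
have [mUt p0 hU] := massU tI; have /measurable_EFinP mUt' := mUt.
have me := measurable_sqr_enorm3 (@measurable_id _ mspace setT).
have : (\int[mu3]_x ((U (t, x))%:E + (enorm3 x ^+ 2 * U (t, x))%:E) < +oo)%E.
  rewrite ge0_integralD//; first exact: lte_add_pinfty.
  - by move=> x _; rewrite lee_fin mulr_ge0 ?sqr_ge0.
  - by apply/measurable_EFinP; exact: measurable_funM.
apply: le_lt_trans; apply: ge0_le_lower_integral => x _.
  by rewrite lee_fin mulr_ge0 ?enorm3_ge0.
rewrite -EFinD lee_fin -[X in X + _]mul1r -mulrDl ler_wpM2r//.
have := sqr_ge0 (enorm3 x - 1); have := enorm3_ge0 x; move: (enorm3 x) => r r0.
by rewrite sqrrB1; lra.
Qed.

Lemma Nge0 t : 0 <= N t.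
Proof. by rewrite /N Xnorm0E; apply: Rintegral_ge0 => x _; exact: hatnorm_ge0. Qed.

(* Young's inequality [N |xi| <= (N ^ 2 + |xi| ^ 2) / 2] trades half of the dissipation
   against the convection term. *)
Lemma majorant_mass t : `[0, T]%classic t ->
  (\int[mu3]_x H (t, x) <= (E t)%:E + 2^-1%:E * W t)%E.
Proof.
move=> tI; have hm := massU tI; have [mUt p0 hU] := hm; have /measurable_EFinP mUt' := mUt.
have wm := measurable_weighted hm; have w0 := weighted_ge0 hm.
have me := measurable_sqr_enorm3 (@measurable_id _ mspace setT).
rewrite /H /majorant /= ge0_integralD//; last 4 first.
- by move=> x _; exact: conv_ge0.
- exact: measurable_conv.
- by move=> x _; apply: mule_ge0; [rewrite lee_fin ltW|exact: conv_pow_ge0].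
- by apply: measurable_funeM; exact: measurable_conv_pow.
rewrite conv_integral// ge0_integralZl_EFin//; last 3 first.
- by move=> x _; exact: conv_pow_ge0.
- exact: measurable_conv_pow.
- exact: ltW.
rewrite conv_pow_integral// Xnorm_version// -EFin_expe -EFinM.
have : ((N t)%:E * \int[mu3]_x weighted (fun y => U (t, y)) x <= (2^-1 * N t ^+ 2 * N t)%:E + 2^-1%:E * W t)%E.
  rewrite -ge0_integralZl_EFin ?Nge0// /W -ge0_integralZl_EFin//; last 2 first.
  - by move=> x _; rewrite lee_fin mulr_ge0 ?sqr_ge0.
  - by apply/measurable_EFinP; exact: measurable_funM.
  rewrite [in leRHS]EFinM -[in leRHS]Xnorm_version// -ge0_integralZl_EFin ?mulr_ge0 ?Nge0//.
  rewrite -ge0_integralD//; last 4 first.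
  - by move=> x _; rewrite mule_ge0 ?lee_fin ?mulr_ge0 ?Nge0.
  - exact: measurable_funeM.
  - by move=> x _; rewrite mule_ge0 ?lee_fin ?mulr_ge0 ?enorm3_ge0.
  - by apply: measurable_funeM; apply/measurable_EFinP; exact: measurable_funM.
  apply: ge0_le_lower_integral => x _; first by apply: mule_ge0; [rewrite lee_fin Nge0|exact: w0].
  rewrite /weighted -!EFinM -EFinD lee_fin !mulrA -mulrDl ler_wpM2r//.
  have := sqr_ge0 (N t - enorm3 x); rewrite sqrrB.
  by move: (N t) (enorm3 x) => p q; lra.
move=> h; rewrite /E mulrDl EFinD addeAC; apply: leeD => //.
by rewrite lee_fin exprSr mulrA.
Qed.

Lemma continuous_E : {within `[0, T], continuous E}.
Proof.
have cN := C_X_Xnorm_continuous hC.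
have cX n : {within `[0, T], continuous (fun t => N t ^+ n)}.
  elim: n => [|n IH] x; first exact: cst_continuous.
  rewrite (_ : (fun t => N t ^+ n.+1) = (fun t => N t * N t ^+ n)).
    by apply: cvgM; [exact: cN|exact: IH].
  by apply/funext => t; rewrite exprS.
move=> x; apply: cvgM; last exact: cN.
by apply: cvgD; apply: cvgM; [exact: cst_continuous|exact: cX|exact: cst_continuous|exact: cX].
Qed.

Lemma integrable_E t : `[0, T]%classic t -> mu.-integrable `[0, t] (EFin \o E).
Proof.
move=> tI; apply: continuous_compact_integrable; first exact: segment_compact.
by apply: continuous_subspaceW continuous_E => s; exact: sub tI.
Qed.

Lemma E_ge0 t : 0 <= E t.
Proof.
by rewrite /E mulr_ge0 ?Nge0// addr_ge0// mulr_ge0 ?exprn_ge0 ?Nge0// ltW.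
Qed.

Lemma integral_majorant t : `[0, T]%classic t ->
  (\int[mu]_tau ((ker t tau 0)%:E * \int[mu3]_x H (tau, x)) <=
   (\int[mu]_(s in `[0%R, t]) E s)%:E + 2^-1%:E * \int[mu]_(s in `[0%R, t]) W s)%E.
Proof.
move=> tI; rewrite -integral_ker0.
have mI : measurable (`[0, t]%classic : set (measurableTypeR R)) by exact: measurable_itv.
have iE := integrable_E tI.
rewrite Rintegral_EFin// -ge0_integralZl_EFin//; last 2 first.
- by move=> s _; exact: W_ge0.
- exact: measurable_funTS measurable_W.
rewrite -ge0_integralD//; last 4 first.
- by move=> s _; rewrite lee_fin E_ge0.
- exact: measurable_int iE.
- by move=> s _; rewrite mule_ge0 ?W_ge0.
- by apply: measurable_funeM; exact: measurable_funTS measurable_W.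
apply: ge0_le_lower_integral => s sI.
  by apply: integral_ge0 => x _; exact: (H_ge0 m alpha0 U0).
by apply: majorant_mass; exact: sub tI sI.
Qed.

Lemma W_integral_sub t : `[0, T]%classic t -> (\int[mu]_(s in `[0%R, t]) W s < +oo)%E.
Proof.
move=> tI; apply: le_lt_trans W_integral; apply: ge0_subset_integral => //.
- exact: measurable_funTS measurable_W.
- by move=> s _; exact: W_ge0.
- by move=> s; exact: sub tI.
Qed.

(** Integrability in time of the $\mathcal X^2$ norm gives this a priori finiteness, which the
    pointwise bound presupposes. *)
Lemma majorant_finite : 0 <= T ->
  (\int[mu]_tau ((ker T tau 0)%:E * \int[mu3]_x H (tau, x)) < +oo)%E.
Proof.
move=> T0; have TI : `[0, T]%classic T by rewrite /= in_itv/= T0 lexx.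
apply: le_lt_trans (integral_majorant TI) _; apply: lte_add_pinfty; first exact: ltry.
apply: (@lte_mul_pinfty R 2^-1%:E); [by rewrite lee_fin invr_ge0|by []|exact: W_integral_sub].
Qed.

Let D s x := duhamel_bound (hatnorm u0 x) (enorm3 x ^+ 2) (fun tau => H (tau, x)) s.

Let mH : measurable_fun setT H := measurable_H alpha m mU U0.
Let H0 : forall z, (0 <= H z)%E := H_ge0 m alpha0 U0.

Lemma D_ge0 s x : (0 <= D s x)%E.
Proof.
apply: adde_ge0; first by rewrite lee_fin mulr_ge0 ?ker_ge0 ?hatnorm_ge0.
exact: (smear_ge0 s H0).
Qed.

Lemma measurable_D : measurable_fun setT (fun z : measurableTypeR R * mspace => D z.1 z.2).
Proof.
apply: emeasurable_funD; last exact: measurable_smear_joint.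
apply/measurable_EFinP; apply: measurable_funM.
  apply: measurable_ker => //; exact: measurable_sqr_enorm3.
exact: (measurableT_comp (measurable_hatnorm u0) measurable_snd).
Qed.

Lemma version_le_D s : `[0, T]%classic s -> {ae mu3, forall x, ((U (s, x))%:E <= D s x)%E}.
Proof.
move=> sI; have T0 : 0 <= T by move: sI; rewrite /= in_itv/= => /andP[]; exact: le_trans.
exact: (pointwise_bound alpha0 m1 hu0 inXu hD mU U0 aeU W_good (majorant_finite T0) sI).
Qed.

(** The bounds at time [t] and at earlier times are recombined at each frequency by
    [duhamel_bound_dissipation]. Bounding the norm and the dissipation separately, each by the full
    right-hand side, would double it. *)
Lemma dissipation_balance t : `[0, T]%classic t ->
  ((N t)%:E + \int[mu]_(s in `[0%R, t]) W s <=
   (Xnorm 0 u0)%:E + \int[mu]_tau ((ker t tau 0)%:E * \int[mu3]_x H (tau, x)))%E.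
Proof.
move=> tI; have t0 : 0 <= t by move: tI; rewrite /= in_itv/= => /andP[].
have me := measurable_sqr_enorm3 (@measurable_id _ mspace setT).
pose G (z : measurableTypeR R * mspace) := ((ker t z.1 0 * enorm3 z.2 ^+ 2)%:E * D z.1 z.2)%E.
have mG : measurable_fun setT G.
  apply: emeasurable_funM measurable_D; apply/measurable_EFinP; apply: measurable_funM.
    exact: measurable_ker.
  by apply: measurable_sqr_enorm3; exact: measurable_snd.
have G0 z : (0 <= G z)%E by rewrite mule_ge0 ?D_ge0// lee_fin mulr_ge0 ?ker_ge0 ?sqr_ge0.
pose K (z : measurableTypeR R * mspace) := ((ker t z.1 0)%:E * H z)%E.
have mK : measurable_fun setT K.
  by apply: emeasurable_funM => //; apply/measurable_EFinP; exact: measurable_ker.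
have K0 z : (0 <= K z)%E by rewrite mule_ge0// lee_fin ker_ge0.
have mDt : measurable_fun setT (D t : mspace -> \bar R).
  exact: (measurableT_comp measurable_D (pair1_measurable (t : measurableTypeR R))).
(* The right-hand side is rewritten as an integral over frequencies, where the identity for
   [duhamel_bound] applies. *)
have -> : ((Xnorm 0 u0)%:E + \int[mu]_tau ((ker t tau 0)%:E * \int[mu3]_x H (tau, x)) =
    \int[mu3]_x (D t x + \int[mu]_s G (s, x)))%E.
  have eK : (\int[mu]_tau ((ker t tau 0)%:E * \int[mu3]_x H (tau, x)) =
      \int[mu3]_x \int[mu]_tau K (tau, x))%E.
    rewrite -(@fubini_tonelli _ _ _ _ R mu mu3 K mK K0); apply: eq_integral => tau _.
    rewrite -ge0_integralZl_EFin ?ker_ge0//.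
    exact: (measurableT_comp mH (pair1_measurable tau)).
  rewrite eK Xnorm0E Rintegral_EFin//; last exact: integrable_hatnorm.
  transitivity (\int[mu3]_x ((hatnorm u0 x)%:E + \int[mu]_tau K (tau, x)))%E.
    apply/esym; apply: ge0_integralD => //.
    - by move=> x _; rewrite lee_fin hatnorm_ge0.
    - by apply/measurable_EFinP; exact: measurable_hatnorm.
    - by move=> x _; exact: integral_ge0.
    - exact: (@measurable_fun_fubini_tonelli_G _ _ _ _ R mu K mK K0).
  apply: eq_integral => x _; rewrite /D /G /K /=.
  rewrite duhamel_bound_dissipation ?hatnorm_ge0 ?sqr_ge0//; last exact: measurable_line.
  by rewrite /ker lexx t0 mulr0 expR0 mul1r.
have -> : (\int[mu3]_x (D t x + \int[mu]_s G (s, x)) =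
    \int[mu3]_x D t x + \int[mu]_s \int[mu3]_x G (s, x))%E.
  rewrite (@fubini_tonelli _ _ _ _ R mu mu3 G mG G0); apply: ge0_integralD => //.
  - by move=> x _; exact: D_ge0.
  - by move=> x _; exact: integral_ge0.
  - exact: (@measurable_fun_fubini_tonelli_G _ _ _ _ R mu G mG G0).
apply: leeD.
  rewrite -Xnorm_version//; apply: ae_ge0_le_integral => //.
  - by move=> x _; rewrite lee_fin.
  - by have [] := massU tI.
  - by move=> x _; exact: D_ge0.
  - by apply: ae_mono (version_le_D tI).
rewrite integral_ker0; apply: ge0_le_lower_integral => s _.
  by rewrite mule_ge0 ?W_ge0// lee_fin ker_ge0.
have [/andP[s0 st]|out] := boolP ((0 <= s) && (s <= t)); last first.
  by rewrite /ker (negbTE out) mul0e; apply: integral_ge0.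
have sI : `[0, T]%classic s by apply: (sub tI); rewrite /= in_itv/= s0.
have [/measurable_EFinP mUs _ _] := massU sI.
rewrite /W -ge0_integralZl_EFin ?ker_ge0//; last 2 first.
- by move=> x _; rewrite lee_fin mulr_ge0 ?sqr_ge0.
- by apply/measurable_EFinP; exact: measurable_funM.
apply: (@ae_ge0_le_integral _ _ _ mu3 setT measurableT _ (fun x => G (s, x))).
- by move=> x _; rewrite -EFinM lee_fin !mulr_ge0 ?ker_ge0 ?enorm3_ge0.
- by apply: measurable_funeM; apply/measurable_EFinP; exact: measurable_funM.
- by move=> x _; exact: G0.
- exact: (measurableT_comp mG (pair1_measurable (s : measurableTypeR R))).
- apply: ae_mono (version_le_D sI) => x hx _; rewrite /G /fst /snd -EFinM mulrA EFinM.
  by apply: lee_wpmul2l => //; rewrite lee_fin mulr_ge0 ?ker_ge0 ?sqr_ge0.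
Qed.

(** The integral of [W] is finite, so the half of it on the right can be subtracted; the nonnegative
    half remaining on the left is dropped. *)
Lemma norm_integral_inequality t : `[0, T]%classic t ->
  Xnorm 0 (u t) <= Xnorm 0 u0 + \int[mu]_(s in `[0, t]) E s.
Proof.
move=> tI; have Wf := W_integral_sub tI.
have W0 : (0 <= \int[mu]_(s in `[0%R, t]) W s)%E by apply: integral_ge0 => s _; exact: W_ge0.
have Wfin : (\int[mu]_(s in `[0%R, t]) W s)%E \is a fin_num by rewrite ge0_fin_numE.
have := le_trans (dissipation_balance tI) (leeD (lexx _) (integral_majorant tI)).
rewrite -(fineK Wfin) -EFinM -!EFinD lee_fin; move: W0; rewrite -{1}(fineK Wfin) lee_fin.
rewrite /N; lra.
Qed.

End EnergyInequality.

(** * Gronwall's lemma *)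

Section Gronwall.
Context {R : realType}.
Local Notation mu := (@lebesgue_measure R).

(** The right-hand side $P$ of the integral inequality is differentiable inside the interval even if
    $n$ is merely continuous. From $n\le P$ follows $P'=gn\le gP$, so $Pe^{-G}$ does not increase,
    where $G$ is the integral of $g$. *)
Lemma gronwall (t n0 : R) (g n : R -> R) : 0 <= t ->
  {within `[0, t], continuous g} -> {within `[0, t], continuous n} ->
  (forall s, 0 <= g s) ->
  (forall s, `[0, t]%classic s -> n s <= n0 + \int[mu]_(z in `[0, s]) (g z * n z)) ->
  n t <= n0 * expR (\int[mu]_(z in `[0, t]) g z).
Proof.
rewrite le_eqVlt => /predU1P[<-|t0] cg cn g0 h.
  have := h 0; rewrite set_itv1 !Rintegral_set1 expR0 mulr1 addr0; exact.
have cgn : {within `[0, t], continuous (fun z => g z * n z)}.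
  by move=> x; apply: cvgM; [exact: cg|exact: cn].
have ig : mu.-integrable `[0, t] (EFin \o g).
  by apply: continuous_compact_integrable => //; exact: segment_compact.
have ign : mu.-integrable `[0, t] (EFin \o (fun z => g z * n z)).
  by apply: continuous_compact_integrable => //; exact: segment_compact.
pose P s := n0 + \int[mu]_(z in `[0, s]) (g z * n z).
pose G s := \int[mu]_(z in `[0, s]) g z.
have [og _ _] := (continuous_within_itvP _ t0).1 cg.
have [ogn _ _] := (continuous_within_itvP _ t0).1 cgn.
have dG (x : R) : x \in `]0, t[ -> is_derive x 1 G (g x).
  move=> xI; move: (xI); rewrite in_itv/= => /andP[x0 xt].
  have [d e] := continuous_FTC1_closed xt ig x0 (og x xI).
  by split; [exact: d|rewrite -derive1E; exact: e].
have dP (x : R) : x \in `]0, t[ -> is_derive x 1 P (g x * n x).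
  move=> xI; move: (xI); rewrite in_itv/= => /andP[x0 xt].
  have [d e] := continuous_FTC1_closed xt ign x0 (ogn x xI).
  rewrite -[g x * n x]add0r; apply: is_deriveD; split; [exact: d|rewrite -derive1E; exact: e].
have dPG (x : R) : x \in `]0, t[ ->
    is_derive x 1 (fun s => P s * expR (- G s)) ((g x * n x - P x * g x) * expR (- G x)).
  move=> xI.
  have dE := @is_derive1_comp _ expR (fun s => - G s) x _ _ (is_derive_expR _) (is_deriveN (dG x xI)).
  apply: (is_derive_eq (is_deriveM (dP x xI) dE)).
  by rewrite /GRing.scale/=; ring.
have cPG : {within `[0, t], continuous (fun s => P s * expR (- G s))}.
  have cG := parameterized_integral_continuous (ltW t0) ig.
  have cP := parameterized_integral_continuous (ltW t0) ign.
  move=> x; apply: cvgM.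
    by apply: cvgD; [exact: cvg_cst|exact: cP].
  by apply: cvg_comp; [exact: (cvgN (cG x))|exact: continuous_expR].
have le : P t * expR (- G t) <= P 0 * expR (- G 0).
  apply: (@ler0_derive1_nincr R (fun s => P s * expR (- G s)) 0 t) => //; last exact: ltW.
  - by move=> x xI; have [] := dPG x xI.
  - move=> x xI; have := dPG x xI => dx; rewrite derive1E derive_val.
    have xI' : `[0, t]%classic x by apply: subset_itv_oo_cc.
    rewrite mulr_le0_ge0 ?expR_ge0// (mulrC (P x)) -mulrBr mulr_ge0_le0//.
    by rewrite subr_le0; exact: h.
have hI : `[0, t]%classic t by rewrite /= in_itv/= lexx ltW.
apply: le_trans (h t hI) _; rewrite -/(P t).
move: le; rewrite [X in _ <= X](_ : _ = n0); first by rewrite expRN ler_pdivrMr ?expR_gt0.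
by rewrite /P /G set_itv1 !Rintegral_set1 addr0 oppr0 expR0 mulr1.
Qed.

End Gronwall.

Theorem theorem1p2 (R : realType) (alpha : R) (m : nat) (u0 : vdist R)
    (Tstar : \bar R) (u : R -> vdist R)
    (halpha : 0 < alpha) (hm : (1 <= m)%N)
    (hu0 : inX 0 u0) (hdiv : div_free u0)
    (hu : maximal_solution alpha m u0 Tstar u) :
  forall t : R, 0 <= t -> (t%:E < Tstar)%E ->
    Xnorm 0 (u t) <=
      Xnorm 0 u0 *
      expR (\int[leb R]_(z in `[0, t])
              (2^-1 * Xnorm 0 (u z) ^+ 2 + alpha * Xnorm 0 (u z) ^+ (2 * m))).
Proof.
move=> t t0 tT; have [_ [hC hL hD] _] := hu.
(* Integrability of the $\mathcal X^2$ norm is given on [[0, T]] for [0 < T < Tstar]; a [T] beyond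
   [t] includes the case [t = 0]. *)
have [T [tT' T0 TT]] : exists T : R, [/\ t < T, 0 < T & (T%:E < Tstar)%E].
  case: Tstar tT {hu hC hL hD} => [r| |]//.
    rewrite lte_fin => tr; exists ((t + r) / 2); rewrite lte_fin.
    by split; lra.
  by move=> _; exists (t + 1); rewrite ltry; split => //; lra.
have sub s : `[0, T]%classic s -> 0 <= s /\ (s%:E < Tstar)%E.
  by rewrite /= in_itv/= => /andP[s0 sT]; split => //; apply: le_lt_trans TT; rewrite lee_fin.
have hCT : C_X 0 `[0, T] u.
  have [hI hc] := hC; split=> [s /sub|s /sub sI]; first exact: hI.
  apply: cvg_trans (hc s sI); apply: cvg_app; exact: within_subset.
have hDT : duhamel alpha m u0 `[0, T] u by move=> s /sub sI; exact: hD.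
have [_ hX2] := hL T T0 TT.
have [U [mU U0 aeU]] := joint_version hCT.
have sub' s : `[0, t]%classic s -> `[0, T]%classic s.
  by rewrite /= !in_itv/= => /andP[-> st]; rewrite (le_trans st (ltW tT')).
have key s : `[0, t]%classic s -> _ := fun sI =>
  norm_integral_inequality halpha hm hu0 hCT hDT hX2 mU U0 aeU (sub' s sI).
have cN : {within `[0, t], continuous (fun s => Xnorm 0 (u s))}.
  exact: continuous_subspaceW sub' (C_X_Xnorm_continuous hCT).
have cX n : {within `[0, t], continuous (fun s => Xnorm 0 (u s) ^+ n)}.
  elim: n => [|n IH] x; first exact: cst_continuous.
  rewrite (_ : (fun s => _) = (fun s => Xnorm 0 (u s) * Xnorm 0 (u s) ^+ n)).
    by apply: cvgM; [exact: cN|exact: IH].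
  by apply/funext => s; rewrite exprS.
apply: (@gronwall R t (Xnorm 0 u0) _ (fun s => Xnorm 0 (u s))) => //.
- move=> x; apply: cvgD; apply: cvgM.
  + exact: cst_continuous.
  + exact: cX.
  + exact: cst_continuous.
  + exact: cX.
- by move=> s; rewrite addr_ge0// mulr_ge0 ?exprn_ge0 ?Nge0// ltW.
Qed.
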